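(* Let $(M,g_0,\omega_1,\omega_2,\omega_3)$ be a hyperkähler 4-manifold. (a) Let $r,s$ be real constants with $r+st>0$ for any $t\in(a,b)$, where $a>0$, and set $$\tilde\omega_1=(r+st)\,\omega_1,\qquad u=t(r+st)^2 .$$ Then the 3-form $$\varphi=\tilde\omega_1\wedge(dy+\eta_N)+dt\wedge(dx+\xi_P)\wedge(dy+\eta_N)+t\Big(\omega_2\wedge(dx+\xi_P)+u\,\omega_3\wedge dt\Big)$$ defines a torsion-free $G_2$ structure on $(a,b)\times\mathbb{R}^2_{x,y}\times M'$, where $M'$ is a suitable open subset of $M$. (b) Suppose, furthermore, that $(M,g_0)$ admits an almost-Kähler structure $(\omega_0,I)$ compatible with the opposite orientation to the one induced by $(\omega_1,\omega_2,\omega_3)$. Let $p,q,r,s$ be real constants satisfying $r+st>|p+qt|$ for $t\in(a,b)$, $a>0$, and set $$\tilde\omega_1=(p+qt)\,\omega_0+(r+st)\,\omega_1,\qquad u=t\Big((r+st)^2-(p+qt)^2\Big).$$ Then the 3-form $\varphi$ given by the same formula as in (a) again defines a torsion-free $G_2$ structure on a manifold of the form $(a,b)\times\mathbb{R}^2_{x,y}\times M'$.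
   Context: A torsion-free $G_2$ structure on a 7-manifold is an admissible 3-form $\varphi$ (at each point linearly equivalent to $(e^{12}+e^{34}+e^{56})\wedge e^7+\mathrm{Re}\big((e^1+ie^2)\wedge(e^3+ie^4)\wedge(e^5+ie^6)\big)$ with $(e^i)$ an orthonormal oriented coframe, which determines a Riemannian metric, an orientation and a Hodge operator $*$) such that $d\varphi=0$ and $d{*\varphi}=0$. Hyperkähler 4-manifold: a Riemannian metric $g_0$ with parallel orthogonal complex structures $J_1,J_2,J_3$ satisfying the quaternion relations ($J_1J_2=J_3$), and $\omega_i(\cdot,\cdot)=g_0(J_i\cdot,\cdot)$; thus $\omega_i\wedge\omega_i=\omega_j\wedge\omega_j$ and $\omega_i\wedge\omega_j=0$ for $i\ne j$, and $\omega_2(\cdot,\cdot)=\omega_3(J_1\cdot,\cdot)$. An almost-Kähler structure $(\omega_0,I)$ on $(M,g_0)$ is a $g_0$-orthogonal almost-complex structure $I$ whose fundamental form $\omega_0(\cdot,\cdot)=g_0(I\cdot,\cdot)$ is closed; compatibility with the opposite orientation means $\omega_0\wedge\omega_0=-\omega_1\wedge\omega_1$. In the formula for $\varphi$: $t\in(a,b)$; $(x,y)$ are standard coordinates on $\mathbb{R}^2_{x,y}$; $\eta_N$ is a 1-form on $(a,b)\times\mathbb{R}_x\times M'$ with $d\eta_N=-\omega_2$; $\xi_P$ is a 1-form on $(a,b)\times M'$ with $d\xi_P=\tilde\omega_1'$, where $'=\partial/\partial t$ (so $d\xi_P=s\,\omega_1$ in case (a) and $d\xi_P=q\,\omega_0+s\,\omega_1$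 in case (b)). The open subset $M'$ is ''suitable'' if such 1-forms $\eta_N,\xi_P$ exist; it suffices to take $M'$ any contractible open subset of $M$. Forms on factors are identified with their pullbacks. *)

(* Defs.v *)
From HB Require Import structures.
From mathcomp Require Import all_boot all_order all_algebra perm.
From mathcomp Require Import all_classical all_reals all_analysis.
Set Implicit Arguments.
Unset Strict Implicit.
Unset Printing Implicit Defensive.
Import Order.TTheory GRing.Theory Num.Theory.
Import numFieldNormedType.Exports.
Local Open Scope classical_set_scope.
Local Open Scope ring_scope.

(* Used for open U only. *)
Fixpoint Ck (R : realType) (n k : nat) (U : set 'rV[R]_n) (f : 'rV[R]_n -> R)
    : Prop :=
  if k is k'.+1 then
    (forall z, U z -> differentiable f z) /\ (forall v, Ck k' U ('D_v f))
  else forall z, U z -> {for z, continuous f}.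

Definition smooth (R : realType) (n : nat) (U : set 'rV[R]_n)
  (f : 'rV[R]_n -> R) : Prop := forall k, Ck k U f.

Definition smooth_map (R : realType) (n m : nat) (U : set 'rV[R]_n)
  (f : 'rV[R]_n -> 'rV[R]_m) : Prop := forall j, smooth U (fun z => f z 0 j).

(* A k-tuple of vectors of R^n is a k x n matrix, one vector per row. *)
Definition mform (R : realType) (k n : nat) : Type := 'M[R]_(k, n) -> R.

Definition multilinear_form (R : realType) (k n : nat) (w : mform R k n) :=
  forall (A B C : 'M[R]_(k, n)) (i : 'I_k) (b c : R),
    row i A = b *: row i B + c *: row i C ->
    row' i B = row' i A -> row' i C = row' i A ->
    w A = b * w B + c * w C.

Definition alternating_form (R : realType) (k n : nat) (w : mform R k n) :=
  multilinear_form w /\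
  forall (A : 'M[R]_(k, n)) (i j : 'I_k), i != j -> row i A = row j A -> w A = 0.

(* Normalised so that a /\ b = a (x) b - b (x) a for 1-forms. *)
Definition wedge (R : realType) (k l n : nat) (a : mform R k n) (b : mform R l n)
    : mform R (k + l) n :=
  fun v => ((k`! * l`!)%:R)^-1 *
    \sum_(s : 'S_(k + l))
      (-1) ^+ s * (a (usubmx (row_perm s v)) * b (dsubmx (row_perm s v))).

Notation "a ∧ b" := (wedge a b) (at level 39, left associativity).

(* The exterior derivative in a chart, evaluated on constant vector fields:
   the Lie bracket terms of the invariant formula vanish. *)
Definition exd (R : realType) (k n : nat) (w : 'rV[R]_n -> mform R k n)
    : 'rV[R]_n -> mform R k.+1 n :=
  fun z v => \sum_(i < k.+1)
    (-1) ^+ i * 'D_(row i v) (fun z' => w z' (row' i v)) z.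

(* The columns of e are a coframe: the j-th covector is v |-> (v *m e) 0 j. *)
Definition covec (R : realType) (n : nat) (e : 'M[R]_n) (j : 'I_n) : mform R 1 n :=
  fun v => (v *m e) 0 j.

(* The Hodge star of the metric and the orientation for which the coframe e is
   orthonormal and oriented. The dual frame is given by the rows of [invmx e]
   and the volume form by w |-> \det (w *m e). *)
Definition hodge (R : realType) (k l : nat) (e : 'M[R]_(k + l))
    (a : mform R k (k + l)) : mform R l (k + l) :=
  fun v => (k`!%:R)^-1 *
    \sum_(s : {ffun 'I_k -> 'I_(k + l)})
      a (rowsub s (invmx e)) * \det (col_mx (rowsub s (invmx e)) v *m e).

(* (e^12 + e^34 + e^56) /\ e^7
     + Re ((e^1 + i e^2) /\ (e^3 + i e^4) /\ (e^5 + i e^6)),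
   with the real part expanded. *)
Definition g2_form (R : realType) (e : 'M[R]_7) : mform R 3 7 :=
  let e1 := covec e (@Ordinal 7 0 isT) in
  let e2 := covec e (@Ordinal 7 1 isT) in
  let e3 := covec e (@Ordinal 7 2 isT) in
  let e4 := covec e (@Ordinal 7 3 isT) in
  let e5 := covec e (@Ordinal 7 4 isT) in
  let e6 := covec e (@Ordinal 7 5 isT) in
  let e7 := covec e (@Ordinal 7 6 isT) in
  (e1 ∧ e2 \+ e3 ∧ e4 \+ e5 ∧ e6) ∧ e7 \+
  ((e1 ∧ e3 ∧ e5 \- e1 ∧ e4 ∧ e6) \- e2 ∧ e3 ∧ e6 \- e2 ∧ e4 ∧ e5).

Definition g2_coframe (R : realType) (phi : mform R 3 7) (e : 'M[R]_7) : Prop :=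
  e \in unitmx /\ phi = g2_form e.

Definition g2_admissible (R : realType) (phi : mform R 3 7) : Prop :=
  exists e : 'M[R]_7, g2_coframe phi e.

(* psi is the Hodge dual of phi for the metric and the orientation determined
   by phi. Two coframes adapted to phi differ by an element of the stabiliser
   G_2 of the model form, which lies in SO(7), so psi does not depend on e. *)
Definition g2_dual (R : realType) (phi : mform R 3 7) (psi : mform R 4 7) : Prop :=
  exists2 e : 'M[R]_7, g2_coframe phi e & psi = @hodge R 3 4 e phi.

(* [coord i] and [param i] are the i-th chart and its inverse; only their values
   on [dom i] and on [coord i @` dom i] are meaningful. *)
Record manifold (R : realType) (n : nat) := Manifold {
  pts :> topologicalType;
  pts_hausdorff : hausdorff_space pts;
  pts_second_countable : @second_countable pts;
  charts : Type;
  dom : charts -> set pts;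
  coord : charts -> pts -> 'rV[R]_n;
  param : charts -> 'rV[R]_n -> pts;
  dom_open : forall i, open (dom i);
  dom_cover : forall p, exists i, dom i p;
  coord_open : forall i, open (coord i @` dom i);
  coordK : forall i p, dom i p -> param i (coord i p) = p;
  coord_cont : forall i p, dom i p -> {for p, continuous (coord i)};
  param_cont : forall i z, (coord i @` dom i) z -> {for z, continuous (param i)};
  transition_smooth : forall i j,
    smooth_map (coord i @` (dom i `&` dom j)) (coord j \o param i)
}.
Arguments charts {R n} m.
Arguments dom {R n} m.
Arguments coord {R n} m.
Arguments param {R n} m.

(* The part of a subset W that lies in the i-th chart, seen in R^n. *)
Definition chart_set (R : realType) (n : nat) (M : manifold R n) (W : set M)
  (i : charts M) : set 'rV[R]_n := coord M i @` (dom M i `&` W).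

Definition transition (R : realType) (n : nat) (M : manifold R n)
  (i j : charts M) : 'rV[R]_n -> 'rV[R]_n := coord M j \o param M i.

(* A tensor field is the family of its expressions in the charts of the atlas,
   subject to the transformation law. Vectors are rows, so that the differential
   of f at z is v |-> v *m 'J f z. *)

Definition form_field (R : realType) (n : nat) (M : manifold R n) (k : nat) : Type :=
  charts M -> 'rV[R]_n -> mform R k n.

Definition is_form (R : realType) (n : nat) (M : manifold R n) (k : nat)
    (W : set M) (w : form_field M k) : Prop :=
  [/\ forall i z, chart_set W i z -> alternating_form (w i z),
      forall i v, smooth (chart_set W i) (fun z => w i z v) &
      forall i j z v, chart_set (W `&` dom M j) i z ->
        w i z v = w j (transition i j z) (v *m 'J (transition i j) z)].

Definition form_eq (R : realType) (n : nat) (M : manifold R n) (k : nat)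
    (W : set M) (w w' : form_field M k) : Prop :=
  forall i z, chart_set W i z -> w i z = w' i z.

Definition ext_d (R : realType) (n : nat) (M : manifold R n) (k : nat)
  (w : form_field M k) : form_field M k.+1 := fun i => exd (w i).

Definition form_closed (R : realType) (n : nat) (M : manifold R n) (k : nat)
    (W : set M) (w : form_field M k) : Prop :=
  form_eq W (ext_d w) (fun _ _ _ => 0).

Definition mx_field (R : realType) (n : nat) (M : manifold R n) : Type :=
  charts M -> 'rV[R]_n -> 'M[R]_n.

Definition mx_field_smooth (R : realType) (n : nat) (M : manifold R n)
    (A : mx_field M) : Prop :=
  forall i k l, smooth (chart_set setT i) (fun z => A i z k l).

(* g(v, w) = v *m g *m w^T *)
Definition is_riemannian (R : realType) (n : nat) (M : manifold R n)
    (g : mx_field M) : Prop :=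
  [/\ mx_field_smooth g,
      forall i z, chart_set setT i z -> (g i z)^T = g i z,
      forall i z (v : 'rV[R]_n), chart_set setT i z -> v != 0 ->
        0 < (v *m g i z *m v^T) 0 0 &
      forall i j z, chart_set (dom M j) i z ->
        let D := 'J (transition i j) z in
        g i z = D *m g j (transition i j z) *m D^T].

(* J v = v *m J; the composite J o K is thus the matrix product K *m J. *)
Definition is_endo (R : realType) (n : nat) (M : manifold R n)
    (J : mx_field M) : Prop :=
  mx_field_smooth J /\
  forall i j z, chart_set (dom M j) i z ->
    let D := 'J (transition i j) z in
    J i z *m D = D *m J j (transition i j z).

(* Integrability is not required: it follows from [parallel], which [hyperkahler]
   adds, and is not part of an almost-Kahler structure. *)
Definition orthogonal_acs (R : realType) (n : nat) (M : manifold R n)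
    (g J : mx_field M) : Prop :=
  [/\ is_endo J,
      forall i z, chart_set setT i z -> J i z *m J i z = - 1%:M &
      forall i z, chart_set setT i z -> J i z *m g i z *m (J i z)^T = g i z].

(* g(J v_0, v_1) *)
Definition fund_form (R : realType) (n : nat) (M : manifold R n)
    (g J : mx_field M) : form_field M 2 :=
  fun i z v => (row 0 v *m J i z *m g i z *m (row 1 v)^T) 0 0.

(* The Levi-Civita derivative of the constant vector field w along u, from the
   Koszul formula for constant fields. *)
Definition christoffel (R : realType) (n : nat) (g : 'rV[R]_n -> 'M[R]_n)
    (z u w : 'rV[R]_n) : 'rV[R]_n :=
  let ip (a b : 'rV[R]_n) := fun z' => (a *m g z' *m b^T) 0 0 in
  (\row_j (2^-1 * ('D_u (ip w (delta_mx 0 j)) z + 'D_w (ip u (delta_mx 0 j)) z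
                   - 'D_(delta_mx 0 j) (ip u w) z))) *m invmx (g z).

(* (nabla_u J) w = nabla_u (J w) - J (nabla_u w) for constant w *)
Definition cov_deriv (R : realType) (n : nat) (g J : 'rV[R]_n -> 'M[R]_n)
    (z u w : 'rV[R]_n) : 'rV[R]_n :=
  (\row_j 'D_u (fun z' => (w *m J z') 0 j) z) + christoffel g z u (w *m J z)
  - christoffel g z u w *m J z.

Definition parallel (R : realType) (n : nat) (M : manifold R n)
    (g J : mx_field M) : Prop :=
  forall i z u w, chart_set setT i z -> cov_deriv (g i) (J i) z u w = 0.

Definition hyperkahler (R : realType) (M : manifold R 4)
    (g J1 J2 J3 : mx_field M) : Prop :=
  [/\ is_riemannian g,
      [/\ orthogonal_acs g J1, orthogonal_acs g J2 & orthogonal_acs g J3],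
      [/\ parallel g J1, parallel g J2 & parallel g J3] &
      forall i z, chart_set setT i z -> J2 i z *m J1 i z = J3 i z].

Definition almost_kahler (R : realType) (n : nat) (M : manifold R n)
    (g I : mx_field M) : Prop :=
  orthogonal_acs g I /\ form_closed setT (fund_form g I).

Lemma rV_second_countable (R : realType) (m : nat) :
  @second_countable 'rV[R]_m.
Proof.
pose b (q : 'rV[rat]_m * nat) : set 'rV[R]_m :=
  (ball (map_mx ratr q.1 : 'rV[R]_m) (q.2.+1%:R^-1))°.
exists (range b); first exact: sub_countable (card_image_le _ _) (countableP _).
split; first by move=> _ [q _ <-]; exact: open_interior.
move=> x V /nbhs_ballP[_/posnumP[eps] xV].
have [//|k] := @ltr_add_invr R 0%R (eps%:num / 2) _; rewrite add0r => keps.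
pose h : R := k.+1%:R^-1 / 2.
have h0 : 0 < h by rewrite divr_gt0// invr_gt0.
have hk : h < k.+1%:R^-1 by rewrite /h ltr_pdivrMr// ltr_pMr// ltr1n.
have [q qx] : exists q : 'rV[rat]_m, forall j, `|x 0 j - ratr (q 0 j)| < h.
  have /choice[f fx] : forall j, exists r : rat, `|x 0 j - ratr r| < h.
    move=> j; have /rat_in_itvoo[r /itvP rx] : x 0 j - h < x 0 j + h.
      by rewrite ltrBlDr -addrA ltrDl addr_gt0.
    by exists r; rewrite ltr_distl ltrBlDr -[x 0 j < _]ltrBlDr !rx.
  by exists (\row_j f j) => j; rewrite mxE.
have bh (y : 'rV[R]_m) : (forall j, `|y 0 j - ratr (q 0 j)| < h) -> b (q, k) y.
  move=> yq; rewrite /b /interior /=; apply/nbhs_ballP; exists h => //= z [_ yz].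
  split => [|i j]; first by rewrite invr_gt0.
  rewrite ord1 mxE /ball /= (le_lt_trans (ler_distD (y 0 j) _ _))//.
  rewrite [ltRHS](splitr k.+1%:R^-1) ltrD//; first by rewrite distrC; exact: yq.
  exact: (yz 0 j).
exists (b (q, k)); first by split; [exists (q, k)|exact: bh].
move=> z bz; apply: xV.
rewrite [eps%:num]splitr; apply: (@ball_triangle _ _ (map_mx ratr q : 'rV[R]_m)).
  split => [|i j]; first by rewrite divr_gt0.
  rewrite !ord1 mxE; apply: lt_trans (qx j) _.
  exact: lt_trans hk _.
by apply: (le_ball (ltW keps)); exact: interior_subset bz.
Qed.

Lemma Ck_cst (R : realType) (n k : nat) (U : set 'rV[R]_n) (c : R) :
  Ck k U (fun=> c).
Proof.
elim: k c => [|k IHk] c /=; first by move=> z _; exact: cst_continuous.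
split => [z _|v]; first exact: differentiable_cst.
rewrite (_ : 'D_v _ = fun=> 0)//; apply/funext => z.
exact: (derive_cst c z v).
Qed.

Lemma Ck_coord (R : realType) (n k : nat) (U : set 'rV[R]_n) (j : 'I_n) :
  Ck k U (fun z => z 0 j).
Proof.
case: k => [|k] /=; first by move=> z _; exact: coord_continuous.
have df z : differentiable (fun z : 'rV[R]_n => z 0 j) z.
  exact: differentiable_coord.
split => // v; rewrite (_ : 'D_v _ = fun=> v 0 j); first exact: Ck_cst.
apply/funext => z; apply: cvg_lim => //; apply: cvg_near_cst.
near=> h; rewrite /= !mxE addrK /GRing.scale /= mulKf//.
by near: h; exact: nbhs_dnbhs_neq.
Unshelve. all: by end_near. Qed.

Lemma Ck_rsubmx (R : realType) (m n k : nat) (U : set 'rV[R]_n)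
    (f : 'rV[R]_n -> R) :
  Ck k U f -> Ck k [set z : 'rV[R]_(m + n) | U (rsubmx z)] (f \o rsubmx).
Proof.
elim: k f => [|k IHk] f /=.
  move=> cf z Uz; apply: continuous_comp; last exact: cf.
  exact: continuous_rsubmx.
move=> [df cf]; split => [z Uz|v].
  by apply: differentiable_comp; [exact: differentiable_rsubmx|exact: df].
rewrite (_ : 'D_v _ = 'D_(rsubmx v) f \o rsubmx); first exact: IHk.
by apply/funext => z; rewrite /derive /=; under eq_fun do rewrite linearP.
Qed.

Section ProductManifold.
Context (R : realType) (m n : nat) (M : manifold R n).

Local Notation P := ('rV[R]_m * M)%type.

Definition prod_dom (i : charts M) : set P := [set q | dom M i q.2].
Definition prod_coord (i : charts M) (q : P) : 'rV[R]_(m + n) :=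
  row_mx q.1 (coord M i q.2).
Definition prod_param (i : charts M) (z : 'rV[R]_(m + n)) : P :=
  (lsubmx z, param M i (rsubmx z)).

Lemma prod_domE i (A : set M) :
  prod_coord i @` (prod_dom i `&` [set q | A q.2]) =
  [set z | (coord M i @` (dom M i `&` A)) (rsubmx z)].
Proof.
apply/seteqP; split => z /=.
  by move=> [[x p] /= [dp Ap] <-]; rewrite /prod_coord row_mxKr; exists p.
move=> [p [dp Ap] pz]; exists (lsubmx z, p) => //.
by rewrite /prod_coord /= pz hsubmxK.
Qed.

Lemma prod_hausdorff : hausdorff_space P.
Proof.
move=> [x p] [y q] cl; congr pair.
- apply: norm_hausdorff => A B Ax By.
  have [||[a b] [[? ?] [? ?]]] := cl (A `*` setT) (B `*` setT).
  + by exists (A, setT) => //=; split => //; exact: filterT.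
  + by exists (B, setT) => //=; split => //; exact: filterT.
  + by exists a.
- apply: (@pts_hausdorff R n M) => A B Ax By.
  have [||[a b] [[? ?] [? ?]]] := cl (setT `*` A) (setT `*` B).
  + by exists (setT, A) => //=; split => //; exact: filterT.
  + by exists (setT, B) => //=; split => //; exact: filterT.
  + by exists b.
Qed.

Lemma prod_second_countable : @second_countable P.
Proof.
have [B cB [oB bB]] := rV_second_countable R m.
have [C cC [oC bC]] := @pts_second_countable R n M.
exists ((fun AD => AD.1 `*` AD.2) @` (B `*` C)).
  exact: sub_countable (card_image_le _ _) (countableX cB cC).
split=> [_ [[A D] /= [BA CD] <-]|[x p] V [[E F] /= [xE pF] EFV]].
  rewrite openE => -[y q] /= [Ay Dq]; exists (A, D) => //=.
  by split; apply: open_nbhs_nbhs; split => //; [exact: oB|exact: oC].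
have [A [BA Ax] AE] := bB x E xE.
have [D [CD Dp] DF] := bC p F pF.
exists (A `*` D); first by split => //; exists (A, D).
by move=> [y q] /= [/AE ? /DF ?]; exact: EFV.
Qed.

Lemma prod_dom_open i : open (prod_dom i).
Proof.
apply: open_comp => [q _|]; last exact: dom_open.
exact: cvg_snd.
Qed.

Lemma prod_dom_cover q : exists i, prod_dom i q.
Proof. by have [i ?] := dom_cover q.2; exists i. Qed.

Lemma prod_coord_open i : open (prod_coord i @` prod_dom i).
Proof.
have := prod_domE i setT; rewrite -[[set q | _]]/setT !setIT => ->.
apply: open_comp => [z _|]; last exact: coord_open.
exact: continuous_rsubmx.
Qed.

Lemma prod_coordK i q : prod_dom i q -> prod_param i (prod_coord i q) = q.
Proof.
by case: q => x p dp; rewrite /prod_param /prod_coord row_mxKl row_mxKr coordK.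
Qed.

Lemma prod_coord_cont i q : prod_dom i q -> {for q, continuous (prod_coord i)}.
Proof.
case: q => x p /= dp A /nbhs_ballP[e e0 eA].
exists (ball x e, coord M i @^-1` ball (coord M i p) e).
  split => /=; first exact: nbhsx_ballx.
  by apply: (coord_cont dp); exact: nbhsx_ballx.
move=> [y q] /= [[_ xy] [_ pq]]; apply: eA; split => // k l.
rewrite /prod_coord !mxE; case: (fintype.split l) => j; [exact: xy|exact: pq].
Qed.

Lemma prod_param_cont i z : (prod_coord i @` prod_dom i) z ->
  {for z, continuous (prod_param i)}.
Proof.
have := prod_domE i setT; rewrite -[[set q | _]]/setT !setIT => -> zi.
have pc : {for z, continuous (param M i \o rsubmx)}.
  exact: (continuous_comp (@continuous_rsubmx R 1 m n z) (param_cont zi)).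
move=> A [[E F] /= [zE zF] EFA].
have lE : nbhs z [set y | E (lsubmx y)] by exact: (continuous_lsubmx zE).
have rF : nbhs z [set y | F (param M i (rsubmx y))] by exact: (pc _ zF).
by apply: filterS (filterI lE rF) => y [yE yF]; exact: (EFA (lsubmx y, _)).
Qed.

Lemma prod_transition_smooth i j :
  smooth_map (prod_coord i @` (prod_dom i `&` prod_dom j))
    (prod_coord j \o prod_param i).
Proof.
rewrite [prod_dom j](_ : _ = [set q | dom M j q.2])// prod_domE => l k.
rewrite (_ : (fun z => _) = fun z : 'rV[R]_(m + n) =>
  match fintype.split l with
  | inl a => z 0 (lshift n a)
  | inr a => (coord M j (param M i (rsubmx z))) 0 a
  end); last first.
  apply/funext => z; rewrite /prod_coord /= mxE.
  by case: (fintype.split l) => a //; rewrite mxE.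
case: (fintype.split l) => a; first exact: Ck_coord.
exact: Ck_rsubmx (@transition_smooth R n M i j a k).
Qed.

Definition prod_manifold : manifold R (m + n) :=
  @Manifold R (m + n) P prod_hausdorff prod_second_countable (charts M)
    prod_dom prod_coord prod_param prod_dom_open prod_dom_cover prod_coord_open
    prod_coordK prod_coord_cont prod_param_cont prod_transition_smooth.

End ProductManifold.

Arguments prod_manifold {R} m {n} M.

Section ProductForms.
Context (R : realType) (n : nat) (M : manifold R n).

(* Pullback along the projection R^m x M -> M. *)
Definition pull_base (m k : nat) (w : form_field M k) :
    form_field (prod_manifold m M) k :=
  fun i z v => w i (rsubmx z) (rsubmx v).

(* Pullback along the projection R^m x M -> R^l x M onto the first l Euclidean
   coordinates, for l <= m. *)
Definition pull_prod (m l k : nat) (w : form_field (prod_manifold l M) k) :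
    form_field (prod_manifold m M) k :=
  let A : 'M[R]_(m + n, l + n) := block_mx (pid_mx l) 0 0 1%:M in
  fun i z v => w i (z *m A) (v *m A).

Definition dcoord (m : nat) (j : 'I_m) : mform R 1 (m + n) :=
  fun v => v 0 (lshift n j).

(* (a, b) x R^m x M' *)
Definition slab (m : nat) (a : R) (b : \bar R) (M' : set M) :
    set (prod_manifold m.+1 M) :=
  [set q : 'rV[R]_m.+1 * M |
    [/\ a < q.1 0 0, ((q.1 0 0)%:E < b)%E & M' q.2]].

End ProductForms.
Arguments pull_base {R n M} m {k} w.
Arguments pull_prod {R n M} m {l k} w.
Arguments dcoord {R} n {m} j.
Arguments slab {R n M} m a b M'.

Definition g2_structure (R : realType) (N : manifold R 7) (W : set N)
    (phi : form_field N 3) : Prop :=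
  is_form W phi /\ forall i z, chart_set W i z -> g2_admissible (phi i z).

Definition torsion_free_g2 (R : realType) (N : manifold R 7) (W : set N)
    (phi : form_field N 3) : Prop :=
  [/\ g2_structure W phi,
      form_closed W phi &
      exists psi : form_field N 4,
        [/\ is_form W psi,
            forall i z, chart_set W i z -> g2_dual (phi i z) (psi i z) &
            form_closed W psi]].

(* The Euclidean coordinates of R^3 x M are (t, x, y). *)
Definition time (R : realType) (z : 'rV[R]_(3 + 4)) : R := z 0 (lshift 4 0).

Definition g2_ansatz (R : realType) (M : manifold R 4)
    (tw1 : form_field (prod_manifold 3 M) 2) (w2 w3 : form_field M 2) (u : R -> R)
    (etaN : form_field (prod_manifold 2 M) 1)
    (xiP : form_field (prod_manifold 1 M) 1) : form_field (prod_manifold 3 M) 3 :=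
  fun i z =>
    let t := time z in
    let dt : mform R 1 (3 + 4) := dcoord 4 (@Ordinal 3 0 isT) in
    let dx : mform R 1 (3 + 4) := dcoord 4 (@Ordinal 3 1 isT) in
    let dy : mform R 1 (3 + 4) := dcoord 4 (@Ordinal 3 2 isT) in
    let thx : mform R 1 (3 + 4) := dx \+ pull_prod 3 xiP i z in
    let thy : mform R 1 (3 + 4) := dy \+ pull_prod 3 etaN i z in
    tw1 i z ∧ thy \+ dt ∧ thx ∧ thy \+
    t \*o (pull_base 3 w2 i z ∧ thx \+ u t \*o (pull_base 3 w3 i z ∧ dt)).

(* dtw1 stands for the t-derivative of the family tw1 of 2-forms on M, which is
   affine in t, so that dtw1 does not depend on t. *)
Definition suitable (R : realType) (M : manifold R 4) (a : R) (b : \bar R)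
    (M' : set M) (w2 dtw1 : form_field M 2)
    (etaN : form_field (prod_manifold 2 M) 1)
    (xiP : form_field (prod_manifold 1 M) 1) : Prop :=
  [/\ open M',
      is_form (slab 1 a b M') etaN,
      form_eq (slab 1 a b M') (ext_d etaN) (fun i z v => - pull_base 2 w2 i z v),
      is_form (slab 0 a b M') xiP &
      form_eq (slab 0 a b M') (ext_d xiP) (pull_base 1 dtw1)].

(* Main.v *)
From HB Require Import structures.
Require Import Defs.
From mathcomp Require Import all_boot all_order all_algebra fingroup perm.
From mathcomp Require Import all_classical all_reals all_analysis.
From mathcomp Require Import ring lra.
Set Implicit Arguments.
Unset Strict Implicit.
Unset Printing Implicit Defensive.
Import Order.TTheory GRing.Theory Num.Theory.
Import numFieldNormedType.Exports.
Local Open Scope classical_set_scope.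
Local Open Scope ring_scope.

(** The two families are one family in two guises: (a) is (b) with p = q = 0, where
    the term in omega_0 is absent. So put h = r + s t, P = p + q t and D^2 = h^2 - P^2,
    and write theta_x = dx + xi_P, theta_y = dy + eta_N.

    Admissibility is a matter of finding the right coframe at each point. A unit
    vector and its images under J_1, J_2, J_3 form an orthonormal frame of M, with
    dual coframe f_0, f_1, f_2, f_3, in which
<<
      omega_1 = f_01 + f_23,  omega_2 = f_02 - f_13,  omega_3 = f_03 + f_12.
>>
    In case (b) the condition on the orientation says that the fundamental form of
    I is anti-self-dual, so that I commutes with J_1 and the vector can be chosen
    with I e = J_1 e ([almost_kahler_frame]); then omega_0 = f_01 - f_23, and
    tilde omega_1 = (h + P) f_01 + (h - P) f_23. The coframe
<<
      al f_0, al f_1, be f_2, be f_3, theta_x / D, - t D dt, theta_y / t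
      with al^2 = t (h + P), be^2 = t (h - P), hence al be = t D,
>>
    turns phi into the model form ([ansatz_coframe]): all coefficients agree, the last
    one being al be t D = t u, which is where the value of u comes from. The Hodge
    dual of the model form is computed monomial by monomial ([hodge_g2_form]), and
    in the same coframe it reads
<<
      psi = 1/2 t^2 D^2 omega_1 omega_1 + t^2 tilde omega_1 dt theta_x
            - t D^2 omega_2 dt theta_y + omega_3 theta_x theta_y.
>>

    Closedness of phi and psi then follows from the graded Leibniz rule
    ([exd_wedge]) and the following facts. The omega_i are closed because the J_i are
    parallel for the Levi-Civita connection, which is torsion-free
    ([parallel_closed]); omega_0 is closed by assumption. The curvatures are
    d theta_x = tilde omega_1' and d theta_y = - omega_2. Products of distinct
    omega_i vanish, omega_i omega_i = omega_1 omega_1 for i = 1, 2, 3 and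
    omega_0 omega_0 = - omega_1 omega_1, so that tilde omega_1 tilde omega_1'
    = 1/2 (D^2)' omega_1 omega_1. The terms of d phi cancel in pairs
    ([ansatz_closed]), and d psi reduces to the multiple
    1/2 (t^2 D^2)' - 1/2 t^2 (D^2)' - t D^2 = 0 of dt omega_1 omega_1
    ([ansatz_coclosed]). *)

(** * Smooth functions *)

Section Smooth.
Context (R : realType) (n : nat).
Implicit Types (U V : set 'rV[R]_n) (f g : 'rV[R]_n -> R).

Lemma Ck_sub k U V f : V `<=` U -> Ck k U f -> Ck k V f.
Proof.
move=> VU; elim: k f => [|k IHk] f /=; first by move=> cf z /VU; exact: cf.
by move=> [df cf]; split => [z /VU|v]; [exact: df|exact: IHk].
Qed.

Lemma Ck_differentiable k U f z : Ck k.+1 U f -> U z -> differentiable f z.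
Proof. by move=> [df _]; exact: df. Qed.

Lemma CkW k U f : Ck k.+1 U f -> Ck k U f.
Proof.
elim: k f => [|k IHk] f.
  by move=> [df _] z Uz; apply: differentiable_continuous; exact: df.
by move=> [df cf]; split => // v; apply: IHk; exact: cf.
Qed.

Lemma near_eq_differentiable f g z :
  (\forall y \near z, f y = g y) -> differentiable f z -> differentiable g z.
Proof.
move=> fg /diff_locallyP[dfc /eqaddoP dfo].
have dgo : g \o shift z = cst (g z) + 'd f z +o_ 0 id.
  apply/eqaddoP => e e0; have := dfo e e0.
  have fg0 : \forall h \near (0 : 'rV[R]_n), f (h + z) = g (h + z).
    by have := fg; rewrite (near_shift 0 z) /= subr0.
  apply: filterS2 fg0 => h /=.
  by rewrite !fctE /= (nbhs_singleton fg) => ->.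
have dgE := diff_unique dfc dgo.
by apply/diff_locallyP; rewrite dgE.
Qed.

Lemma Ck_eq k U f g : open U -> (forall z, U z -> f z = g z) ->
  Ck k U f -> Ck k U g.
Proof.
move=> oU.
have near_fg h1 h2 z : (forall y, U y -> h1 y = h2 y) -> U z ->
    \forall y \near z, h1 y = h2 y :> R.
  by move=> fg Uz; apply: filterS (open_nbhs_nbhs (conj oU Uz)) => y /fg.
elim: k f g => [|k IHk] f g fg /=.
  move=> cf z Uz; rewrite /prop_for /continuous_at -fg//.
  apply: cvg_trans (cf z Uz).
  by apply: (@near_eq_cvg _ _ (nbhs z)); exact: (near_fg _ _ _ fg Uz).
move=> [df cf]; split => [z Uz|v].
  by apply: near_eq_differentiable (df z Uz); exact: near_fg fg Uz.
apply: IHk (cf v) => z Uz.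
by apply: near_eq_derive; exact: near_fg fg Uz.
Qed.

Lemma Ck_ext k U f g : f =1 g -> Ck k U f -> Ck k U g.
Proof. by move=> /funext ->. Qed.

Lemma CkD k U f g : open U -> Ck k U f -> Ck k U g -> Ck k U (f \+ g).
Proof.
move=> oU; elim: k f g => [|k IHk] f g.
  by move=> cf cg z Uz; exact: (@continuousD _ _ _ _ _ _ (cf z Uz) (cg z Uz)).
move=> [df cf] [dg cg]; split => [z Uz|v].
  by apply: differentiableD; [exact: df|exact: dg].
apply: (@Ck_eq _ _ ('D_v f \+ 'D_v g)) (IHk _ _ (cf v) (cg v)) => // z Uz.
by rewrite /= deriveD//; apply: diff_derivable; [exact: df|exact: dg].
Qed.

Lemma CkM k U f g : open U -> Ck k U f -> Ck k U g -> Ck k U (f \* g).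
Proof.
move=> oU; elim: k f g => [|k IHk] f g.
  by move=> cf cg z Uz; exact: (@continuousM _ _ _ _ _ (cf z Uz) (cg z Uz)).
move=> kf kg; have [df cf] := kf; have [dg cg] := kg; split => [z Uz|v].
  by apply: differentiableM; [exact: df|exact: dg].
apply: (@Ck_eq _ _ ((f \* 'D_v g) \+ (g \* 'D_v f))) => //.
  move=> z Uz.
  by rewrite /= deriveM//; apply: diff_derivable; [exact: df|exact: dg].
by apply: CkD => //; apply: IHk; [exact: CkW|exact: cg|exact: CkW|exact: cf].
Qed.

Lemma smooth_differentiable U f z : smooth U f -> U z -> differentiable f z.
Proof. by move=> sf; exact: Ck_differentiable (sf 1%N). Qed.

Lemma smooth_derivable U f z v : smooth U f -> U z -> derivable f z v.
Proof. by move=> sf Uz; apply: diff_derivable; exact: smooth_differentiable Uz. Qed.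

Lemma smooth_sub U V f : V `<=` U -> smooth U f -> smooth V f.
Proof. by move=> VU sf k; exact: Ck_sub VU (sf k). Qed.

Lemma smooth_cst U c : smooth U (fun=> c).
Proof. by move=> k; exact: Ck_cst. Qed.

Lemma smooth_coord U j : smooth U (fun z => z 0 j).
Proof. by move=> k; exact: Ck_coord. Qed.

Lemma smoothD U f g : open U -> smooth U f -> smooth U g ->
  smooth U (fun z => f z + g z).
Proof. by move=> oU sf sg k; exact: CkD. Qed.

Lemma smoothM U f g : open U -> smooth U f -> smooth U g ->
  smooth U (fun z => f z * g z).
Proof. by move=> oU sf sg k; exact: CkM. Qed.

Lemma smoothX U f m : open U -> smooth U f -> smooth U (fun z => f z ^+ m).
Proof.
move=> oU sf; elim: m => [|m IHm]; first exact: smooth_cst.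
move=> k; apply: (@Ck_ext _ _ (fun z => f z * f z ^+ m)) => [z|].
  by rewrite exprS.
exact: (smoothM oU sf IHm).
Qed.

Lemma smooth_sum (T : Type) (r : seq T) U (F : T -> 'rV[R]_n -> R) : open U ->
  (forall i, smooth U (F i)) -> smooth U (fun z => \sum_(i <- r) F i z).
Proof.
move=> oU sF; elim: r => [|i r IHr] k.
  by apply: (Ck_ext _ (Ck_cst _ _ 0)) => z; rewrite big_nil.
apply: (@Ck_ext _ _ (fun z => F i z + \sum_(j <- r) F j z)) => [z|].
  by rewrite big_cons.
exact: (smoothD oU (sF i) IHr).
Qed.

End Smooth.

Lemma differentiable_row (R : realType) (m n : nat) (f : 'rV[R]_m -> 'rV[R]_n) z :
  (forall j, differentiable (fun y => f y 0 j) z) -> differentiable f z.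
Proof.
move=> df; rewrite (_ : f = \sum_(j < n) (fun y => f y 0 j *: delta_mx 0 j)).
  by apply: differentiable_sum => j; exact: differentiableZl.
by apply/funext => y; rewrite [LHS]row_sum_delta fct_sumE.
Qed.

Lemma differentiable_mulmxr (R : realType) (m n : nat) (A : 'M[R]_(m, n))
    (z : 'rV[R]_m) : differentiable (fun y : 'rV[R]_m => y *m A) z.
Proof.
apply: differentiable_row => j.
rewrite (_ : (fun y => _) =
    \sum_(i < m) (A i j \*: (fun y : 'rV[R]_m => y 0 i))); last first.
  apply/funext => y; rewrite fct_sumE !mxE; apply: eq_bigr => i _.
  by rewrite mulrC.
by apply: differentiable_sum => i; exact/differentiableZ/differentiable_coord.
Qed.

(** A directional derivative of the composite with a linear map is again a
    directional derivative of f composed with that map, so the induction needs no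
    general chain rule. All pullbacks along projections are linear in charts. *)
Lemma smooth_linear (R : realType) (m n : nat) (U : set 'rV[R]_n)
    (A : 'M[R]_(m, n)) (f : 'rV[R]_n -> R) :
  smooth U f -> smooth [set z : 'rV[R]_m | U (z *m A)] (fun z => f (z *m A)).
Proof.
move=> sf k; move: (sf k) => {sf}; elim: k f => [|k IHk] f /=.
  move=> cf z Uz; apply: (@continuous_comp _ _ _ (mulmxr A) f); last exact: cf.
  exact: differentiable_continuous (differentiable_mulmxr _ _).
move=> [df cf]; split => [z Uz|v].
  apply: (@differentiable_comp _ _ _ _ (mulmxr A) f); last exact: df.
  exact: differentiable_mulmxr.
rewrite (_ : 'D_v _ = fun z => 'D_(v *m A) f (z *m A)); first exact: (IHk _ (cf (v *m A))).
apply/funext => z; rewrite /derive /=; under eq_fun do rewrite mulmxDl -scalemxAl.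
by [].
Qed.

(** * The wedge product *)

(** Fixing the value at 0 splits a sum over permutations in the way in which a
    determinant is expanded along a row. *)
Lemma sum_perm_lift (V : nmodType) (n : nat) (F : 'S_n.+1 -> V) :
  \sum_s F s = \sum_(i < n.+1) \sum_(s : 'S_n) F (lift_perm ord0 i s).
Proof.
rewrite pair_big /=; apply: reindex.
exists (fun s => odflt (ord0, 1%g)
  [pick p : 'I_n.+1 * 'S_n | lift_perm ord0 p.1 p.2 == s]) => [[i s] _|s _] /=.
  case: pickP => [[j t] /= /eqP jt|/(_ (i, s))]; last by rewrite /= eqxx.
  have ij : j = i by rewrite -(lift_perm_id ord0 j t) jt lift_perm_id.
  rewrite ij in jt *; congr pair; apply/permP => k.
  by apply: (@lift_inj _ i); rewrite -(lift_perm_lift ord0) jt lift_perm_lift.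
case: pickP => [p /eqP //|/= nos].
have inj : injective (fun p : 'I_n.+1 * 'S_n => lift_perm ord0 p.1 p.2).
  move=> [i u] [j t] /= jt.
  have ij : i = j by rewrite -(lift_perm_id ord0 i u) jt lift_perm_id.
  rewrite ij in jt *; congr pair; apply/permP => k.
  by apply: (@lift_inj _ j); rewrite -(lift_perm_lift ord0) jt lift_perm_lift.
have /(inj_card_onto inj) : (#|{: 'S_n.+1}| <= #|{: 'I_n.+1 * 'S_n}|)%N.
  by rewrite card_prod card_ord !card_Sn factS.
by move=> /(_ s) /codomP[p sp]; have := nos p; rewrite sp eqxx.
Qed.

Lemma sum_perm0 (V : nmodType) (F : 'S_0 -> V) : \sum_s F s = F 1%g.
Proof. by rewrite (big_pred1 (1%g : 'S_0))// => s; apply/esym/eqP/permP => -[]. Qed.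

Section BlockPerm.
Context (k l : nat) (p : 'S_k) (q : 'S_l).

Definition block_perm_fun (i : 'I_(k + l)) : 'I_(k + l) :=
  match fintype.split i with
  | inl a => lshift l (p a)
  | inr b => rshift k (q b)
  end.

Lemma block_perm_inj : injective block_perm_fun.
Proof.
move=> i j; rewrite /block_perm_fun.
case: splitP => a ia; case: splitP => b jb => /eqP.
- by rewrite eq_lshift => /eqP/perm_inj ab; apply: val_inj; rewrite /= ia jb ab.
- by rewrite eq_lrshift.
- by rewrite eq_rlshift.
- by rewrite eq_rshift => /eqP/perm_inj ab; apply: val_inj; rewrite /= ia jb ab.
Qed.

Definition block_perm : 'S_(k + l) := perm block_perm_inj.

Lemma block_perm_lshift a : block_perm (lshift l a) = lshift l (p a).
Proof. by rewrite permE /block_perm_fun (unsplitK (inl a)). Qed.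

Lemma block_perm_rshift b : block_perm (rshift k b) = rshift k (q b).
Proof. by rewrite permE /block_perm_fun (unsplitK (inr b)). Qed.

(** The permutation matrix is block diagonal. *)
Lemma sign_block_perm (R : comNzRingType) :
  (-1) ^+ block_perm = (-1) ^+ p * (-1) ^+ q :> R.
Proof.
rewrite -!det_perm -(det_ublock (perm_mx p) 0); congr (\det _).
apply/matrixP => i j; rewrite -(splitK i) -(splitK j).
case: (fintype.split i) (fintype.split j) => a [] b; rewrite /unsplit.
- by rewrite block_mxEul !mxE block_perm_lshift eq_lshift.
- by rewrite block_mxEur !mxE block_perm_lshift eq_lrshift.
- by rewrite block_mxEdl !mxE block_perm_rshift eq_rlshift.
- by rewrite block_mxEdr !mxE block_perm_rshift eq_rshift.
Qed.

End BlockPerm.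

Section Alternation.
Context (R : realType) (n : nat).

Definition alternation k (F : mform R k n) : mform R k n :=
  fun v => \sum_(s : 'S_k) (-1) ^+ s * F (row_perm s v).

Definition tensor k l (a : mform R k n) (b : mform R l n) : mform R (k + l) n :=
  fun v => a (usubmx v) * b (dsubmx v).

Definition skew_form k (w : mform R k n) : Prop :=
  forall (s : 'S_k) v, w (row_perm s v) = (-1) ^+ s * w v.

Lemma wedgeE k l (a : mform R k n) (b : mform R l n) v :
  (a ∧ b) v = ((k`! * l`!)%:R)^-1 * alternation (tensor a b) v.
Proof. by []. Qed.

Lemma alternation_skew k (F : mform R k n) :
  skew_form (alternation F).
Proof.
move=> t v; rewrite /alternation big_distrr /= (reindex_inj (mulIg t^-1)%g) /=.
apply: eq_bigr => s _; rewrite -row_permM mulgKV odd_permM odd_permV.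
by rewrite signr_addb mulrA [X in _ = X * _]mulrC.
Qed.

Lemma alternation_fixed k (w : mform R k n) v :
  skew_form w -> alternation w v = k`!%:R * w v.
Proof.
move=> aw; rewrite /alternation (eq_bigr (fun=> w v)) => [|s _].
  by rewrite sumr_const card_Sn mulr_natl.
by rewrite aw mulrA -signr_addb addbb mul1r.
Qed.

(** Replacing s by the product with a block permutation changes only the name of
    the summation variable; averaging over the block permutations then lets an inner
    alternation be absorbed by the outer one. *)
Lemma alternation_block k l (F : mform R k n) (G : mform R l n)
    (p : 'S_k) (q : 'S_l) v :
  alternation (tensor F G) v =
  \sum_(s : 'S_(k + l)) (-1) ^+ s *
    ((-1) ^+ p * F (row_perm p (usubmx (row_perm s v))) *
     ((-1) ^+ q * G (row_perm q (dsubmx (row_perm s v))))).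
Proof.
rewrite /alternation (reindex_inj (mulgI (block_perm p q))) /=.
apply: eq_bigr => s _; rewrite row_permM odd_permM signr_addb sign_block_perm.
rewrite /tensor (_ : usubmx _ = row_perm p (usubmx (row_perm s v))); last first.
  by apply/matrixP => i j; rewrite !mxE block_perm_lshift.
rewrite (_ : dsubmx _ = row_perm q (dsubmx (row_perm s v))); last first.
  by apply/matrixP => i j; rewrite !mxE block_perm_rshift.
move: (F _) (G _) ((-1) ^+ p) ((-1) ^+ q) ((-1) ^+ s) => x y b c d; ring.
Qed.

Lemma alternation_tensorl k l (F : mform R k n) (G : mform R l n) v :
  alternation (tensor (alternation F) G) v =
  k`!%:R * alternation (tensor F G) v.
Proof.
rewrite -card_Sn mulr_natl -sumr_const.
rewrite (eq_bigr _ (fun p _ => alternation_block F G p 1%g v)) exchange_big /=.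
apply: eq_bigr => s _; rewrite -big_distrr /= -big_distrl /=.
by rewrite odd_perm1 mul1r row_perm1.
Qed.

Lemma alternation_tensorr k l (F : mform R k n) (G : mform R l n) v :
  alternation (tensor F (alternation G)) v =
  l`!%:R * alternation (tensor F G) v.
Proof.
rewrite -card_Sn mulr_natl -sumr_const.
rewrite (eq_bigr _ (fun q _ => alternation_block F G 1%g q v)) exchange_big /=.
apply: eq_bigr => s _; rewrite -big_distrr /= -big_distrr /=.
by rewrite odd_perm1 mul1r row_perm1.
Qed.

Lemma alternationZ k (F : mform R k n) c v :
  alternation (c \*o F) v = c * alternation F v.
Proof. by rewrite /alternation big_distrr; apply: eq_bigr => s _; rewrite /= mulrCA. Qed.

Lemma alternation_castmx k1 k2 (e : k1 = k2) (F : mform R k2 n) (x : 'M[R]_(k1, n)) :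
  alternation F (castmx (e, erefl n) x) =
  alternation (fun y => F (castmx (e, erefl n) y)) x.
Proof. by case: k2 / e F => F; rewrite castmx_id. Qed.

Lemma wedge_skew k l (a : mform R k n) (b : mform R l n) :
  skew_form (a ∧ b).
Proof. by move=> s v; rewrite !wedgeE alternation_skew mulrCA. Qed.

End Alternation.

Section Wedge.
Context (R : realType) (n : nat).

Lemma fact_neq0 k : k`!%:R != 0 :> R.
Proof. by rewrite pnatr_eq0 -lt0n fact_gt0. Qed.

(** Both sides are the same multiple of the alternation of the triple tensor
    product, which is associative up to the cast of the number of rows. *)
Lemma wedgeA_cast k l m (a : mform R k n) (b : mform R l n) (c : mform R m n) v :
  (a ∧ (b ∧ c)) v = (a ∧ b ∧ c) (castmx (addnA k l m, erefl n) v).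
Proof.
have -> : (a ∧ (b ∧ c)) v =
    ((k`! * l`! * m`!)%:R)^-1 * alternation (tensor a (tensor b c)) v.
  rewrite wedgeE (_ : tensor a (wedge b c) =
    ((l`! * m`!)%:R)^-1 \*o tensor a (alternation (tensor b c))); last first.
    by apply/funext => w; rewrite /tensor /= wedgeE mulrCA.
  rewrite alternationZ alternation_tensorr !natrM.
  by field; rewrite !fact_neq0.
set w := castmx _ v.
have -> : (a ∧ b ∧ c) w =
    ((k`! * l`! * m`!)%:R)^-1 * alternation (tensor (tensor a b) c) w.
  rewrite wedgeE (_ : tensor (wedge a b) c =
    ((k`! * l`!)%:R)^-1 \*o tensor (alternation (tensor a b)) c); last first.
    by apply/funext => x; rewrite /tensor /= wedgeE mulrA.
  rewrite alternationZ alternation_tensorl !natrM.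
  by field; rewrite !fact_neq0.
rewrite /w alternation_castmx; congr (_ * _); congr (alternation _ _).
apply/funext => x.
rewrite /tensor mulrA; congr (a _ * b _ * c _); apply/matrixP => i j;
  rewrite !(mxE, castmxE) /=; congr (x _ _); apply: val_inj => //=.
- by rewrite addnA.
Qed.

Lemma wedgeDl k l (a b : mform R k n) (c : mform R l n) :
  (a \+ b) ∧ c = (a ∧ c) \+ (b ∧ c).
Proof.
apply/funext => v; rewrite /= /wedge -mulrDr -big_split /=.
congr (_ * _); apply: eq_bigr => s _.
by rewrite -mulrDr mulrDl.
Qed.

Lemma wedgeDr k l (a : mform R k n) (b c : mform R l n) :
  a ∧ (b \+ c) = (a ∧ b) \+ (a ∧ c).
Proof.
apply/funext => v; rewrite /= /wedge -mulrDr -big_split /=.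
congr (_ * _); apply: eq_bigr => s _.
by rewrite -!mulrDr.
Qed.

Lemma wedgeZl k l x (a : mform R k n) (b : mform R l n) :
  (x \*o a) ∧ b = x \*o (a ∧ b).
Proof.
apply/funext => v; rewrite /= /wedge mulrCA [in RHS]big_distrr /=.
congr (_ * _); apply: eq_bigr => s _.
by rewrite -mulrA mulrCA.
Qed.

Lemma wedgeZr k l x (a : mform R k n) (b : mform R l n) :
  a ∧ (x \*o b) = x \*o (a ∧ b).
Proof.
apply/funext => v; rewrite /= /wedge mulrCA [in RHS]big_distrr /=.
congr (_ * _); apply: eq_bigr => s _.
by rewrite (mulrCA _ x) (mulrCA _ x).
Qed.

(** Multiplication by A on the right commutes with permutations of the rows. *)
Lemma wedge_pullback m k l (A : 'M[R]_(m, n)) (a : mform R k n) (b : mform R l n) :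
  (fun v => (a ∧ b) (v *m A)) =
  (fun v : 'M[R]_(k, m) => a (v *m A)) ∧ (fun v : 'M[R]_(l, m) => b (v *m A)).
Proof.
apply/funext => v; rewrite /wedge; congr (_ * _); apply: eq_bigr => s _.
have -> : row_perm s (v *m A) = row_perm s v *m A by rewrite !row_permE mulmxA.
by rewrite mul_usub_mx mul_dsub_mx.
Qed.

Lemma wedge11C (a b : mform R 1 n) : a ∧ b = -1 \*o (b ∧ a).
Proof.
apply/funext => v /=; rewrite !wedgeE mulrCA mulN1r; congr (_ * _).
rewrite /alternation -sumrN.
pose t : 'S_(1 + 1) := tperm (lshift 1 0) (rshift 1 0).
rewrite (reindex_inj (mulgI t)) /=; apply: eq_bigr => s _.
rewrite row_permM odd_permM odd_tperm eq_lrshift signr_addb mulN1r mulNr.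
congr (- (_ * _)); rewrite /tensor mulrC.
by congr (_ * _); congr (_ _); apply/matrixP => i j;
  rewrite !mxE !ord1 ?tpermL ?tpermR.
Qed.

End Wedge.

(** * Wedge products of covectors as minors *)

Section WedgeWords.
Context (R : realType) (n : nat).

Lemma wedge_swap k (a : mform R k n) (b c : mform R 1 n) :
  a ∧ b ∧ c = -1 \*o (a ∧ c ∧ b).
Proof.
apply/funext => v /=.
rewrite -(castmxKV (addnA k 1 1) (erefl n) v) -!wedgeA_cast.
by rewrite [b ∧ c]wedge11C wedgeZr.
Qed.

Lemma wedge11E (a b : mform R 1 n) v :
  (a ∧ b) v = a (row 0 v) * b (row 1 v) - a (row 1 v) * b (row 0 v).
Proof.
rewrite wedgeE invr1 mul1r /alternation sum_perm_lift !big_ord_recl big_ord0.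
rewrite !sum_perm_lift !big_ord_recl !big_ord0 !sum_perm0 !addr0 /tensor.
rewrite !odd_lift_perm odd_perm1 /= expr0 expr1 mul1r mulN1r.
have e0 : lshift 1 (0 : 'I_1) = ord0 by apply: val_inj.
have e1 : rshift 1 (0 : 'I_1) = lift ord0 ord0 by apply: val_inj.
congr (a _ * b _ - a _ * b _); apply/rowP => j; rewrite !mxE ?e0 ?e1;
  rewrite ?lift_perm_lift lift_perm_id; congr (v _ _); exact: val_inj.
Qed.

(** Laplace expansion along two blocks of columns. Permuting the columns inside the
    blocks by p and q multiplies the determinant by the two signs; summing its
    Leibniz expansions over all p and q recovers k! l! copies of it on one side and
    the products of the two small determinants on the other. *)
Lemma wedge_det k l (C : 'M[R]_(n, k)) (D : 'M[R]_(n, l)) :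
  (fun v : 'M[R]_(k, n) => \det (v *m C)) ∧ (fun v : 'M[R]_(l, n) => \det (v *m D)) =
  fun v : 'M[R]_(k + l, n) => \det (v *m row_mx C D).
Proof.
apply/funext => v; rewrite mul_mx_row wedgeE.
set X := v *m C; set Y := v *m D.
suff -> : alternation (tensor (fun v => \det (v *m C)) (fun v => \det (v *m D))) v
    = (k`! * l`!)%:R * \det (row_mx X Y).
  by rewrite mulKf// natrM mulf_neq0// fact_neq0.
have detE (p : 'S_k) (q : 'S_l) :
    (-1) ^+ p * (-1) ^+ q * \det (row_mx X Y) =
    \sum_(s : 'S_(k + l)) (-1) ^+ s *
    ((\prod_i X (s (lshift l i)) (p i)) * (\prod_j Y (s (rshift k j)) (q j))).
  rewrite -sign_block_perm -det_perm -(det_tr (row_mx X Y)) -det_mulmx -row_permE.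
  rewrite /(\det _).
  apply: eq_bigr => s _; rewrite big_split_ord /=; congr (_ * (_ * _)).
    by apply: eq_bigr => i _; rewrite 2![LHS]mxE block_perm_lshift row_mxEl.
  by apply: eq_bigr => i _; rewrite 2![LHS]mxE block_perm_rshift row_mxEr.
transitivity (\sum_(p : 'S_k) \sum_(q : 'S_l)
    (-1) ^+ p * (-1) ^+ q * ((-1) ^+ p * (-1) ^+ q * \det (row_mx X Y))).
  under eq_bigr do under eq_bigr do rewrite detE big_distrr /=.
  under eq_bigr do rewrite exchange_big /=.
  rewrite exchange_big /= /alternation; apply: eq_bigr => s _.
  rewrite /tensor /(\det _) big_distrl big_distrr /=; apply: eq_bigr => p _.
  rewrite !big_distrr /=; apply: eq_bigr => q _.
  have -> : usubmx (row_perm s v) *m C = usubmx (row_perm s X).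
    by rewrite mul_usub_mx /X !row_permE mulmxA.
  have -> : dsubmx (row_perm s v) *m D = dsubmx (row_perm s Y).
    by rewrite mul_dsub_mx /Y !row_permE mulmxA.
  clearbody X Y.
  under [\prod_i (usubmx _) _ _]eq_bigr do rewrite !mxE.
  under [\prod_i (dsubmx _) _ _]eq_bigr do rewrite !mxE.
  move: (\prod_i _) (\prod_i _) ((-1) ^+ p) ((-1) ^+ q) ((-1) ^+ s) => x y c d f.
  ring.
under eq_bigr do under eq_bigr do
  rewrite mulrA mulrACA -!expr2 !sqrr_sign mulr1 mul1r.
by rewrite !sumr_const !card_Sn -mulrnA mulr_natl mulnC.
Qed.
End WedgeWords.

(** * Explicit permutations and the Hodge star of a monomial *)

Section Lehmer.

(** A permutation is described by its Lehmer code: x :: c sends 0 to x and sends the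
    remaining arguments, according to c, to the values other than x in their natural
    order. The code makes both the values and the sign of an explicit permutation
    computable, which a permutation given by its graph does not. *)
Fixpoint lehmer_fun (c : seq nat) (i : nat) : nat :=
  match c, i with
  | [::], _ => i
  | x :: _, 0 => x
  | x :: c', i'.+1 => bump x (lehmer_fun c' i')
  end.

Fixpoint lehmer (c : seq nat) (n : nat) : 'S_n :=
  match n with
  | 0 => 1%g
  | m.+1 => lift_perm ord0 (inord (head 0%N c)) (lehmer (behead c) m)
  end.

Fixpoint lehmer_code (c : seq nat) (n : nat) : bool :=
  match c, n with
  | [::], 0 => true
  | x :: c', m.+1 => (x < m.+1)%N && lehmer_code c' m
  | _, _ => false
  end.

Lemma lehmerE c n (i : 'I_n) : lehmer_code c n ->
  lehmer c n i = lehmer_fun c i :> nat.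
Proof.
elim: n c i => [|m IHm] [|x c] i //=; first by case: i.
move=> /andP[xm cm]; case: (unliftP ord0 i) => [j|] ->.
  rewrite lift_perm_lift (_ : nat_of_ord (lift ord0 j) = j.+1)//=.
  by rewrite inordK// IHm.
by rewrite lift_perm_id inordK.
Qed.

(** The entries of the code count the inversions. *)
Lemma sign_lehmer (R : pzRingType) c n : lehmer_code c n ->
  (-1) ^+ lehmer c n = (-1) ^+ odd (sumn c) :> R.
Proof.
move=> cn; congr (_ ^+ nat_of_bool _).
elim: n c cn => [|m IHm] [|x c] //=; first by rewrite odd_perm1.
by move=> /andP[xm cm]; rewrite odd_lift_perm IHm//= inordK// oddD.
Qed.

End Lehmer.

Section Hodge.
Context (R : realType).

(** The columns are selected by a map and not by a subset, so that the order of the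
    factors of a monomial, hence its sign, is part of the index. *)
Definition minor_form n k (e : 'M[R]_n) (J : 'I_k -> 'I_n) : mform R k n :=
  fun v => \det (colsub J (v *m e)).

Lemma covec_minor n (e : 'M[R]_n) (j : 'I_n) :
  covec e j = minor_form e (fun _ : 'I_1 => j).
Proof. by apply/funext => v; rewrite /minor_form det_mx11 mxE. Qed.

Lemma wedge_minor n k (e : 'M[R]_n) (J : 'I_k -> 'I_n) (j : 'I_n) :
  minor_form e J ∧ covec e j =
  minor_form e (fun a : 'I_(k + 1) => if fintype.split a is inl b then J b else j).
Proof.
have colE m (K : 'I_m -> 'I_n) : minor_form e K = fun v => \det (v *m colsub K e).
  by apply/funext => v; rewrite /minor_form mulmx_colsub.
rewrite covec_minor !colE wedge_det; apply/funext => v; congr (\det (v *m _)).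
apply/matrixP => a b; rewrite !mxE.
by case: (fintype.split b) => ?; rewrite mxE.
Qed.

Lemma hodgeD k l (e : 'M[R]_(k + l)) (a b : mform R k (k + l)) :
  hodge e (a \+ b) = hodge e a \+ hodge e b.
Proof.
apply/funext => v; rewrite /hodge /= -mulrDr -big_split; congr (_ * _).
by apply: eq_bigr => s _; rewrite mulrDl.
Qed.

Lemma hodgeB k l (e : 'M[R]_(k + l)) (a b : mform R k (k + l)) :
  hodge e (a \- b) = hodge e a \- hodge e b.
Proof.
apply/funext => v; rewrite /hodge /= -mulrBr -sumrB; congr (_ * _).
by apply: eq_bigr => s _; rewrite mulrBl.
Qed.

(** A tuple of dual frame vectors contributes only if it is a rearrangement of
    the first k values of s, since the minor vanishes on all others. The k! rearrangements
    contribute equally, because the sign of the minor is compensated by that of the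
    determinant. The common value is found by permuting the columns by s, which makes
    the matrix block triangular. *)
Lemma hodge_minor k l (e : 'M[R]_(k + l)) (s : 'S_(k + l)) : e \in unitmx ->
  hodge e (minor_form e (fun a => s (lshift l a))) =
  (-1) ^+ s \*o minor_form e (fun b => s (rshift k b)).
Proof.
move=> eU; apply/funext => v; rewrite /hodge /minor_form /=.
set X := v *m e; pose J a := s (lshift l a).
pose d := \det (col_mx (rowsub J 1%:M) X).
have dE : d = (-1) ^+ s * \det (colsub (fun b => s (rshift k b)) X).
  have -> : d = (-1) ^+ s * \det (col_perm s (col_mx (rowsub J 1%:M) X)).
    rewrite col_permE det_mulmx det_perm odd_permV mulrCA mulrA.
    by rewrite -mulrA -expr2 sqrr_sign mulr1.
  congr (_ * _); rewrite -[RHS]mul1r -[X in _ = X * _](det1 R k) -(det_lblock _ (lsubmx (col_perm s X))).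
  congr (\det _); apply/matrixP => i j; rewrite -(splitK i) -(splitK j).
  case: (fintype.split i) (fintype.split j) => a [] b; rewrite /unsplit [LHS]mxE.
  - rewrite col_mxEu block_mxEul !mxE.
        by rewrite (inj_eq perm_inj) eq_lshift.
  - by rewrite col_mxEu block_mxEur !mxE (inj_eq perm_inj) eq_lrshift.
  - by rewrite col_mxEd block_mxEdl 2![RHS]mxE.
  - by rewrite col_mxEd block_mxEdr [RHS]mxE.
(* It remains to see that the sum has one term d for each rearrangement. *)
rewrite -dE -[RHS](mulKf (fact_neq0 R k)); congr (_ * _).
have rowE (f : 'I_k -> 'I_(k + l)) : rowsub f (invmx e) *m e = rowsub f 1%:M.
  by rewrite mul_rowsub_mx mulVmx.
transitivity (\sum_(p : 'S_k) d).
  transitivity (\sum_(f : {ffun 'I_k -> 'I_(k + l)}) \sum_(p : 'S_k)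
      (-1) ^+ p * ((f == [ffun a => J (p a)])%:R *
                   \det (col_mx (rowsub f 1%:M) X))).
    apply: eq_bigr => f _; rewrite rowE mul_col_mx rowE -/X /(\det (colsub _ _)) big_distrl /=.
    apply: eq_bigr => p _; rewrite -mulrA; congr (_ * (_ * _)).
    under eq_bigr do rewrite !mxE.
    case: eqP => [->|/eqP fJ]; first by rewrite big1 // => a _; rewrite ffunE eqxx.
    have [a fa] : exists a, f a != J (p a).
      apply/existsP; apply: contraR fJ; rewrite negb_exists => /forallP fJ.
      by apply/eqP/ffunP => a; rewrite ffunE; apply/eqP; rewrite -[_ == _]negbK.
    by rewrite (bigD1 a)//= (negPf fa) mul0r.
  rewrite exchange_big; apply: eq_bigr => p _ /=.
  rewrite (bigD1 [ffun a => J (p a)])//= eqxx mul1r big1 => [|f /negPf ->]; last first.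
    by rewrite mul0r mulr0.
  rewrite addr0 /d.
  transitivity ((-1) ^+ p * \det (block_mx (perm_mx p) 0 0 1%:M *m col_mx (rowsub J 1%:M) X)).
    rewrite mul_block_col !mul0mx addr0 add0r mul1mx -row_permE.
    congr (_ * \det (col_mx _ _)).
    by apply/matrixP => a b; rewrite !mxE ffunE.
  by rewrite det_mulmx det_ublock det1 mulr1 det_perm mulrA -expr2 sqrr_sign mul1r.
by rewrite sumr_const card_Sn mulr_natl.
Qed.

End Hodge.

(** * The Hodge dual of the model form *)

Section HodgeG2.
Context (R : realType).

Lemma wedge3_minor n (e : 'M[R]_n) i j k :
  covec e i ∧ covec e j ∧ covec e k = minor_form e (tnth [tuple i; j; k]).
Proof.
rewrite covec_minor !wedge_minor; congr minor_form; apply/funext => a.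
by case: splitP => b ab; [case: splitP => c bc|]; rewrite (tnth_nth i) /=
  ab ?bc ord1.
Qed.

Lemma wedge4_minor n (e : 'M[R]_n) i j k l :
  covec e i ∧ covec e j ∧ covec e k ∧ covec e l =
  minor_form e (tnth [tuple i; j; k; l]).
Proof.
rewrite wedge3_minor wedge_minor; congr minor_form; apply/funext => a.
case: splitP => b ab; rewrite !(tnth_nth i) /= ab.
  by case: b ab => -[|[|[|]]].
by rewrite ord1.
Qed.

(** The code c lists the indices of the given monomial followed by those of the
    complementary one; the sign relating e^ijklmnp to the volume form is the parity of
    the sum of the code. *)
Lemma hodge_wedge3 (e : 'M[R]_(3 + 4)) (c : seq nat) (i j k l m n p : 'I_7) :
  e \in unitmx -> lehmer_code c 7 ->
  map val [:: i; j; k; l; m; n; p] = map (lehmer_fun c) (iota 0 7) ->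
  hodge e (covec e i ∧ covec e j ∧ covec e k) =
  (-1) ^+ odd (sumn c) \*o (covec e l ∧ covec e m ∧ covec e n ∧ covec e p).
Proof.
move=> eU c7 [ci cj ck cl cm cn cp]; rewrite wedge3_minor wedge4_minor.
have -> : tnth [tuple i; j; k] = (fun a => lehmer c (3 + 4) (lshift 4 a)).
  apply/funext => a; apply: ord_inj; rewrite lehmerE// (tnth_nth i).
  by case: a => -[|[|[|]]].
have -> : tnth [tuple l; m; n; p] = (fun a => lehmer c (3 + 4) (rshift 3 a)).
  apply/funext => a; apply: ord_inj; rewrite lehmerE// (tnth_nth i).
  by case: a => -[|[|[|[|]]]].
by rewrite hodge_minor// sign_lehmer.
Qed.

(** With w = e^12 + e^34 + e^56 and Omega = (e^1 + i e^2) (e^3 + i e^4) (e^5 + i e^6)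
    this is 1/2 w w + Im Omega e^7. *)
Definition g2_coform (e : 'M[R]_7) : mform R 4 7 :=
  let e1 := covec e (@Ordinal 7 0 isT) in
  let e2 := covec e (@Ordinal 7 1 isT) in
  let e3 := covec e (@Ordinal 7 2 isT) in
  let e4 := covec e (@Ordinal 7 3 isT) in
  let e5 := covec e (@Ordinal 7 4 isT) in
  let e6 := covec e (@Ordinal 7 5 isT) in
  let e7 := covec e (@Ordinal 7 6 isT) in
  (e1 ∧ e2 ∧ e3 ∧ e4 \+ (e1 ∧ e2 \+ e3 ∧ e4) ∧ e5 ∧ e6) \+
  ((e1 ∧ e3 ∧ e6 \+ e1 ∧ e4 ∧ e5 \+ e2 ∧ e3 ∧ e5) ∧ e7 \- e2 ∧ e4 ∧ e6 ∧ e7).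

(** Each of the seven monomials has a single complementary monomial; the codes below
    list the three indices followed by the complement in increasing order. *)
Lemma hodge_g2_form (e : 'M[R]_7) : e \in unitmx ->
  @hodge R 3 4 e (g2_form e) = g2_coform e.
Proof.
move=> eU; rewrite /g2_form /g2_coform !wedgeDl hodgeD !hodgeB !hodgeD.
rewrite (@hodge_wedge3 _ [:: 0; 0; 4; 0; 0; 0; 0] (@Ordinal 7 0 isT)
  (@Ordinal 7 1 isT) (@Ordinal 7 6 isT) (@Ordinal 7 2 isT)
  (@Ordinal 7 3 isT) (@Ordinal 7 4 isT) (@Ordinal 7 5 isT))//.
rewrite (@hodge_wedge3 _ [:: 2; 2; 4; 0; 0; 0; 0] (@Ordinal 7 2 isT)
  (@Ordinal 7 3 isT) (@Ordinal 7 6 isT) (@Ordinal 7 0 isT)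
  (@Ordinal 7 1 isT) (@Ordinal 7 4 isT) (@Ordinal 7 5 isT))//.
rewrite (@hodge_wedge3 _ [:: 4; 4; 4; 0; 0; 0; 0] (@Ordinal 7 4 isT)
  (@Ordinal 7 5 isT) (@Ordinal 7 6 isT) (@Ordinal 7 0 isT)
  (@Ordinal 7 1 isT) (@Ordinal 7 2 isT) (@Ordinal 7 3 isT))//.
rewrite (@hodge_wedge3 _ [:: 0; 1; 2; 0; 0; 0; 0] (@Ordinal 7 0 isT)
  (@Ordinal 7 2 isT) (@Ordinal 7 4 isT) (@Ordinal 7 1 isT)
  (@Ordinal 7 3 isT) (@Ordinal 7 5 isT) (@Ordinal 7 6 isT))//.
rewrite (@hodge_wedge3 _ [:: 0; 2; 3; 0; 0; 0; 0] (@Ordinal 7 0 isT)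
  (@Ordinal 7 3 isT) (@Ordinal 7 5 isT) (@Ordinal 7 1 isT)
  (@Ordinal 7 2 isT) (@Ordinal 7 4 isT) (@Ordinal 7 6 isT))//.
rewrite (@hodge_wedge3 _ [:: 1; 1; 3; 0; 0; 0; 0] (@Ordinal 7 1 isT)
  (@Ordinal 7 2 isT) (@Ordinal 7 5 isT) (@Ordinal 7 0 isT)
  (@Ordinal 7 3 isT) (@Ordinal 7 4 isT) (@Ordinal 7 6 isT))//.
rewrite (@hodge_wedge3 _ [:: 1; 2; 2; 0; 0; 0; 0] (@Ordinal 7 1 isT)
  (@Ordinal 7 3 isT) (@Ordinal 7 4 isT) (@Ordinal 7 0 isT)
  (@Ordinal 7 2 isT) (@Ordinal 7 5 isT) (@Ordinal 7 6 isT))//.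
apply/funext => v /=; rewrite expr0 expr1 !mul1r !mulN1r; ring.
Qed.

End HodgeG2.

(** * The exterior derivative *)

Section DeriveSum.
Context (R : realType) (V : normedModType R).

Lemma derivable_big (I : Type) (r : seq I) (h : I -> V -> R) z u :
  (forall i, derivable (h i) z u) ->
  derivable (fun y => \sum_(i <- r) h i y) z u.
Proof.
move=> dh; elim: r => [|i r IHr].
  by under eq_fun do rewrite big_nil; exact: derivable_cst.
by under eq_fun do rewrite big_cons; exact: (derivableD (dh i) IHr).
Qed.

Lemma derive_big (I : Type) (r : seq I) (h : I -> V -> R) z u :
  (forall i, derivable (h i) z u) ->
  'D_u (fun y => \sum_(i <- r) h i y) z = \sum_(i <- r) 'D_u (h i) z.
Proof.
move=> dh; elim: r => [|i r IHr].
  by rewrite big_nil; under eq_fun do rewrite big_nil; rewrite derive_cst.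
rewrite big_cons -IHr -deriveD//; last exact: derivable_big.
by congr ('D_u _ z); apply/funext => y; rewrite big_cons.
Qed.

Lemma derivable_mulr (f g : V -> R) z u :
  derivable f z u -> derivable g z u -> derivable (fun y => f y * g y) z u.
Proof. exact: derivableM. Qed.

Lemma derive_mulr (f g : V -> R) z u :
  derivable f z u -> derivable g z u ->
  'D_u (fun y => f y * g y) z = f z * 'D_u g z + g z * 'D_u f z.
Proof. exact: deriveM. Qed.

Lemma derive_mulrl c (f : V -> R) z u :
  derivable f z u -> 'D_u (fun y => c * f y) z = c * 'D_u f z.
Proof. exact: deriveZ. Qed.

End DeriveSum.

Section ExteriorDerivative.
Context (R : realType) (n : nat).
Implicit Type z : 'rV[R]_n.

Lemma alternation_row_perm k (c : 'S_k) (F : mform R k n) v :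
  alternation (fun w => F (row_perm c w)) v = (-1) ^+ c * alternation F v.
Proof.
rewrite /alternation [in RHS](reindex_inj (mulgI c)) big_distrr /=.
apply: eq_bigr => s _.
by rewrite row_permM odd_permM signr_addb !mulrA -expr2 sqrr_sign mul1r.
Qed.

(** The permutations of the rows are grouped by the row that comes first. With a
    derivative along that row in the place of T, this exhibits the exterior derivative
    as an alternation. *)
Lemma alternation_first k (T : 'rV[R]_n -> mform R k n) (v : 'M[R]_(1 + k, n)) :
  alternation (fun w : 'M[R]_(1 + k, n) => T (row 0 (usubmx w)) (dsubmx w)) v =
  \sum_(i < k.+1) (-1) ^+ i * alternation (T (row i v)) (row' i v).
Proof.
rewrite /alternation (sum_perm_lift (n := k)).
apply: eq_bigr => i _; rewrite big_distrr; apply: eq_bigr => s _ /=.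
have -> : row 0 (usubmx (row_perm (lift_perm ord0 i s) v : 'M[R]_(1 + k, n))) = row i v.
  apply/rowP => j; rewrite !mxE; congr (v _ _).
  by rewrite (_ : lshift k 0 = ord0) ?lift_perm_id//; exact: val_inj.
have -> : dsubmx (row_perm (lift_perm ord0 i s) v : 'M[R]_(1 + k, n)) = row_perm s (row' i v).
  apply/matrixP => a j; rewrite !mxE; congr (v _ _).
  by rewrite (_ : rshift 1 a = lift ord0 a) ?lift_perm_lift//; exact: val_inj.
by rewrite odd_lift_perm /= signr_addb signr_odd mulrA.
Qed.

Lemma wedge1E k (a : mform R 1 n) (b : mform R k n) (v : 'M[R]_(1 + k, n)) :
  skew_form b ->
  (a ∧ b) v = \sum_(i < k.+1) (-1) ^+ i * (a (row i v) * b (row' i v)).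
Proof.
move=> ab; rewrite wedgeE mul1n.
rewrite (_ : tensor a b = fun w => a (row 0 (usubmx w)) * b (dsubmx w)).
  rewrite (alternation_first (fun u w => a u * b w)) big_distrr.
  apply: eq_bigr => i _ /=; rewrite alternation_fixed => [|s w].
    by rewrite mulrCA mulKf// fact_neq0.
  by rewrite ab mulrCA.
by apply/funext => w; rewrite /tensor; congr (a _ * _); apply/rowP => j; rewrite !mxE.
Qed.

(** Antisymmetry is asked for near z because the exterior derivative at z
    sees the values of the form at the nearby points. *)
Definition form_near k (w : 'rV[R]_n -> mform R k n) z : Prop :=
  (\forall y \near z, skew_form (w y)) /\
  forall v u, derivable (fun y => w y v) z u.

(** The flat covariant derivative of w, which is antisymmetric in the last k
    arguments only. *)
Definition nabla k (w : 'rV[R]_n -> mform R k n) z : mform R (1 + k) n :=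
  fun v => 'D_(row 0 (usubmx v)) (fun y => w y (dsubmx v)) z.

(** Since w is antisymmetric, alternating its flat derivative repeats each term of
    the exterior derivative k! times. *)
Lemma exd_alternation k (w : 'rV[R]_n -> mform R k n) z v : form_near w z ->
  exd w z v = (k`!%:R)^-1 * alternation (nabla w z) v.
Proof.
move=> [aw dw]; rewrite (alternation_first (fun u x => 'D_u (w ^~ x) z)) big_distrr.
apply: eq_bigr => i _ /=; rewrite alternation_fixed => [|s x].
  by rewrite mulrCA mulKf// fact_neq0.
rewrite -derive_mulrl//; apply: near_eq_derive.
by apply: filterS aw => y ->.
Qed.

Lemma form_near_skew k (w : 'rV[R]_n -> mform R k n) z :
  form_near w z -> skew_form (w z).
Proof. by move=> [+ _] => /nbhs_singleton. Qed.

Lemma form_near_wedge k l (a : 'rV[R]_n -> mform R k n)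
    (b : 'rV[R]_n -> mform R l n) z : form_near a z -> form_near b z ->
  form_near (fun y => a y ∧ b y) z.
Proof.
move=> [_ da] [_ db]; split=> [|v u].
  by apply: (@filterE _ (nbhs z)) => y; exact: wedge_skew.
apply: derivable_mulr; first exact: derivable_cst.
apply: derivable_big => s; apply: derivable_mulr; first exact: derivable_cst.
exact: derivable_mulr.
Qed.

Lemma derive_wedge k l (a : 'rV[R]_n -> mform R k n)
    (b : 'rV[R]_n -> mform R l n) z u v : form_near a z -> form_near b z ->
  'D_u (fun y => (a y ∧ b y) v) z =
  ((fun x => 'D_u (a ^~ x) z) ∧ b z) v + (a z ∧ (fun x => 'D_u (b ^~ x) z)) v.
Proof.
move=> [_ da] [_ db]; rewrite /wedge -mulrDr derive_mulrl; last first.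
  apply: derivable_big => s; apply: derivable_mulr; first exact: derivable_cst.
  exact: derivable_mulr.
congr (_ * _); rewrite derive_big => [|s]; last first.
  by apply: derivable_mulr; [exact: derivable_cst|exact: derivable_mulr].
rewrite -big_split; apply: eq_bigr => s _ /=.
rewrite derive_mulrl; last exact: derivable_mulr.
by rewrite derive_mulr// -mulrDr addrC [b z _ * _]mulrC.
Qed.

(** By the product rule the flat derivative of a tensor product has two terms. After
    alternation the first one is d a wedge b. In the second one the differentiating
    row comes before the k rows of a instead of after them, and moving it across
    costs the sign (-1)^k. *)
Theorem exd_wedge k l (a : 'rV[R]_n -> mform R k n)
    (b : 'rV[R]_n -> mform R l n) z v : form_near a z -> form_near b z ->
  exd (fun y => a y ∧ b y) z v =
  (exd a z ∧ b z) v +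
  (-1) ^+ k * (a z ∧ exd b z) (castmx (esym (addnS k l), erefl n) v).
Proof.
move=> ha hb; pose c : R := ((k`! * l`!)%:R)^-1.
have daE : (exd a z ∧ b z) v = c * alternation (tensor (nabla a z) (b z)) v.
  rewrite wedgeE (_ : tensor (exd a z) (b z) =
      (k`!%:R)^-1 \*o tensor (alternation (nabla a z)) (b z)); last first.
    by apply/funext => w; rewrite /tensor /= (exd_alternation _ ha) mulrA.
  rewrite alternationZ alternation_tensorl /c !(natrM _ (_`!) (_`!)).
  by field; rewrite !fact_neq0.
have dbE w : (a z ∧ exd b z) w = c * alternation (tensor (a z) (nabla b z)) w.
  rewrite wedgeE (_ : tensor (a z) (exd b z) =
      (l`!%:R)^-1 \*o tensor (a z) (alternation (nabla b z))); last first.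
    by apply/funext => x; rewrite /tensor /= (exd_alternation _ hb) mulrCA.
  rewrite alternationZ alternation_tensorr /c !(natrM _ (_`!) (_`!)).
  by field; rewrite !fact_neq0.
rewrite daE dbE /exd.
have -> : \sum_(i < (k + l).+1) (-1) ^+ i *
      'D_(row i v) (fun y => (a y ∧ b y) (row' i v)) z =
    c * (alternation (fun w : 'M[R]_(1 + (k + l), n) =>
           tensor (fun x => 'D_(row 0 (usubmx w)) (a ^~ x) z) (b z) (dsubmx w)) v +
         alternation (fun w : 'M[R]_(1 + (k + l), n) =>
           tensor (a z) (fun x => 'D_(row 0 (usubmx w)) (b ^~ x) z) (dsubmx w)) v).
  rewrite (alternation_first (fun u => tensor (fun x => 'D_u (a ^~ x) z) (b z))).
  rewrite (alternation_first (fun u => tensor (a z) (fun x => 'D_u (b ^~ x) z))).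
  rewrite -big_split big_distrr; apply: eq_bigr => i _ /=.
  by rewrite derive_wedge// !wedgeE -/c -mulrDr -mulrDr mulrCA.
pose F1 : mform R (1 + (k + l)) n := fun w =>
  tensor (fun x => 'D_(row 0 (usubmx w)) (a ^~ x) z) (b z) (dsubmx w).
pose F2 : mform R (1 + (k + l)) n := fun w =>
  tensor (a z) (fun x => 'D_(row 0 (usubmx w)) (b ^~ x) z) (dsubmx w).
rewrite -/F1 -/F2 mulrDr.
have -> : F1 = tensor (nabla a z) (b z).
  apply/funext => w; rewrite /F1 /tensor /nabla.
  have -> : row 0 (usubmx w) = row 0 (usubmx (@usubmx _ (1 + k) l _ w)).
    by apply/rowP => j; rewrite !mxE; congr (w _ _); apply: val_inj.
  have -> : usubmx (dsubmx w) = dsubmx (@usubmx _ (1 + k) l _ w).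
    by apply/matrixP => i j; rewrite !mxE; congr (w _ _); apply: val_inj.
  have -> // : dsubmx (dsubmx w) = @dsubmx _ (1 + k) l _ w.
  by apply/matrixP => i j; rewrite !mxE; congr (w _ _); apply: val_inj.
(* s is the cycle that moves the first row behind the next k rows. *)
pose s : 'S_(k + l).+1 := lift_perm (inord k) ord0 1.
have signs : (-1) ^+ s = (-1) ^+ k :> R.
  by rewrite odd_lift_perm odd_perm1 addbF addbF inordK ?signr_odd// ltnS leq_addr.
have sE i : s i = (if i < k then i.+1 else if i == k :> nat then 0 else i)%N :> nat.
  have kl : (k < (k + l).+1)%N by rewrite ltnS leq_addr.
  case: (unliftP (inord k) i) => [j|] ->.
    rewrite lift_perm_lift perm1 /= inordK// /bump /= add1n.
    case: (leqP k j) => kj; last by rewrite add0n kj.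
    by rewrite add1n ltnNge ltnW// gtn_eqF.
  by rewrite lift_perm_id inordK// ltnn eqxx.
rewrite [X in _ = _ + X]mulrCA -signs alternation_castmx -alternation_row_perm.
suff -> : F2 = (fun w => tensor (a z) (nabla b z)
    (castmx (esym (addnS k l), erefl n) (row_perm s w))) by [].
apply/funext => w; rewrite /F2 /tensor /nabla; set X := castmx _ _.
have XE (i : 'I_(k + l.+1)) (i' : 'I_(k + l).+1) j : i = i' :> nat -> X i j = w (s i') j.
  by move=> ii'; rewrite /X castmxE mxE; congr (w (s _) _); apply: val_inj.
have -> : usubmx X = usubmx (dsubmx w).
  apply/matrixP => i j; rewrite 3!mxE (XE _ (inord i)).
    by congr (w _ _); apply: val_inj; rewrite /= sE inordK ?ltn_ord// ltnS ltnW// ltn_addr.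
  by rewrite inordK// ltnS ltnW// ltn_addr.
have -> : row 0 (@usubmx R 1 l n (dsubmx X)) = row 0 (usubmx w).
  apply/rowP => j; rewrite ![LHS]mxE (XE _ (inord k)); last first.
    by rewrite /= addn0 inordK// ltnS leq_addr.
  rewrite ![RHS]mxE; congr (w _ _); apply: val_inj; rewrite /= sE.
  by rewrite inordK ?ltnn ?eqxx// ltnS leq_addr.
have -> // : @dsubmx R 1 l n (dsubmx X) = dsubmx (dsubmx w).
apply/matrixP => i j; rewrite ![LHS]mxE (XE _ (rshift 1 (rshift k i))); last by rewrite /= addnCA.
rewrite ![RHS]mxE; congr (w _ _); apply: val_inj; rewrite /= sE /=.
have ki : (k < 1 + (k + i))%N by rewrite add1n ltnS leq_addr.
by rewrite ltnNge (ltnW ki) /= gtn_eqF.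
Qed.

Lemma exdD k (v w : 'rV[R]_n -> mform R k n) z :
  form_near v z -> form_near w z ->
  exd (fun y => v y \+ w y) z = exd v z \+ exd w z.
Proof.
move=> [_ dv] [_ dw]; apply/funext => x; rewrite /exd /= -big_split.
apply: eq_bigr => i _ /=; rewrite -mulrDr; congr (_ * _).
exact: (deriveD (dv _ _) (dw _ _)).
Qed.

Lemma exd_scale k (f : 'rV[R]_n -> R) (w : 'rV[R]_n -> mform R k n) z :
  (forall u, derivable f z u) -> form_near w z ->
  exd (fun y => f y \*o w y) z =
  ((fun v : 'M[R]_(1, n) => 'D_(row 0 v) f z) ∧ w z) \+ f z \*o exd w z.
Proof.
move=> df hw; apply/funext => v.
rewrite /= (wedge1E _ _ (form_near_skew hw)) /exd big_distrr -big_split.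
apply: eq_bigr => i _ /=; rewrite derive_mulr//; last exact: hw.2.
rewrite (_ : row 0 (row i v) = row i v); first by ring.
by apply/rowP => j; rewrite !mxE.
Qed.

Lemma form_nearD k (v w : 'rV[R]_n -> mform R k n) z :
  form_near v z -> form_near w z -> form_near (fun y => v y \+ w y) z.
Proof.
move=> [av dv] [aw dw]; split => [|x u]; last exact: (derivableD (dv x u) (dw x u)).
by apply: filterS2 av aw => y ay wy s x; rewrite /= ay wy mulrDr.
Qed.

Lemma form_near_scale k (f : 'rV[R]_n -> R) (w : 'rV[R]_n -> mform R k n) z :
  (forall u, derivable f z u) -> form_near w z ->
  form_near (fun y => f y \*o w y) z.
Proof.
move=> df [aw dw]; split => [|x u]; last exact: derivable_mulr.
by apply: filterS aw => y wy s x; rewrite /= wy mulrCA.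
Qed.

Lemma skew_form1 (a : mform R 1 n) : skew_form a.
Proof.
move=> s v; have -> : s = 1%g by apply/permP => i; rewrite !ord1.
by rewrite odd_perm1 mul1r row_perm1.
Qed.

Lemma exd_cst k (a : mform R k n) z : exd (fun=> a) z = fun=> 0.
Proof.
apply/funext => v; rewrite /exd big1// => i _.
by rewrite derive_cst mulr0.
Qed.

End ExteriorDerivative.

Lemma exd_linear (R : realType) (m n k : nat) (A : 'M[R]_(m, n))
    (w : 'rV[R]_n -> mform R k n) (z : 'rV[R]_m) :
  exd (fun y : 'rV[R]_m => fun v : 'M[R]_(k, m) => w (y *m A) (v *m A)) z =
  fun v => exd w (z *m A) (v *m A).
Proof.
apply/funext => v; apply: eq_bigr => i _; congr (_ * _).
rewrite /derive row_mul (_ : row' i (v *m A) = row' i v *m A); last first.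
  by apply/matrixP => a b; rewrite !mxE; apply: eq_bigr => c _; rewrite mxE.
by under eq_fun do rewrite /= mulmxDl -scalemxAl.
Qed.

(** * Alternating forms *)

Lemma eq_row'P (R : realType) (n k : nat) (A B : 'M[R]_(k, n)) i :
  row' i A = row' i B <-> forall j, j != i -> row j A = row j B.
Proof.
split=> [AB j ji|AB].
  have /unlift_some[j' -> _] : i != j by rewrite eq_sym.
  apply/rowP => c; have /matrixP/(_ j' c) := AB.
  by rewrite !mxE.
apply/matrixP => j c.
have /AB/rowP/(_ c) : lift i j != i by rewrite eq_sym neq_lift.
by rewrite !mxE.
Qed.

Section WedgeAlternating.
Context (R : realType) (n : nat).

(** Row i of the arguments is fed, in each term of the alternation, to exactly one of
    the two factors, which is linear in it. The alternating property comes from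
    antisymmetry and the fact that 2 is invertible. *)
Lemma alternating_wedge k l (a : mform R k n) (b : mform R l n) :
  alternating_form a -> alternating_form b -> alternating_form (a ∧ b).
Proof.
move=> [ma _] [mb _]; split=> [A B C i x y Ai Bi Ci|A i j ij Aij]; last first.
  have : (a ∧ b) (row_perm (tperm i j) A) = - (a ∧ b) A.
    by rewrite wedge_skew odd_tperm ij expr1 mulN1r.
  rewrite (_ : row_perm _ _ = A); first by lra.
  have AijE c : A i c = A j c by have /rowP/(_ c) := Aij; rewrite !mxE.
  by apply/matrixP => h c; rewrite mxE; case: tpermP => // ->.
rewrite /wedge mulrCA (mulrCA y) -mulrDr; congr (_ * _).
rewrite !big_distrr -big_split; apply: eq_bigr => s _ /=.
rewrite (mulrCA x) (mulrCA y) -mulrDr; congr (_ * _).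
have rowE (D E : 'M[R]_(k + l, n)) j : row' i D = row' i E -> s j != i ->
    forall c, D (s j) c = E (s j) c.
  by move=> /eq_row'P DE sji c; have /rowP/(_ c) := DE _ sji; rewrite !mxE.
have rowiE j c : s j = i -> A (s j) c = x * B (s j) c + y * C (s j) c.
  by move=> ->; have /rowP/(_ c) := Ai; rewrite !mxE.
have [j sj] : exists j, s j = i by exists (s^-1%g i); rewrite permKV.
rewrite -(splitK j) in sj; case: (fintype.split j) sj => h; rewrite /unsplit => sh.
  have dE (D : 'M[R]_(k + l, n)) : row' i D = row' i A ->
      dsubmx (row_perm s D) = dsubmx (row_perm s A).
    move=> DA; apply/matrixP => u c; rewrite !mxE; apply: rowE => //.
    by rewrite -sh (inj_eq perm_inj) eq_rlshift.
  have uE (D : 'M[R]_(k + l, n)) : row' i D = row' i A ->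
      row' h (usubmx (row_perm s D)) = row' h (usubmx (row_perm s A)).
    move=> DA; apply/matrixP => u c; rewrite !mxE; apply: rowE => //.
    by rewrite -sh (inj_eq perm_inj) eq_lshift eq_sym neq_lift.
  rewrite (dE B)// (dE C)// !mulrA -mulrDl; congr (_ * _).
  apply: (ma _ _ _ h); [|exact: uE|exact: uE].
  by apply/rowP => c; rewrite !mxE rowiE.
have uE (D : 'M[R]_(k + l, n)) : row' i D = row' i A ->
    usubmx (row_perm s D) = usubmx (row_perm s A).
  move=> DA; apply/matrixP => u c; rewrite !mxE; apply: rowE => //.
  by rewrite -sh (inj_eq perm_inj) eq_lrshift.
have dE (D : 'M[R]_(k + l, n)) : row' i D = row' i A ->
    row' h (dsubmx (row_perm s D)) = row' h (dsubmx (row_perm s A)).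
  move=> DA; apply/matrixP => u c; rewrite !mxE; apply: rowE => //.
  by rewrite -sh (inj_eq perm_inj) eq_rshift eq_sym neq_lift.
rewrite (uE B)// (uE C)// ![_ * (a _ * _)]mulrCA -mulrDr; congr (_ * _).
apply: (mb _ _ _ h); [|exact: dE|exact: dE].
by apply/rowP => c; rewrite !mxE rowiE.
Qed.

Lemma alternatingD k (a b : mform R k n) :
  alternating_form a -> alternating_form b -> alternating_form (a \+ b).
Proof.
move=> [ma aa] [mb ab]; split=> [A B C i x y Ai Bi Ci|A i j ij Aij] /=.
  by rewrite (ma _ _ _ _ _ _ Ai)// (mb _ _ _ _ _ _ Ai)//; ring.
by rewrite (aa _ _ _ ij)// (ab _ _ _ ij)// addr0.
Qed.

Lemma alternatingZ k c (a : mform R k n) :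
  alternating_form a -> alternating_form (c \*o a).
Proof.
move=> [ma aa]; split=> [A B C i x y Ai Bi Ci|A i j ij Aij] /=.
  by rewrite (ma _ _ _ _ _ _ Ai)//; ring.
by rewrite (aa _ _ _ ij)// mulr0.
Qed.

Lemma alternating_pullback m k (D : 'M[R]_(m, n)) (a : mform R k n) :
  alternating_form a ->
  alternating_form (fun v : 'M[R]_(k, m) => a (v *m D)).
Proof.
move=> [ma aa]; split=> [A B C i x y Ai Bi Ci|A i j ij Aij] /=.
  apply: (ma _ (B *m D) (C *m D) i).
  - by rewrite !row_mul Ai mulmxDl -!scalemxAl.
  - apply/eq_row'P => j ji; rewrite !row_mul; congr (_ *m _).
    exact: (eq_row'P B A i).1 Bi j ji.
  - apply/eq_row'P => j ji; rewrite !row_mul; congr (_ *m _).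
    exact: (eq_row'P C A i).1 Ci j ji.
by apply: (aa _ _ _ ij); rewrite !row_mul Aij.
Qed.

Lemma alternating1 (a : mform R 1 n) :
  (forall x y u v, a (x *: u + y *: v) = x * a u + y * a v) ->
  alternating_form a.
Proof.
move=> la; split=> [A B C i x y|A i j]; last by rewrite !ord1 eqxx.
rewrite !ord1 => Ai _ _; rewrite -la; congr (a _); apply/row_matrixP => j.
by rewrite ord1 linearD !linearZ.
Qed.

Lemma alternating1_linear (a : mform R 1 n) x y u v :
  alternating_form a -> a (x *: u + y *: v) = x * a u + y * a v.
Proof.
move=> [ma _]; apply: (ma _ _ _ 0); first by rewrite linearD !linearZ.
  by apply/matrixP => -[].
by apply/matrixP => -[].
Qed.

End WedgeAlternating.

(** * Hyperkahler linear algebra on a tangent space *)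

(** The conditions are imposed on one tangent space, where vectors are rows and J acts
    by multiplication on the right. *)
Definition metric_mx (R : realType) (n : nat) (g : 'M[R]_n) : Prop :=
  g^T = g /\ forall v : 'rV[R]_n, v != 0 -> 0 < (v *m g *m v^T) 0 0.

Definition orthogonal_complex_mx (R : realType) (n : nat) (g J : 'M[R]_n) : Prop :=
  J *m J = - 1%:M /\ J *m g *m J^T = g.

Definition fund_mx (R : realType) (n : nat) (g J : 'M[R]_n) : mform R 2 n :=
  fun v => (row 0 v *m J *m g *m (row 1 v)^T) 0 0.

Section Pointwise.
Context (R : realType).
Local Notation o0 := (@Ordinal 4 0 isT).
Local Notation o1 := (@Ordinal 4 1 isT).
Local Notation o2 := (@Ordinal 4 2 isT).
Local Notation o3 := (@Ordinal 4 3 isT).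

Lemma sum4 (V : nmodType) (F : 'I_4 -> V) :
  \sum_i F i = F o0 + F o1 + F o2 + F o3.
Proof.
rewrite !big_ord_recl big_ord0 addr0 !addrA.
by congr (F _ + F _ + F _ + F _); apply: val_inj.
Qed.

Lemma metric_mx_unit n (g : 'M[R]_n) : metric_mx g -> g \in unitmx.
Proof.
move=> [_ pg]; rewrite -row_free_unit -kermx_eq0; apply/eqP/row_matrixP => i.
rewrite row0; apply/eqP/negPn/negP => /pg.
have /sub_kermxP -> : (row i (kermx g) <= kermx g)%MS by exact: row_sub.
by rewrite mul0mx mxE ltxx.
Qed.

Lemma complex_metric_skew n (g J : 'M[R]_n) :
  metric_mx g -> orthogonal_complex_mx g J -> g *m J^T = - (J *m g).
Proof.
move=> [gT _] [JJ JgJ]; rewrite -[in LHS]JgJ -!mulmxA -trmx_mul JJ.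
by rewrite linearN /= trmx1 mulmxN mulmx1 mulmxN.
Qed.

Definition skew_mx (a b c d f h : R) : 'M[R]_4 :=
  \matrix_(i < 4, j < 4) nth 0 (nth [::] [::
    [:: 0; a; b; c];
    [:: - a; 0; d; f];
    [:: - b; - d; 0; h];
    [:: - c; - f; - h; 0]] i) j.

(** The matrices of omega_1, omega_2, omega_3 in the frame e, J1 e, J2 e, J3 e. *)
Definition frame_J1 := skew_mx 1 0 0 0 0 1.
Definition frame_J2 := skew_mx 0 1 0 0 (-1) 0.
Definition frame_J3 := skew_mx 0 0 1 1 0 0.

(** The last equation is the relation J1 J2 = J3, because rows compose in the opposite
    order. *)
Definition quaternionic (J1 J2 J3 : 'M[R]_4) : Prop :=
  [/\ J1 *m J1 = - 1%:M, J2 *m J2 = - 1%:M, J3 *m J3 = - 1%:M &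
      J2 *m J1 = J3].

Lemma quaternion_table J1 J2 J3 : quaternionic J1 J2 J3 ->
  [/\ J1 *m J2 = - J3, J1 *m J3 = J2, J3 *m J1 = - J2, J2 *m J3 = - J1 &
      J3 *m J2 = J1].
Proof.
move=> [J11 J22 J33 J21].
have J31 : J3 *m J1 = - J2 by rewrite -J21 -mulmxA J11 mulmxN mulmx1.
have J23 : J2 *m J3 = - J1 by rewrite -J21 mulmxA J22 mulNmx mul1mx.
have J12 : J1 *m J2 = - J3.
  have := J33; rewrite -{1}J21 -{1}J21 => h.
  have : J2 *m (J2 *m J1 *m (J2 *m J1)) *m J1 = - (J2 *m J1).
    by rewrite h mulmxN mulmx1 mulNmx.
  rewrite -!mulmxA J11 !mulmxN mulmx1 (mulmxA J2 J2) J22 mulNmx mul1mx opprK.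
  by rewrite J21 => ->.
by split => //; [rewrite -[J3]opprK -J12 mulmxN mulmxA J11 mulNmx mul1mx opprK
  |rewrite -[J3]opprK -J12 mulNmx -mulmxA J22 mulmxN mulmx1 opprK].
Qed.

(** With F as coframe, K is the Gram matrix of the fundamental form on the dual frame. *)
Lemma fund_mx_frame (g J F K : 'M[R]_4) : J *m g = F *m K *m F^T ->
  (forall i j, K j i = - K i j) ->
  fund_mx g J =
    K o0 o1 \*o (covec F o0 ∧ covec F o1) \+
    K o0 o2 \*o (covec F o0 ∧ covec F o2) \+
    K o0 o3 \*o (covec F o0 ∧ covec F o3) \+
    K o1 o2 \*o (covec F o1 ∧ covec F o2) \+
    K o1 o3 \*o (covec F o1 ∧ covec F o3) \+
    K o2 o3 \*o (covec F o2 ∧ covec F o3).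
Proof.
move=> JgE skewK; apply/funext => v /=.
have -> : fund_mx g J v = \sum_i \sum_j (v *m F) 0 i * K i j * (v *m F) 1 j.
  rewrite /fund_mx -[_ *m J *m g]mulmxA JgE.
  rewrite (_ : _ *m _ = row 0 (v *m F) *m K *m (row 1 (v *m F))^T); last first.
    by rewrite !row_mul trmx_mul !mulmxA.
  rewrite exchange_big mxE; apply: eq_bigr => j _; rewrite !mxE big_distrl /=.
  by apply: eq_bigr => i _; rewrite !mxE.
rewrite !wedge11E /covec -!row_mul; set X := v *m F.
have rowX i j : row i X 0 j = X i j by rewrite mxE.
rewrite !rowX !sum4; have K0 i : K i i = 0 by have := skewK i i; lra.
rewrite !K0 (skewK o0 o1) (skewK o0 o2) (skewK o0 o3) (skewK o1 o2).
rewrite (skewK o1 o3) (skewK o2 o3); ring.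
Qed.

(** The quaternion relations reduce every entry to the value on e of g or of one of
    the three fundamental forms; the former is 1 and the latter vanish by
    antisymmetry. *)
Lemma quaternionic_frame g J1 J2 J3 (e : 'rV[R]_4) :
  metric_mx g -> quaternionic J1 J2 J3 ->
  orthogonal_complex_mx g J1 -> orthogonal_complex_mx g J2 ->
  orthogonal_complex_mx g J3 -> (e *m g *m e^T) 0 0 = 1 ->
  let E := \matrix_(i < 4) (e *m nth 1%:M [:: 1%:M; J1; J2; J3] i) in
  [/\ E *m g *m E^T = 1%:M,
     E *m (J1 *m g) *m E^T = frame_J1, E *m (J2 *m g) *m E^T = frame_J2 &
     E *m (J3 *m g) *m E^T = frame_J3].
Proof.
move=> mg Q oJ1 oJ2 oJ3 e1 E.
have [J11 J22 J33 J21] := Q; have [J12 J13 J31 J23 J32] := quaternion_table Q.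
have gT : g^T = g := mg.1.
have g1 := complex_metric_skew mg oJ1; have g2 := complex_metric_skew mg oJ2.
have g3 := complex_metric_skew mg oJ3.
pose q X := (e *m X *m e^T) 0 0.
have qN X : q (- X) = - q X by rewrite /q mulmxN mulNmx mxE.
have skew0 J : g *m J^T = - (J *m g) -> q (J *m g) = 0.
  move=> gJ; have : (e *m (J *m g) *m e^T)^T = - (e *m (J *m g) *m e^T).
    by rewrite !trmx_mul trmxK gT gJ mulNmx mulmxN mulmxA.
  by move=> /matrixP/(_ 0 0); rewrite /q !mxE; lra.
have z1 := skew0 _ g1; have z2 := skew0 _ g2; have z3 := skew0 _ g3.
pose A i := nth 1%:M [:: 1%:M; J1; J2; J3] i.
have entry X i j : (E *m X *m E^T) i j = q (A i *m (X *m (A j)^T)).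
  transitivity ((row i E *m X *m (row j E)^T) 0 0).
    rewrite [LHS]mxE [RHS]mxE; apply: eq_bigr => k _.
    by rewrite -row_mul !mxE.
  by rewrite !rowK trmx_mul /q !mulmxA.
have qg : q g = 1 by [].
clearbody q; rewrite {}/A in entry.
have T (A B C : 'M[R]_4) : A *m B = C -> A *m (B *m g) = C *m g.
  by rewrite mulmxA => ->.
have T11 := T _ _ _ J11; have T12 := T _ _ _ J12; have T13 := T _ _ _ J13.
have T21 := T _ _ _ J21; have T22 := T _ _ _ J22; have T23 := T _ _ _ J23.
have T31 := T _ _ _ J31; have T32 := T _ _ _ J32; have T33 := T _ _ _ J33.
have TE := (T11, T12, T13, T21, T22, T23, T31, T32, T33).
by split; apply/matrixP => -[[|[|[|[|//]]]] hi] -[[|[|[|[|//]]]] hj];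
  rewrite entry [RHS]mxE /= ?trmx1 -?mulmxA ?(g1, g2, g3, mulmx1, mul1mx);
  rewrite ?(mulmxN, TE, mulNmx, mul1mx) ?opprK ?(qN, qg, z1, z2, z3) ?oppr0.
Qed.

Lemma skew_mxE a b c d f h : let K := skew_mx a b c d f h in
  [/\ K o0 o1 = a, K o0 o2 = b & K o0 o3 = c] /\
  [/\ K o1 o2 = d, K o1 o3 = f & K o2 o3 = h].
Proof. by rewrite /= !mxE. Qed.

Lemma skew_mx_skew a b c d f h i j :
  skew_mx a b c d f h j i = - skew_mx a b c d f h i j.
Proof.
by case: i => -[|[|[|[|//]]]] hi; case: j => -[|[|[|[|//]]]] hj;
  rewrite !mxE /= ?oppr0 ?opprK.
Qed.

Lemma skew_mxP (K : 'M[R]_4) : (forall i j, K j i = - K i j) ->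
  K = skew_mx (K o0 o1) (K o0 o2) (K o0 o3) (K o1 o2) (K o1 o3) (K o2 o3).
Proof.
move=> sK; have K0 i : K i i = 0 by have := sK i i; lra.
have oP (i : 'I_4) : [\/ i = o0, i = o1, i = o2 | i = o3].
  by case: i => -[|[|[|[|//]]]] hi; [apply: Or41|apply: Or42|apply: Or43|apply: Or44];
    exact: val_inj.
apply/matrixP => i j.
by case: (oP i) => ->; case: (oP j) => ->; rewrite mxE /= ?K0 // sK.
Qed.

Lemma frame_unit (E g : 'M[R]_4) : E *m g *m E^T = 1%:M -> E \in unitmx.
Proof. by rewrite -mulmxA => /mulmx1_unit[]. Qed.

Lemma fund_mx_skew_mx (E g J : 'M[R]_4) a b c d f h : E \in unitmx ->
  E *m (J *m g) *m E^T = skew_mx a b c d f h ->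
  let F := invmx E in
  fund_mx g J =
    a \*o (covec F o0 ∧ covec F o1) \+ b \*o (covec F o0 ∧ covec F o2) \+
    c \*o (covec F o0 ∧ covec F o3) \+ d \*o (covec F o1 ∧ covec F o2) \+
    f \*o (covec F o1 ∧ covec F o3) \+ h \*o (covec F o2 ∧ covec F o3).
Proof.
move=> EU KE F.
rewrite (@fund_mx_frame _ _ F (skew_mx a b c d f h)); last exact: skew_mx_skew.
  by have [[-> -> ->] [-> -> ->]] := skew_mxE a b c d f h.
rewrite -KE /F !mulmxA mulVmx// mul1mx -!mulmxA -trmx_mul mulVmx// trmx1.
by rewrite !mulmxA mulmx1.
Qed.

Lemma sum_perm4 (W : 'M[R]_4) :
  \sum_(s : 'S_4) (-1) ^+ s * (W (s o0) (s o1) * W (s o2) (s o3)) =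
  \sum_(i < 4) \sum_(j < 3) \sum_(k < 2) \sum_(l < 1)
    (-1) ^+ (i + (j + (k + l))) *
    (W i (lift i j) * W (lift i (lift j k)) (lift i (lift j (lift k l)))).
Proof.
rewrite sum_perm_lift; apply: eq_bigr => i _.
rewrite sum_perm_lift; apply: eq_bigr => j _.
rewrite sum_perm_lift; apply: eq_bigr => k _.
rewrite sum_perm_lift; apply: eq_bigr => l _.
rewrite sum_perm0.
have -> : o0 = ord0 by exact: val_inj.
have -> : o1 = lift ord0 ord0 by exact: val_inj.
have -> : o2 = lift ord0 (lift ord0 ord0) by exact: val_inj.
have -> : o3 = lift ord0 (lift ord0 (lift ord0 ord0)) by exact: val_inj.
rewrite !(lift_perm_lift, lift_perm_id) !odd_lift_perm odd_perm1 /= addbF.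
by rewrite -!oddD signr_odd.
Qed.

(** The sum is 4! / 3 = 8 times the Pfaffian, each of the three perfect matchings of
    four points arising from 8 permutations. *)
Lemma pfaffian4 a b c d f h :
  let W := skew_mx a b c d f h in
  \sum_(s : 'S_4) (-1) ^+ s * (W (s o0) (s o1) * W (s o2) (s o3)) =
  8 * (a * h - b * f + c * d).
Proof.
move=> W; rewrite sum_perm4 !big_ord_recl !big_ord0 /W !mxE /=.
rewrite ?(expr0, exprS) /=; ring.
Qed.

Lemma fund_mx_wedge_frame (E g J : 'M[R]_4) a b c d f h :
  E *m (J *m g) *m E^T = skew_mx a b c d f h ->
  (fund_mx g J ∧ fund_mx g J) (E : 'M[R]_(2 + 2, 4)) = 2 * (a * h - b * f + c * d).
Proof.
move=> KE; rewrite wedgeE /alternation /tensor.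
have entry (i j : 'I_4) v : row 0 v = row i E -> row 1 v = row j E ->
    fund_mx g J v = skew_mx a b c d f h i j.
  move=> vi vj; rewrite /fund_mx vi vj -KE [LHS]mxE [RHS]mxE.
  by apply: eq_bigr => k _; rewrite -[_ *m J *m g]mulmxA -row_mul !mxE.
rewrite (_ : \sum_(s : 'S_(2 + 2)) _ = 8 * (a * h - b * f + c * d)); last first.
  rewrite -pfaffian4; apply: eq_bigr => s _; congr (_ * _).
  by rewrite (entry (s o0) (s o1)) ?(entry (s o2) (s o3)) //; apply/rowP => j;
    rewrite !mxE; congr (E (s _) _); exact: val_inj.
rewrite (_ : (2`! * 2`!)%N = 4)//; by field.
Qed.

Lemma frame_skew (E g J : 'M[R]_4) : metric_mx g -> orthogonal_complex_mx g J ->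
  let W := E *m (J *m g) *m E^T in forall i j, W j i = - W i j.
Proof.
move=> mg oJ W i j; have : W^T = - W.
  rewrite /W !trmx_mul trmxK mg.1 (complex_metric_skew mg oJ).
  by rewrite mulNmx mulmxN !mulmxA.
by move=> /matrixP/(_ i j); rewrite !mxE.
Qed.

(** A self-dual and an anti-self-dual part make up W, the former with coordinates
    a + h, b - f, c + d. The diagonal of W^2 = -1 says that all rows are unit vectors,
    so the squares of the six coefficients add up to 2; adding twice the Pfaffian
    gives 0 as the square norm of the self-dual part. *)
Lemma skew_mx_anti_self_dual a b c d f h :
  let W := skew_mx a b c d f h in
  W *m W = - 1%:M -> a * h - b * f + c * d = -1 ->
  [/\ d = - c, f = b, h = - a & a ^+ 2 + b ^+ 2 + c ^+ 2 = 1].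
Proof.
move=> W WW pf.
have n i : \sum_k W i k ^+ 2 = 1.
  have /matrixP/(_ i i) := WW; rewrite !mxE eqxx mulr1n => e.
  rewrite -[RHS]opprK -e -sumrN; apply: eq_bigr => k _.
  by rewrite [W k i]skew_mx_skew; ring.
have := n o0; have := n o1; have := n o2; have := n o3.
rewrite !sum4 /W !mxE /= => n3 n2 n1 n0.
have : (a + h) ^+ 2 + (b - f) ^+ 2 + (c + d) ^+ 2 = 0 by nra.
move/eqP; rewrite !paddr_eq0 ?addr_ge0 ?sqr_ge0// !sqrf_eq0.
by move=> /andP[/andP[/eqP ah /eqP bf] /eqP cd]; split; nra.
Qed.

(** In an orthonormal frame the Gram matrix of the fundamental form is conjugate to J. *)
Lemma frame_square (E g J : 'M[R]_4) :
  E *m g *m E^T = 1%:M -> J *m J = - 1%:M ->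
  let W := E *m (J *m g) *m E^T in W *m W = - 1%:M.
Proof.
move=> EgE JJ W; have EU := frame_unit EgE.
have EgT : g *m E^T = invmx E.
  by rewrite -[LHS]mul1mx -(mulVmx EU) -!mulmxA (mulmxA E) EgE mulmx1.
have -> : W = E *m J *m invmx E by rewrite /W -EgT !mulmxA.
by rewrite !mulmxA (mulmxKV EU) -(mulmxA E) JJ mulmxN mulmx1 mulNmx mulmxV.
Qed.

Definition hyperkahler_mx (g J1 J2 J3 : 'M[R]_4) : Prop :=
  [/\ metric_mx g, orthogonal_complex_mx g J1, orthogonal_complex_mx g J2,
      orthogonal_complex_mx g J3 & J2 *m J1 = J3].

Definition adapted_frame (g J1 J2 J3 E : 'M[R]_4) : Prop :=
  E *m g *m E^T = 1%:M /\
  [/\ E *m (J1 *m g) *m E^T = frame_J1, E *m (J2 *m g) *m E^T = frame_J2 &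
      E *m (J3 *m g) *m E^T = frame_J3].

Lemma adapted_frame_from g J1 J2 J3 (v : 'rV[R]_4) :
  hyperkahler_mx g J1 J2 J3 -> v != 0 ->
  exists c, exists2 E, adapted_frame g J1 J2 J3 E & row o0 E = c *: v.
Proof.
move=> [mg oJ1 oJ2 oJ3 J21] v0; have pv := mg.2 v v0.
pose q := (v *m g *m v^T) 0 0; pose c := (Num.sqrt q)^-1.
exists c, (\matrix_(i < 4) ((c *: v) *m nth 1%:M [:: 1%:M; J1; J2; J3] i)).
  have e1 : ((c *: v) *m g *m (c *: v)^T) 0 0 = 1.
    rewrite linearZ /= -scalemxAr -!scalemxAl scalerA !mxE -expr2.
    rewrite [X in _ * X](_ : _ = q); last by rewrite /q mxE.
    by rewrite /c exprVn sqr_sqrtr ?ltW// mulVf// gt_eqF.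
  have [] // := quaternionic_frame mg _ oJ1 oJ2 oJ3 e1; first last.
  by split; [exact: oJ1.1|exact: oJ2.1|exact: oJ3.1|].
by rewrite rowK /= mulmx1.
Qed.

(** In any adapted frame the fundamental form of J is anti-self-dual, so J commutes
    with J1. Hence x = e - J1 J e satisfies J x = J1 x, and the frame that starts at the
    normalised x is as required: the first row determines an anti-self-dual matrix. *)
Lemma almost_kahler_frame g J1 J2 J3 (J : 'M[R]_4) :
  hyperkahler_mx g J1 J2 J3 -> orthogonal_complex_mx g J ->
  fund_mx g J ∧ fund_mx g J =
    (fun v => - (fund_mx g J1 ∧ fund_mx g J1) v) ->
  exists2 E, adapted_frame g J1 J2 J3 E &
    E *m (J *m g) *m E^T = skew_mx 1 0 0 0 0 (-1).
Proof.
move=> hk oJ opp; have [mg oJ1 _ _ _] := hk.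
have asd E : adapted_frame g J1 J2 J3 E ->
    exists a b c, a ^+ 2 + b ^+ 2 + c ^+ 2 = 1 /\
      E *m (J *m g) *m E^T = skew_mx a b c (- c) b (- a).
  move=> [EgE [E1 _ _]].
  have := skew_mxP (frame_skew E mg oJ).
  set W := E *m (J *m g) *m E^T.
  move: (W o0 o1) (W o0 o2) (W o0 o3) (W o1 o2) (W o1 o3) (W o2 o3).
  move=> a b c d f h WE; exists a, b, c.
  have WW := frame_square EgE oJ.1; rewrite -/W WE in WW.
  have pf : a * h - b * f + c * d = -1.
    have := congr1 (@^~ (E : 'M[R]_(2 + 2, 4))) opp => /=.
    rewrite (fund_mx_wedge_frame WE) (fund_mx_wedge_frame E1); lra.
  have [dc fb ha n] := skew_mx_anti_self_dual WW pf.
  by rewrite WE dc fb ha.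
have d0 : (delta_mx 0 0 : 'rV[R]_4) != 0.
  by apply/eqP => /matrixP/(_ 0 0); rewrite !mxE /=; lra.
have [_ [E0 aE0 _]] := adapted_frame_from hk d0.
have [a [b [c [n WE]]]] := asd _ aE0.
have EU := frame_unit aE0.1; have [EgE [E1 _ _]] := aE0.
have [xi xi0 xiE] : exists2 xi : 'rV[R]_4, xi != 0 &
    xi *m skew_mx a b c (- c) b (- a) = xi *m frame_J1.
  (* The vector e - J1 J e vanishes when J e = - J1 e; then J = J1 on the plane
     spanned by the last two frame vectors. *)
  have [a1|a1] := eqVneq a (-1).
    have [b0 c0] : b = 0 /\ c = 0 by split; nra.
    exists (\row_j (j == o2)%:R).
      by apply/eqP => /matrixP/(_ 0 o2); rewrite !mxE /=; lra.
    apply/rowP => j; rewrite !mxE !sum4 !mxE /= a1 b0 c0.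
    by case: j => -[|[|[|[|//]]]] hj /=; ring.
  exists (\row_j nth 0 [:: 1 + a; 0; c; - b] j).
    apply/eqP => /matrixP/(_ 0 o0); rewrite !mxE /= => e.
    by move/eqP: a1; apply; lra.
  apply/rowP => j; rewrite !mxE !sum4 !mxE /=.
  by case: j => -[|[|[|[|//]]]] hj /=; nra.
pose x := xi *m E0.
have x0 : x != 0.
  apply: contra xi0 => /eqP x0.
  by rewrite -[xi](mulmxK EU) -/x x0 mul0mx.
have xJ : x *m (J *m g) = x *m (J1 *m g).
  have ETU : E0^T \in unitmx by rewrite unitmx_tr.
  rewrite -[LHS](mulmxK ETU) -[RHS](mulmxK ETU); congr (_ *m _).
  rewrite /x -!(mulmxA xi) ; move: xiE; rewrite -WE -E1.
  by rewrite !mulmxA.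
have [k [E aE Ex]] := adapted_frame_from hk x0.
have [a' [b' [c' [n' WE']]]] := asd _ aE.
exists E => //; rewrite WE'.
have rowE : row o0 (skew_mx a' b' c' (- c') b' (- a')) = row o0 frame_J1.
  have [_ [<- _ _]] := aE; rewrite -WE' !row_mul Ex -!scalemxAl.
  by rewrite xJ.
have e k' : skew_mx a' b' c' (- c') b' (- a') o0 k' = frame_J1 o0 k'.
  by have /rowP/(_ k') := rowE; rewrite !mxE.
have := e o1; have := e o2; have := e o3; rewrite !mxE /= => -> -> ->.
by rewrite oppr0.
Qed.

End Pointwise.

(** * Parallel complex structures *)

(** The definition is sealed, and so is the one of [mx_pair] below: unfolded, these are
    matrix entries, and rewriting with the rules for entries would break them up. *)
HB.lock Definition mx_derive (R : realType) (V : normedModType R) m n (A : V -> 'M[R]_(m, n)) z u : 'M[R]_(m, n) :=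
  \matrix_(i, j) 'D_u (fun y => A y i j) z.

Arguments mx_derive {R V m n}.

Section MatrixDerivative.
Context (R : realType) (V : normedModType R).

Definition mx_derivable m n (A : V -> 'M[R]_(m, n)) z u :=
  forall i j, derivable (fun y => A y i j) z u.

Lemma mx_derivable_cst m n (A : 'M[R]_(m, n)) z u : mx_derivable (fun=> A) z u.
Proof. by move=> i j; exact: derivable_cst. Qed.

Lemma mx_deriveE m n (A : V -> 'M[R]_(m, n)) z u i j :
  mx_derive A z u i j = 'D_u (fun y => A y i j) z.
Proof. by rewrite mx_derive.unlock mxE. Qed.

Lemma mx_derive_cst m n (A : 'M[R]_(m, n)) (z u : V) : mx_derive (fun=> A) z u = 0.
Proof. by apply/matrixP => i j; rewrite mx_deriveE mxE derive_cst. Qed.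

Lemma mulmx_entryE m n p (A : V -> 'M[R]_(m, n)) (B : V -> 'M[R]_(n, p)) i j :
  (fun y => (A y *m B y) i j) = fun y => \sum_k A y i k * B y k j.
Proof. by apply/funext => y; rewrite mxE. Qed.

Lemma mx_derivable_mul m n p (A : V -> 'M[R]_(m, n)) (B : V -> 'M[R]_(n, p)) z u :
  mx_derivable A z u -> mx_derivable B z u ->
  mx_derivable (fun y => A y *m B y) z u.
Proof.
move=> dA dB i j; rewrite mulmx_entryE; apply: derivable_big => k.
exact: derivable_mulr.
Qed.

Lemma mx_derive_mul m n p (A : V -> 'M[R]_(m, n)) (B : V -> 'M[R]_(n, p)) z u :
  mx_derivable A z u -> mx_derivable B z u ->
  mx_derive (fun y => A y *m B y) z u =
  mx_derive A z u *m B z + A z *m mx_derive B z u.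
Proof.
move=> dA dB; apply/matrixP => i j; rewrite mx_deriveE !mxE mulmx_entryE derive_big.
  rewrite -big_split; apply: eq_bigr => k _ /=.
  by rewrite derive_mulr// !mx_deriveE addrC [B z k j * _]mulrC.
by move=> k; exact: derivable_mulr.
Qed.

End MatrixDerivative.

HB.lock Definition mx_pair (R : realType) (n : nat) (A : 'M[R]_n) (a b : 'rV[R]_n) : R :=
  (a *m A *m b^T) 0 0.

Arguments mx_pair {R n}.

Lemma mx_pairE (R : realType) (n : nat) (A : 'M[R]_n) a b :
  mx_pair A a b = (a *m A *m b^T) 0 0.
Proof. by rewrite mx_pair.unlock. Qed.

Section Parallel.
Context (R : realType) (n : nat) (U : set 'rV[R]_n) (g J : 'rV[R]_n -> 'M[R]_n).
Hypothesis oU : open U.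
Hypothesis smooth_g : forall i j, smooth U (fun z => g z i j).
Hypothesis smooth_J : forall i j, smooth U (fun z => J z i j).
Hypothesis metric_g : forall z, U z -> metric_mx (g z).
Hypothesis complex_J : forall z, U z -> orthogonal_complex_mx (g z) (J z).

Local Notation dg z u := (mx_pair (mx_derive g z u)).
Local Notation ip z := (mx_pair (g z)).

Lemma derive_metric z u (a b : 'rV[R]_n) : U z ->
  'D_u (fun y => (a *m g y *m b^T) 0 0) z = dg z u a b.
Proof.
move=> Uz; have dg_ : mx_derivable g z u.
  by move=> i j; exact: smooth_derivable Uz.
transitivity (mx_derive (fun y => a *m g y *m b^T) z u 0 0); first by rewrite mx_deriveE.
have c := @mx_derivable_cst R _ _ _ _ z u.
rewrite !mx_derive_mul ?mx_derive_cst ?mul0mx ?add0r ?mulmx0 ?addr0 ?mx_pairE//;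
  exact: mx_derivable_mul.
Qed.

Lemma mx_pair_sym (A : 'M[R]_n) a b : A^T = A -> mx_pair A a b = mx_pair A b a.
Proof.
move=> AT; rewrite !mx_pairE.
transitivity ((a *m A *m b^T)^T 0 0); first by rewrite [RHS]mxE.
by rewrite !trmx_mul trmxK AT mulmxA.
Qed.

Lemma ip_sym z a b : U z -> ip z a b = ip z b a.
Proof. by move=> Uz; apply: mx_pair_sym; exact: (metric_g Uz).1. Qed.

Lemma dg_sym z u a b : U z -> dg z u a b = dg z u b a.
Proof.
move=> Uz; rewrite -!derive_metric//; apply: near_eq_derive.
apply: filterS (open_nbhs_nbhs (conj oU Uz)) => y Uy.
by rewrite -!mx_pairE ip_sym.
Qed.

(** Linearity in the direction is where differentiability of the metric is used:
    the Koszul formula only knows the derivatives along the coordinate vectors. *)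
Lemma dg_linear z (x a b : 'rV[R]_n) : U z ->
  dg z x a b = \sum_j x 0 j * dg z (delta_mx 0 j) a b.
Proof.
move=> Uz; have df : differentiable (fun y => (a *m g y *m b^T) 0 0) z.
  apply: smooth_differentiable Uz.
  rewrite mulmx_entryE; apply: smooth_sum => // k; apply: smoothM => //.
    rewrite mulmx_entryE; apply: smooth_sum => // l.
    by apply: smoothM => //; exact: smooth_cst.
  exact: smooth_cst.
rewrite -derive_metric// deriveE// [x in 'd _ _ x]row_sum_delta linear_sum.
apply: eq_bigr => j _; rewrite linearZ /=.
by rewrite -deriveE// derive_metric.
Qed.

Lemma mx_pair_linear_r (A : 'M[R]_n) (a x : 'rV[R]_n) :
  mx_pair A a x = \sum_j x 0 j * mx_pair A a (delta_mx 0 j).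
Proof.
rewrite mx_pairE; under eq_bigr do rewrite mx_pairE.
move: (a *m _) => Y; rewrite mxE; apply: eq_bigr => j _.
by rewrite trmx_delta -colE !mxE mulrC.
Qed.

(** The Koszul formula, tested against an arbitrary vector. *)
Lemma christoffelE z u a x : U z ->
  ip z (christoffel g z u a) x = 2^-1 * (dg z u a x + dg z a u x - dg z x u a).
Proof.
move=> Uz; rewrite mx_pairE /christoffel mulmxKV; last first.
  by apply: metric_mx_unit; exact: metric_g.
rewrite (dg_linear x u a Uz) (mx_pair_linear_r _ a x) (mx_pair_linear_r _ u x) mxE.
rewrite -big_split -sumrB big_distrr; apply: eq_bigr => j _ /=.
rewrite !mxE !derive_metric//.
move: (dg z _ a _) (dg z _ u (delta_mx _ _)) (dg z (delta_mx _ _) _ _) => p q r.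
ring.
Qed.

(** The connection is torsion-free. *)
Lemma christoffel_sym z u a x : U z ->
  ip z (christoffel g z u a) x = ip z (christoffel g z a u) x.
Proof. move=> Uz; rewrite (christoffelE _ _ _ Uz) (christoffelE _ _ _ Uz) (dg_sym x u a Uz).
by rewrite [dg z u a x + _]addrC. Qed.

Lemma christoffel_metric z u a b : U z ->
  dg z u a b = ip z (christoffel g z u a) b + ip z (christoffel g z u b) a.
Proof.
move=> Uz; rewrite (christoffelE _ _ _ Uz) (christoffelE _ _ _ Uz) (dg_sym u b a Uz).
move: (dg z u a b) (dg z a u b) (dg z b u a) => p q r.
by field.
Qed.

Lemma ip_skew z a b : U z -> ip z (a *m J z) b = - ip z (b *m J z) a.
Proof.
move=> Uz; rewrite !mx_pairE.
transitivity ((a *m J z *m g z *m b^T)^T 0 0); first by rewrite [RHS]mxE.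
rewrite !trmx_mul trmxK (metric_g Uz).1 !mulmxA -(mulmxA b (g z)).
rewrite (complex_metric_skew (metric_g Uz) (complex_J Uz)) mulmxN mulNmx mxE.
by rewrite !mulmxA.
Qed.

Hypothesis parallel_J : forall z u w, U z -> cov_deriv g J z u w = 0.

Local Notation w := (fun z => fund_mx (g z) (J z)).

(** Since J is parallel and the connection is metric, the covariant derivative of the
    fundamental form vanishes, so its plain derivative is given by the Christoffel
    terms of the two arguments. *)
Lemma derive_fund z u v : U z ->
  'D_u (fun y => w y v) z =
  ip z (christoffel g z u (row 0 v) *m J z) (row 1 v) -
  ip z (christoffel g z u (row 1 v) *m J z) (row 0 v).
Proof.
move=> Uz; pose a := row 0 v; pose b := row 1 v; rewrite -/a -/b.
have dg_ : mx_derivable g z u by move=> i j; exact: smooth_derivable Uz.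
have dJ : mx_derivable J z u by move=> i j; exact: smooth_derivable Uz.
have c (x : 'rV[R]_n) : mx_derivable (fun=> x) z u by exact: mx_derivable_cst.
have cT (x : 'cV[R]_n) : mx_derivable (fun=> x) z u by exact: mx_derivable_cst.
have daJ : a *m mx_derive J z u =
    christoffel g z u a *m J z - christoffel g z u (a *m J z).
  have := parallel_J u a Uz; rewrite /cov_deriv.
  have -> : \row_j 'D_u (fun y => (a *m J y) 0 j) z = a *m mx_derive J z u.
    transitivity (mx_derive (fun y => a *m J y) z u).
      by apply/rowP => j; rewrite mxE mx_deriveE.
    by rewrite mx_derive_mul// mx_derive_cst mul0mx add0r.
  by move=> /eqP; rewrite subr_eq0 -subr_eq0 => /eqP h; apply/eqP; rewrite -subr_eq0 -h opprB addrA.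
transitivity (mx_derive (fun y => a *m J y *m g y *m b^T) z u 0 0).
  by rewrite mx_deriveE.
have d1 := mx_derivable_mul (c a) dJ; have d2 := mx_derivable_mul d1 dg_.
rewrite mx_derive_mul// (mx_derive_mul d1)// (mx_derive_mul (c a))//.
rewrite !mx_derive_cst mulmx0 addr0 mul0mx add0r daJ mulmxDl mxE.
set x := christoffel g z u a *m J z; set y := christoffel g z u (a *m J z).
rewrite (_ : ((x - y) *m g z *m b^T) 0 0 = ip z x b - ip z y b); last first.
  by rewrite !mx_pairE !mulmxBl mxE [X in _ + X]mxE.
rewrite -mx_pairE (christoffel_metric _ _ _ Uz) -/y.
rewrite (ip_sym (christoffel g z u b) (a *m J z) Uz).
rewrite (ip_skew a (christoffel g z u b) Uz).
by rewrite addrA subrK.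
Qed.

(** By the preceding lemma each of the three derivatives is a difference of two values
    of T, and T is symmetric in its first two arguments because the connection is
    torsion-free. The six values cancel in pairs. *)
Lemma parallel_closed z : U z -> exd w z = fun=> 0.
Proof.
move=> Uz; apply/funext => v; rewrite /exd !big_ord_recl big_ord0 addr0.
pose T (x y y' : 'rV[R]_n) := ip z (christoffel g z x y *m J z) y'.
have symT x y y' : T x y y' = T y x y'.
  have E c : ip z (c *m J z) y' = - ip z c (y' *m J z).
    by rewrite (ip_skew c y' Uz) (ip_sym (y' *m J z) c Uz).
  apply: etrans (E (christoffel g z x y)) _.
  apply: etrans _ (esym (E (christoffel g z y x))).
  exact: (congr1 -%R (christoffel_sym x y (y' *m J z) Uz)).
have dE i j k : row 0 (row' i v) = row j v -> row 1 (row' i v) = row k v ->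
    'D_(row i v) (fun y => w y (row' i v)) z =
    T (row i v) (row j v) (row k v) - T (row i v) (row k v) (row j v).
  by move=> jE kE; rewrite (derive_fund _ _ Uz) jE kE.
pose i0 : 'I_3 := ord0; pose i1 : 'I_3 := lift ord0 ord0.
pose i2 : 'I_3 := lift ord0 (lift ord0 ord0).
rewrite -/i0 -/i1 -/i2 (dE i0 i1 i2) ?(dE i1 i0 i2) ?(dE i2 i0 i1);
  try (by apply/rowP => c; rewrite !mxE; congr (v _ _); apply: val_inj).
rewrite (symT (row i1 v) (row i0 v)) (symT (row i2 v) (row i0 v)).
rewrite (symT (row i2 v) (row i1 v)) /= /bump /= expr0 expr1 -signr_odd /=.
move: (T _ _ _) (T _ _ _) (T _ _ _) => p q r; ring.
Qed.

End Parallel.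

(** * Differential forms on manifolds *)

Section FormFields.
Context (R : realType) (n : nat) (N : manifold R n) (W : set N).

Lemma chart_setS (V : set N) i : V `<=` W -> chart_set V i `<=` chart_set W i.
Proof. by move=> VW z [p [dp /VW Wp] <-]; exists p. Qed.

Lemma chart_set_open i : open W -> open (chart_set W i).
Proof.
move=> oW; rewrite openE => z [p [dp Wp] pz].
have zi : (Defs.coord N i @` dom N i) z by exists p.
have nW : nbhs z (param N i @^-1` W).
  apply: (param_cont zi); apply: open_nbhs_nbhs; split => //.
  by rewrite -pz coordK.
have nc : nbhs z (Defs.coord N i @` dom N i).
  by apply: open_nbhs_nbhs; split => //; exact: coord_open.
apply: filterS2 nW nc => y Wy [q dq qy]; exists q => //; split => //.
by move: Wy; rewrite -qy /preimage /= coordK.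
Qed.

Lemma is_form_sub (V : set N) k (w : form_field N k) :
  V `<=` W -> is_form W w -> is_form V w.
Proof.
move=> VW [aw sw tw]; split => [i z /(chart_setS VW)|i v|i j z v]; first exact: aw.
  exact: smooth_sub (chart_setS VW) (sw i v).
by move=> [p [dp [/VW Wp jp]] pz]; apply: tw; exists p.
Qed.

Hypothesis oW : forall i, open (chart_set W i).

Lemma is_form_wedge k l (a : form_field N k) (b : form_field N l) :
  is_form W a -> is_form W b -> is_form W (fun i z => a i z ∧ b i z).
Proof.
move=> [aa sa ta] [ab sb tb]; split => [i z Wz|i v|i j z v Wz].
- by apply: alternating_wedge; [exact: aa|exact: ab].
- apply: smoothM => //; first exact: smooth_cst.
  apply: smooth_sum => // s; apply: smoothM => //; first exact: smooth_cst.
  exact: smoothM.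
- have := congr1 (@^~ v) (wedge_pullback ('J (transition i j) z)
    (a j (transition i j z)) (b j (transition i j z))) => /= ->.
  congr (wedge _ _ _); apply/funext => u; [exact: ta|exact: tb].
Qed.

Lemma is_formD k (a b : form_field N k) :
  is_form W a -> is_form W b -> is_form W (fun i z => a i z \+ b i z).
Proof.
move=> [aa sa ta] [ab sb tb]; split => [i z Wz|i v|i j z v Wz].
- by apply: alternatingD; [exact: aa|exact: ab].
- exact: smoothD.
- by rewrite /= (ta _ _ _ _ Wz) (tb _ _ _ _ Wz).
Qed.

Lemma is_form_scale k (f : charts N -> 'rV[R]_n -> R) (a : form_field N k) :
  (forall i, smooth (chart_set W i) (f i)) ->
  (forall i j z, chart_set (W `&` dom N j) i z -> f i z = f j (transition i j z)) ->
  is_form W a -> is_form W (fun i z => f i z \*o a i z).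
Proof.
move=> sf tf [aa sa ta]; split => [i z Wz|i v|i j z v Wz].
- by apply: alternatingZ; exact: aa.
- exact: smoothM.
- by rewrite /= (ta _ _ _ _ Wz) (tf _ _ _ Wz).
Qed.

Lemma form_near_chart k (w : form_field N k) i z :
  (forall y, chart_set W i y -> skew_form (w i y)) -> is_form W w ->
  chart_set W i z -> form_near (w i) z.
Proof.
move=> aw [_ sw _] Wz; split => [|v u]; last exact: smooth_derivable (sw i v) Wz.
have nz : nbhs z (chart_set W i) by apply: open_nbhs_nbhs; split.
by apply: (@filterS _ (nbhs z) _ _ _ _ nz) => y; exact: aw.
Qed.

End FormFields.

Section Riemannian.
Context (R : realType) (M : manifold R 4) (g J : mx_field M).
Hypotheses (rg : is_riemannian g) (oJ : orthogonal_acs g J).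

Lemma metric_at i z : chart_set setT i z -> metric_mx (g i z).
Proof. by case: rg => _ gT pg _ iz; split=> [|v v0]; [exact: gT|exact: (pg i)]. Qed.

Lemma complex_at i z : chart_set setT i z ->
  orthogonal_complex_mx (g i z) (J i z).
Proof. by case: oJ => _ JJ JgJ iz; split; [exact: JJ|exact: JgJ]. Qed.

Lemma fund_formE i z : fund_form g J i z = fund_mx (g i z) (J i z).
Proof. by []. Qed.

Lemma chart_setT_open i : open (chart_set (setT : set M) i).
Proof. by apply: chart_set_open; exact: openT. Qed.

Lemma fund_mx_skew n (h K : 'M[R]_n) :
  metric_mx h -> orthogonal_complex_mx h K -> skew_form (fund_mx h K).
Proof.
move=> mh oK s v.
have skew (u : 'M[R]_(2, n)) : fund_mx h K (row_perm (tperm 0 1) u) = - fund_mx h K u.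
  rewrite /fund_mx; transitivity ((row 1 u *m K *m h *m (row 0 u)^T)^T 0 0).
    have -> : row 0 (row_perm (tperm 0 1) u) = row 1 u.
      by apply/rowP => j; rewrite !mxE tpermL.
    have -> : row 1 (row_perm (tperm 0 1) u) = row 0 u.
      by apply/rowP => j; rewrite !mxE tpermR.
    by rewrite [RHS]mxE.
  rewrite !trmx_mul trmxK mh.1 !mulmxA -(mulmxA (row 0 u) h) (complex_metric_skew mh oK).
  by rewrite mulmxN mulNmx mxE !mulmxA.
have [s01|s01] := eqVneq (s 0) 0.
  have -> : s = 1%g.
    apply/permP => i; rewrite perm1; case: (eqVneq i 0) => [->//|i0].
    have : s i != 0 by rewrite -s01 (inj_eq perm_inj).
    by case: i i0 => -[|[|//]] // hi _; case: (s _) => -[|[|//]] // hj _; apply: val_inj.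
  by rewrite row_perm1 odd_perm1 mul1r.
have -> : s = tperm 0 1.
  apply/permP => i; have s0 : s 0 = 1.
    by case: (s 0) s01 => -[|[|//]] // hi _; apply: val_inj.
  case: tpermP => [->//|->|i0 i1].
    have : s 1 != 1 by rewrite -s0 (inj_eq perm_inj).
    by case: (s 1) => -[|[|//]] // hi _; apply: val_inj.
  by case: i i0 i1 => -[|[|//]] hi; [case|move=> _; case]; apply: val_inj.
by rewrite skew odd_tperm mulN1r.
Qed.

(** The transformation laws of g and J combine to that of the form, since J D = D J'
    moves the Jacobian past J. *)
Lemma fund_form_is_form : is_form setT (fund_form g J).
Proof.
split => [i z iz|i v|i j z v [p [dp [_ jp]] pz]].
- rewrite fund_formE; split.
    move=> A B C k x y; rewrite /fund_mx.
    case: (eqVneq k 0) => [->|k0] A0 /eq_row'P BA /eq_row'P CA.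
      by rewrite A0 (BA 1)// (CA 1)// !mulmxDl -!scalemxAl mxE !mxE.
    have k1 : k = 1.
      by case: k k0 {A0 BA CA} => -[|[|//]] // hk _; apply: val_inj.
    rewrite k1 in A0 BA CA; rewrite A0 (BA 0)// (CA 0)// linearD !linearZ /=.
    by rewrite mulmxDr -!scalemxAr mxE !mxE.
  move=> A k l kl Akl.
  have := fund_mx_skew (metric_at iz) (complex_at iz) (tperm k l) A.
  rewrite odd_tperm kl (_ : row_perm _ _ = A); first by lra.
  have AE c : A k c = A l c by have /rowP/(_ c) := Akl; rewrite !mxE.
  by apply/matrixP => h c; rewrite mxE; case: tpermP => // ->.
- case: rg => sg _ _ _; case: oJ => -[sJ _] _ _.
  have oi : open (chart_set (setT : set M) i) by exact: chart_setT_open.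
  rewrite /fund_form mulmx_entryE; apply: smooth_sum => // k.
  apply: smoothM => //; last exact: smooth_cst.
  rewrite mulmx_entryE; apply: smooth_sum => // l; apply: smoothM => //.
  rewrite mulmx_entryE; apply: smooth_sum => // h; apply: smoothM => //.
  exact: smooth_cst.
- rewrite /fund_form; case: rg => _ _ _ tg; case: oJ => -[_ tJ] _ _.
  have iz : chart_set (dom M j) i z by exists p.
  rewrite (tg _ _ _ iz) /= !row_mul trmx_mul !mulmxA.
  by rewrite -(mulmxA (row 0 v)) (tJ _ _ _ iz) !mulmxA.
Qed.
End Riemannian.

(** * Hyperkahler manifolds in charts *)

Section RiemannianClosed.
Context (R : realType) (M : manifold R 4) (g : mx_field M).
Hypothesis rg : is_riemannian g.

Lemma parallel_fund_closed (J : mx_field M) :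
  orthogonal_acs g J -> parallel g J -> form_closed setT (fund_form g J).
Proof.
move=> oJ pJ i z iz; rewrite /ext_d /=.
case: (rg) => sg _ _ _; case: (oJ) => -[sJ _] _ _.
apply: (@parallel_closed R 4 (chart_set setT i) (g i) (J i)) => //.
- exact: chart_setT_open.
- by move=> y; exact: metric_at.
- by move=> y; exact: complex_at.
- by move=> y u w; exact: pJ.
Qed.

Lemma hyperkahler_at (J1 J2 J3 : mx_field M) i z :
  hyperkahler g J1 J2 J3 -> chart_set setT i z ->
  hyperkahler_mx (g i z) (J1 i z) (J2 i z) (J3 i z).
Proof.
move=> [_ [c1 c2 c3] _ J21] iz.
by split; [exact: metric_at|exact: complex_at|exact: complex_at|exact: complex_at|exact: J21].
Qed.

End RiemannianClosed.

(** * Products with a Euclidean space *)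

Section Product.
Context (R : realType) (n : nat) (M : manifold R n).

Lemma derive_coord (m : nat) (j : 'I_m) (z v : 'rV[R]_m) :
  'D_v (fun y : 'rV[R]_m => y 0 j) z = v 0 j.
Proof.
apply: cvg_lim => //; apply: cvg_near_cst.
near=> h; rewrite /= !mxE addrK /GRing.scale /= mulKf//.
by near: h; exact: nbhs_dnbhs_neq.
Unshelve. all: by end_near. Qed.

Lemma derive_linear (m p : nat) (A : 'M[R]_(m, p)) (f : 'rV[R]_p -> R) z v :
  'D_v (fun y : 'rV[R]_m => f (y *m A)) z = 'D_(v *m A) f (z *m A).
Proof.
by rewrite /derive /=; under eq_fun do rewrite mulmxDl -scalemxAl.
Qed.

Lemma prod_transitionE m i j z : transition (M := prod_manifold m M) i j z =
  row_mx (lsubmx z) (transition (M := M) i j (rsubmx z)).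
Proof. by []. Qed.

Lemma rsubmxE k m (v : 'M[R]_(k, m + n)) : rsubmx v = v *m col_mx 0 1%:M.
Proof. by rewrite -[in RHS](hsubmxK v) mul_row_col mulmx0 add0r mulmx1. Qed.

(** The transition maps of the product are the identity on the Euclidean factor. The
    matrix is identified through the directional derivatives of the components. *)
Lemma jacobian_prod m i j (z : 'rV[R]_(m + n)) :
  chart_set (dom M j) i (rsubmx z) ->
  'J (transition (M := prod_manifold m M) i j) z =
  block_mx 1%:M 0 0 ('J (transition (M := M) i j) (rsubmx z)).
Proof.
move=> iz; set T := transition (M := M) i j; pose F z := row_mx (lsubmx z) (T (rsubmx z)) : 'rV[R]_(m + n).
have dT a : differentiable (fun y => T y 0 a) (rsubmx z).
  exact: smooth_differentiable (transition_smooth i j a) iz.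
have FlE a : (fun y => F y 0 (lshift n a)) = fun y => y 0 (lshift n a).
  by apply/funext => y; rewrite row_mxEl mxE.
have FrE a : (fun y => F y 0 (rshift m a)) = fun y => T (y *m col_mx 0 1%:M) 0 a.
  by apply/funext => y; rewrite row_mxEr rsubmxE.
have dF : differentiable F z.
  apply: differentiable_row => c; rewrite -(splitK c).
  case: (fintype.split c) => a; rewrite /unsplit ?FlE ?FrE.
    exact: differentiable_coord.
  apply: (@differentiable_comp _ _ _ _ (mulmxr (col_mx 0 1%:M)) (fun y => T y 0 a)).
    exact: differentiable_mulmxr.
  by rewrite /= -rsubmxE.
have DF (v : 'rV[R]_(m + n)) : v *m 'J F z = row_mx (lsubmx v) (rsubmx v *m 'J T (rsubmx z)).
  have <- := deriveEjacobian v dF.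
  have <- := deriveEjacobian (rsubmx v) (differentiable_row dT).
  rewrite derive_mx; last exact: diff_derivable.
  apply/rowP => c; rewrite [LHS]mxE -(splitK c).
  case: (fintype.split c) => a; rewrite /unsplit.
    by rewrite FlE derive_coord row_mxEl mxE.
  rewrite row_mxEr FrE (derive_linear (col_mx 0 1%:M) (fun y => T y 0 a)).
  rewrite -!rsubmxE derive_mx ?mxE//.
  by apply: diff_derivable; exact: differentiable_row.
apply/row_matrixP => c; rewrite !rowE [LHS]DF.
rewrite -[X in _ = X *m _](hsubmxK (delta_mx 0 c)).
by rewrite mul_row_block !mulmx0 mulmx1 add0r addr0.
Qed.

End Product.

Section Slab.
Context (R : realType) (n : nat) (M : manifold R n) (a : R) (b : \bar R) (M' : set M).

Definition slab_time m (z : 'rV[R]_(m.+1 + n)) : R := z 0 (lshift n 0).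

Lemma chart_slab m (V : set M) i (z : 'rV[R]_(m.+1 + n)) :
  chart_set (slab m a b M' `&` [set q | V q.2]) i z <->
  [/\ a < slab_time z, ((slab_time z)%:E < b)%E & chart_set (M' `&` V) i (rsubmx z)].
Proof.
split=> [[[x p] /= [dp [[/= ax xb Mp] Vp]] <-]|[az zb [p [dp [Mp Vp]] pz]]].
  rewrite /slab_time /prod_coord /= row_mxEl row_mxKr; split => //.
  by exists p.
exists (lsubmx z, p); last by rewrite /= /prod_coord /= pz hsubmxK.
by split => //; split => //; split; rewrite //= mxE.
Qed.

Lemma chart_slabT m i (z : 'rV[R]_(m.+1 + n)) :
  chart_set (slab m a b M') i z <->
  [/\ a < slab_time z, ((slab_time z)%:E < b)%E & chart_set M' i (rsubmx z)].
Proof.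
by have := chart_slab setT i z; rewrite !setIT.
Qed.

Lemma slab_open m : open M' -> open (slab m a b M').
Proof.
move=> oM.
have ct : continuous (fun q : prod_manifold m.+1 M => (q : 'rV[R]_m.+1 * M).1 0 0 : R).
  move=> q; apply: (@continuous_comp _ _ _ fst (fun x : 'rV[R]_m.+1 => x 0 0)).
    exact: cvg_fst.
  exact: coord_continuous.
rewrite (_ : slab m a b M' =
  ((fun q : prod_manifold m.+1 M => (q : 'rV[R]_m.+1 * M).1 0 0) @^-1` [set t | a < t]) `&`
  (((fun q : prod_manifold m.+1 M => (q : 'rV[R]_m.+1 * M).1 0 0) @^-1`
     [set t | (t%:E < b)%E]) `&`
   (snd : 'rV[R]_m.+1 * M -> M) @^-1` M')); last first.
  by apply/seteqP; split => q; [case=> ? ? ?|case=> ? [? ?]].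
apply: openI; first by apply: open_comp => [q _|]; [exact: ct|exact: open_gt].
apply: openI; last by apply: open_comp => [q _|//]; exact: cvg_snd.
apply: open_comp => [q _|]; first exact: ct.
case: b => [s| |].
- rewrite (_ : [set _ | _] = [set t | t < s]); first exact: open_lt.
  by apply/seteqP; split => t /=; rewrite lte_fin.
- rewrite (_ : [set _ | _] = setT); first exact: openT.
  by apply/seteqP; split => t //= _; rewrite ltry.
- rewrite (_ : [set _ | _] = set0); first exact: open0.
  by apply/seteqP; split => t.
Qed.

Lemma is_form_pull_base m k (w : form_field M k) :
  is_form M' w -> is_form (slab m a b M') (pull_base m.+1 w).
Proof.
move=> [aw sw tw]; split => [i z /chart_slabT[_ _ Wz]|i v|i j z v].
- rewrite /pull_base (_ : (fun v => _) = fun v => w i (rsubmx z) (v *m col_mx 0 1%:M)).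
    exact/alternating_pullback/aw.
  by apply/funext => v; rewrite -rsubmxE.
- apply: (@smooth_sub _ _ [set z | chart_set M' i (z *m col_mx 0 1%:M)]).
    by move=> z /chart_slabT[_ _]; rewrite /= -rsubmxE.
  rewrite (_ : (fun z => _) = fun z => w i (z *m col_mx 0 1%:M) (rsubmx v)).
    exact: smooth_linear (sw i _).
  by apply/funext => z; rewrite /pull_base -rsubmxE.
- move=> /(chart_slab (dom M j))[_ _ Wz].
  rewrite /pull_base (tw _ _ _ _ Wz) prod_transitionE row_mxKr.
  rewrite jacobian_prod; last by move: Wz => [p [dp [_ jp]] pz]; exists p.
  rewrite -[in RHS](hsubmxK v) mul_row_block row_mxKr mulmx0 add0r.
  by [].
Qed.

Lemma ext_d_pull_base m k (w : form_field M k) i (z : 'rV[R]_(m + n)) :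
  ext_d (pull_base m w) i z = fun v => ext_d w i (rsubmx z) (rsubmx v).
Proof.
rewrite /ext_d (_ : pull_base m w i =
  fun z v => w i (z *m col_mx 0 1%:M) (v *m col_mx 0 1%:M)); last first.
  by apply/funext => y; apply/funext => v; rewrite /pull_base -!rsubmxE.
by rewrite exd_linear; apply/funext => v; rewrite -!rsubmxE.
Qed.

Lemma is_form_dcoord m (j : 'I_m.+1) :
  is_form (slab m a b M') (fun i z => dcoord n j).
Proof.
split => [i z _|i v|i j' z v /(chart_slab (dom M j'))[_ _ Wz]].
- by apply: alternating1 => x y u v; rewrite /dcoord !mxE.
- exact: smooth_cst.
- rewrite jacobian_prod; last by move: Wz => [p [dp [_ jp]] pz]; exists p.
  rewrite -[in RHS](hsubmxK v) mul_row_block mulmx1 mulmx0 addr0 /dcoord.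
  by rewrite row_mxEl mxE.
Qed.

Lemma slab_time_transition m i j (z : 'rV[R]_(m.+1 + n)) :
  slab_time (transition (M := prod_manifold m.+1 M) i j z) = slab_time z.
Proof. by rewrite prod_transitionE /slab_time row_mxEl mxE. Qed.

Definition pull_mx m l : 'M[R]_(m + n, l + n) := block_mx (pid_mx l) 0 0 1%:M.

Lemma mul_pull_mx k m l (v : 'M[R]_(k, m + n)) :
  v *m pull_mx m l = row_mx (lsubmx v *m pid_mx l) (rsubmx v).
Proof.
by rewrite -{1}(hsubmxK v) mul_row_block !mulmx0 mulmx1 addr0 add0r.
Qed.

Lemma slab_time_pull m l (z : 'rV[R]_(m.+1 + n)) :
  slab_time (z *m pull_mx m.+1 l.+1) = slab_time z.
Proof.
rewrite mul_pull_mx /slab_time row_mxEl mxE (bigD1 0)//= big1 => [|k k0].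
  by rewrite !mxE /= mulr1 addr0.
by move: k0; rewrite -val_eqE !mxE /= => /negPf ->; rewrite mulr0.
Qed.

Lemma is_form_pull_prod m l k (w : form_field (prod_manifold l.+1 M) k) :
  is_form (slab l a b M') w -> is_form (slab m a b M') (pull_prod m.+1 w).
Proof.
move=> [aw sw tw].
have pz (V : set M) i z : chart_set (slab m a b M' `&` [set q | V q.2]) i z ->
    chart_set (slab l a b M' `&` [set q | V q.2]) i (z *m pull_mx m.+1 l.+1).
  move=> /chart_slab[? ? ?]; apply/chart_slab; rewrite slab_time_pull; split => //.
  by rewrite mul_pull_mx row_mxKr.
have pzT i z : chart_set (slab m a b M') i z ->
    chart_set (slab l a b M') i (z *m pull_mx m.+1 l.+1).
  by have := pz setT i z; rewrite !setIT.
split => [i z /pzT Wz|i v|i j z v Wz].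
- exact/alternating_pullback/aw.
- apply: (@smooth_sub _ _ [set z | chart_set (slab l a b M') i (z *m pull_mx m.+1 l.+1)]).
    by move=> z /pzT.
  exact: smooth_linear (sw i _).
- rewrite /pull_prod -/(pull_mx m.+1 l.+1) (tw _ j); last exact: (pz (dom M j)).
  have iz : chart_set (dom M j) i (rsubmx z).
    by have [_ _ [p [dp [_ jp]] qz]] := (chart_slab (dom M j) i z).1 Wz; exists p.
  have vE p (u : 'M[R]_(k, p + n)) D :
      u *m block_mx 1%:M 0 0 D = row_mx (lsubmx u) (rsubmx u *m D).
    by rewrite -{1}(hsubmxK u) mul_row_block !mulmx0 mulmx1 addr0 add0r.
  rewrite !jacobian_prod ?mul_pull_mx ?row_mxKr// !vE prod_transitionE.
  by rewrite !row_mxKl !row_mxKr.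
Qed.

Lemma ext_d_pull_prod m l k (w : form_field (prod_manifold l M) k) i (z : 'rV[R]_(m + n)) :
  ext_d (pull_prod m w) i z =
  fun v => ext_d w i (z *m pull_mx m l) (v *m pull_mx m l).
Proof. by rewrite /ext_d /pull_prod /= exd_linear. Qed.

End Slab.

(** * Words in one-forms *)

(** A sealed copy of the wedge product. The latter unfolds to a scalar multiple, so the
    rules that extract scalars would also match inside it. *)
HB.lock Definition ext_prod (R : realType) (k l n : nat) (a : mform R k n)
  (b : mform R l n) : mform R (k + l) n := a ∧ b.
Arguments ext_prod {R k l n}.

Section Words.
Context (R : realType) (n : nat).
Implicit Types x y z t u : mform R 1 n.

(** For a first factor of explicit degree the two sides have convertible types, and
    the cast in the associativity law disappears. *)
Lemma wedgeA1 l m x (b : mform R l n) (c : mform R m n) :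
  @wedge R 1 (l + m) n x (b ∧ c) = @wedge R (1 + l) m n (x ∧ b) c.
Proof.
by apply/funext => v; rewrite wedgeA_cast castmx_id.
Qed.

Lemma wedgeA2 l m (a : mform R 2 n) (b : mform R l n) (c : mform R m n) :
  @wedge R 2 (l + m) n a (b ∧ c) = @wedge R (2 + l) m n (a ∧ b) c.
Proof.
by apply/funext => v; rewrite wedgeA_cast castmx_id.
Qed.

Lemma wedgeA3 l m (a : mform R 3 n) (b : mform R l n) (c : mform R m n) :
  @wedge R 3 (l + m) n a (b ∧ c) = @wedge R (3 + l) m n (a ∧ b) c.
Proof.
by apply/funext => v; rewrite wedgeA_cast castmx_id.
Qed.

(** Monomials in 1-forms, with the degree written as a numeral. Products of words
    whose degrees are sums are brought to this form by [ext_wordE]. *)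
Definition word2 x y : mform R 2 n := ext_prod x y.
Definition word3 x y z : mform R 3 n := ext_prod (word2 x y) z.
Definition word4 x y z t : mform R 4 n := ext_prod (word3 x y z) t.
Definition word5 x y z t u : mform R 5 n := ext_prod (word4 x y z t) u.

Lemma wedge_ext k l (a : mform R k n) (b : mform R l n) : a ∧ b = ext_prod a b.
Proof. by rewrite ext_prod.unlock. Qed.

Lemma extDl k l (a b : mform R k n) (c : mform R l n) :
  ext_prod (a \+ b) c = ext_prod a c \+ ext_prod b c.
Proof. by rewrite -!wedge_ext wedgeDl. Qed.

Lemma extDr k l (a : mform R k n) (b c : mform R l n) :
  ext_prod a (b \+ c) = ext_prod a b \+ ext_prod a c.
Proof. by rewrite -!wedge_ext wedgeDr. Qed.

Lemma extZl k l c (a : mform R k n) (b : mform R l n) :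
  ext_prod (c \*o a) b = c \*o ext_prod a b.
Proof. by rewrite -!wedge_ext wedgeZl. Qed.

Lemma extZr k l c (a : mform R k n) (b : mform R l n) :
  ext_prod a (c \*o b) = c \*o ext_prod a b.
Proof. by rewrite -!wedge_ext wedgeZr. Qed.

Definition ext_linear := (extDl, extDr, extZl, extZr).

Lemma ext_word11 x y : @ext_prod R 1 1 n x y = word2 x y.
Proof. by []. Qed.

Lemma ext_word21 x y z : @ext_prod R 2 1 n (word2 x y) z = word3 x y z.
Proof. by []. Qed.

Lemma ext_word31 x y z t : @ext_prod R 3 1 n (word3 x y z) t = word4 x y z t.
Proof. by []. Qed.

Lemma ext_word41 x y z t u :
  @ext_prod R 4 1 n (word4 x y z t) u = word5 x y z t u.
Proof. by []. Qed.

Lemma ext_word12 x y z : @ext_prod R 1 2 n x (word2 y z) = word3 x y z.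
Proof.
by have := @wedgeA1 1 1 x y z; rewrite !wedge_ext.
Qed.

Lemma ext_word22 x y z t :
  @ext_prod R 2 2 n (word2 x y) (word2 z t) = word4 x y z t.
Proof.
by have := @wedgeA2 1 1 (word2 x y) z t; rewrite !wedge_ext.
Qed.

Lemma ext_word32 x y z t u :
  @ext_prod R 3 2 n (word3 x y z) (word2 t u) = word5 x y z t u.
Proof.
by have := @wedgeA3 1 1 (word3 x y z) t u; rewrite !wedge_ext.
Qed.

Lemma ext_word13 x y z t : @ext_prod R 1 3 n x (word3 y z t) = word4 x y z t.
Proof.
by have := @wedgeA1 2 1 x (word2 y z) t; rewrite !wedge_ext ext_word12. Qed.

Lemma ext_word14 x y z t u :
  @ext_prod R 1 4 n x (word4 y z t u) = word5 x y z t u.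
Proof.
by have := @wedgeA1 3 1 x (word3 y z t) u; rewrite !wedge_ext ext_word13. Qed.

Definition ext_wordE := (ext_word11, ext_word21, ext_word31,
  ext_word41, ext_word12, ext_word22, ext_word32, ext_word13,
  ext_word14).

Lemma ext11C x y : ext_prod x y = -1 \*o ext_prod y x.
Proof. by rewrite -!wedge_ext wedge11C. Qed.

Lemma ext_swap k (a : mform R k n) x y :
  ext_prod (ext_prod a x) y = -1 \*o ext_prod (ext_prod a y) x.
Proof. by rewrite -!wedge_ext wedge_swap. Qed.

Lemma word3C12 x y z v : word3 x y z v = - word3 y x z v.
Proof. by rewrite /word3 /word2 (ext11C x) extZl /= mulN1r. Qed.

Lemma word4C12 x y z t v : word4 x y z t v = - word4 y x z t v.
Proof. by rewrite /word4 /word3 /word2 (ext11C x) !extZl /= mulN1r. Qed.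

Lemma word4C23 x y z t v : word4 x y z t v = - word4 x z y t v.
Proof. by rewrite /word4 /word3 /word2 (ext_swap x) !extZl /= mulN1r. Qed.

Lemma word4C34 x y z t v : word4 x y z t v = - word4 x y t z v.
Proof. by rewrite /word4 /word3 (ext_swap (word2 x y)) /= mulN1r. Qed.

Lemma word5C12 x y z t u v : word5 x y z t u v = - word5 y x z t u v.
Proof. by rewrite /word5 /word4 /word3 /word2 (ext11C x) !extZl /= mulN1r. Qed.

Lemma word5C23 x y z t u v : word5 x y z t u v = - word5 x z y t u v.
Proof. by rewrite /word5 /word4 /word3 /word2 (ext_swap x) !extZl /= mulN1r. Qed.

Lemma word5C34 x y z t u v : word5 x y z t u v = - word5 x y t z u v.
Proof. by rewrite /word5 /word4 /word3 (ext_swap (word2 x y)) !extZl /= mulN1r. Qed.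

Lemma word5C45 x y z t u v : word5 x y z t u v = - word5 x y z u t v.
Proof. by rewrite /word5 /word4 (ext_swap (word3 x y z)) /= mulN1r. Qed.

(** A word with a repeated letter vanishes. With the exchange rules this leaves
    finitely many words, between which the remaining identities are polynomial. *)
Lemma word4_dup12 x z t v : word4 x x z t v = 0.
Proof. by have := word4C12 x x z t v; lra. Qed.
Lemma word4_dup13 x y t v : word4 x y x t v = 0.
Proof. by rewrite word4C23 word4_dup12 oppr0. Qed.
Lemma word4_dup14 x y z v : word4 x y z x v = 0.
Proof. by rewrite word4C34 word4_dup13 oppr0. Qed.
Lemma word4_dup23 x y t v : word4 x y y t v = 0.
Proof. by rewrite word4C12 word4_dup13 oppr0. Qed.
Lemma word4_dup24 x y z v : word4 x y z y v = 0.
Proof. by rewrite word4C12 word4_dup14 oppr0. Qed.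

Definition word4_dup :=
  (word4_dup12, word4_dup13, word4_dup14, word4_dup23, word4_dup24).

Lemma word5_dup12 x z t u v : word5 x x z t u v = 0.
Proof. by have := word5C12 x x z t u v; lra. Qed.
Lemma word5_dup13 x y t u v : word5 x y x t u v = 0.
Proof. by rewrite word5C23 word5_dup12 oppr0. Qed.
Lemma word5_dup14 x y z u v : word5 x y z x u v = 0.
Proof. by rewrite word5C34 word5_dup13 oppr0. Qed.
Lemma word5_dup15 x y z t v : word5 x y z t x v = 0.
Proof. by rewrite word5C45 word5_dup14 oppr0. Qed.
Lemma word5_dup23 x y t u v : word5 x y y t u v = 0.
Proof. by rewrite word5C12 word5_dup13 oppr0. Qed.
Lemma word5_dup24 x y z u v : word5 x y z y u v = 0.
Proof. by rewrite word5C12 word5_dup14 oppr0. Qed.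
Lemma word5_dup25 x y z t v : word5 x y z t y v = 0.
Proof. by rewrite word5C12 word5_dup15 oppr0. Qed.

Definition word5_dup := (word5_dup12, word5_dup13, word5_dup14, word5_dup15,
  word5_dup23, word5_dup24, word5_dup25).

Lemma wedge0l k l (b : mform R l n) :
  ((fun=> 0) : mform R k n) ∧ b = fun=> 0.
Proof.
apply/funext => v; rewrite /wedge big1 ?mulr0// => s _.
by rewrite mul0r mulr0.
Qed.

Lemma wedge0r k l (a : mform R k n) :
  a ∧ ((fun=> 0) : mform R l n) = fun=> 0.
Proof.
apply/funext => v; rewrite /wedge big1 ?mulr0// => s _.
by rewrite !mulr0.
Qed.

Lemma ext0l k l (b : mform R l n) :
  ext_prod ((fun=> 0) : mform R k n) b = fun=> 0.
Proof. by rewrite -wedge_ext wedge0l. Qed.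

Lemma ext0r k l (a : mform R k n) :
  ext_prod a ((fun=> 0) : mform R l n) = fun=> 0.
Proof. by rewrite -wedge_ext wedge0r. Qed.

End Words.

Section Leibniz.
Context (R : realType) (n : nat).

(** The Leibniz rule in explicit degrees, again free of casts. *)
Lemma exd_wedge1 l (a : 'rV[R]_n -> mform R 1 n) (b : 'rV[R]_n -> mform R l n) z :
  form_near a z -> form_near b z ->
  exd (fun y => a y ∧ b y) z =
  @wedge R 2 l n (exd a z) (b z) \+ -1 \*o @wedge R 1 l.+1 n (a z) (exd b z).
Proof.
by move=> ha hb; apply/funext => v; rewrite exd_wedge// castmx_id expr1.
Qed.

Lemma exd_wedge2 l (a : 'rV[R]_n -> mform R 2 n) (b : 'rV[R]_n -> mform R l n) z :
  form_near a z -> form_near b z ->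
  exd (fun y => a y ∧ b y) z =
  @wedge R 3 l n (exd a z) (b z) \+ @wedge R 2 l.+1 n (a z) (exd b z).
Proof.
move=> ha hb; apply/funext => v.
by rewrite exd_wedge// castmx_id -signr_odd expr0 mul1r.
Qed.

Lemma exd_wedge3 l (a : 'rV[R]_n -> mform R 3 n) (b : 'rV[R]_n -> mform R l n) z :
  form_near a z -> form_near b z ->
  exd (fun y => a y ∧ b y) z =
  @wedge R 4 l n (exd a z) (b z) \+ -1 \*o @wedge R 3 l.+1 n (a z) (exd b z).
Proof.
move=> ha hb; apply/funext => v.
by rewrite exd_wedge// castmx_id -signr_odd expr1.
Qed.

Lemma derive_horner_coord (c : {poly R}) (j : 'I_n) (z u : 'rV[R]_n) :
  is_derive z u (fun y : 'rV[R]_n => c.[y 0 j]) (c^`().[z 0 j] * u 0 j).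
Proof.
have dc : derivable (horner c) (z 0 j) 1 by exact: derivable_horner.
have df : differentiable (fun y : 'rV[R]_n => y 0 j) z by exact: differentiable_coord.
have dh : differentiable (horner c) (z 0 j) by apply/derivable1_diffP.
have dch : differentiable (fun y : 'rV[R]_n => c.[y 0 j]) z.
  exact: (differentiable_comp df dh).
apply: DeriveDef; first exact: diff_derivable.
rewrite deriveE// (diff_comp df dh) /= -(deriveE u df) derive_coord (deriv1E dc) /=.
by rewrite -derive.derivE [RHS]mulrC.
Qed.

Lemma smooth_horner_coord (U : set 'rV[R]_n) (c : {poly R}) (j : 'I_n) : open U ->
  smooth U (fun y : 'rV[R]_n => c.[y 0 j]).
Proof.
move=> oU; rewrite (_ : (fun y => _) =
    fun y : 'rV[R]_n => \sum_(i < size c) c`_i * (y 0 j) ^+ i); last first.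
  by apply/funext => y; rewrite horner_coef.
apply: smooth_sum => // i; apply: smoothM => //; first exact: smooth_cst.
by apply: smoothX => //; exact: smooth_coord.
Qed.

(** All coefficients that occur are polynomials in t, so that their derivatives are
    formal ones. *)
Lemma exd_scale_coord k (c : {poly R}) j (a : 'rV[R]_n -> mform R k n) z :
  form_near a z ->
  exd (fun y => c.[y 0 j] \*o a y) z =
  c^`().[z 0 j] \*o ((fun v : 'M[R]_(1, n) => v 0 j) ∧ a z) \+
  c.[z 0 j] \*o exd a z.
Proof.
move=> ha; rewrite exd_scale//; last first.
  by move=> u; have [] := derive_horner_coord c j z u.
have -> : (fun v : 'M[R]_(1, n) => 'D_(row 0 v) (fun y : 'rV[R]_n => c.[y 0 j]) z) =
    c^`().[z 0 j] \*o (fun v : 'M[R]_(1, n) => v 0 j).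
  apply/funext => v; have [_ ->] := derive_horner_coord c j z (row 0 v).
  by rewrite /= mxE.
by rewrite (wedgeZl c^`().[z 0 j]).
Qed.

Lemma form_near_scale_coord k (c : {poly R}) j (a : 'rV[R]_n -> mform R k n) z :
  form_near a z -> form_near (fun y => c.[y 0 j] \*o a y) z.
Proof.
by move=> ha; apply: form_near_scale => // u; have [] := derive_horner_coord c j z u.
Qed.

End Leibniz.

(** * A coframe adapted to the ansatz *)

Section AdaptedCoframe.
Context (R : realType).

(** A 1-form is determined by its values on the basis vectors. *)
Lemma coframe_of n (L : 'I_n -> mform R 1 n) :
  (forall j, alternating_form (L j)) -> exists e, forall j, covec e j = L j.
Proof.
move=> aL; exists (\matrix_(c, j) L j (delta_mx 0 c)) => j.
apply/funext => v; rewrite /covec mxE [in RHS](row_sum_delta v).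
transitivity (\sum_c v 0 c * L j (delta_mx 0 c)).
  by apply: eq_bigr => c _; rewrite mxE.
elim: (index_enum _) => [|c r IHr]; last first.
  rewrite !big_cons IHr -[\sum_(_ <- r) v 0 _ *: _]scale1r.
  by rewrite alternating1_linear// mul1r ?scale1r.
rewrite !big_nil; have := alternating1_linear 0 0 0 0 (aL j).
by rewrite !scale0r addr0 !mul0r addr0.
Qed.

Lemma coframe_unit n (e : 'M[R]_n) :
  (forall v, (forall j, covec e j v = 0) -> v = 0) -> e \in unitmx.
Proof.
move=> ker0; rewrite -row_free_unit -kermx_eq0; apply/eqP/row_matrixP => i.
rewrite row0; apply: ker0 => j; rewrite /covec.
have /sub_kermxP -> : (row i (kermx e) <= kermx e)%MS by exact: row_sub.
by rewrite mxE.
Qed.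

(** With the coframe al f0, al f1, be f2, be f3, thx / D, - t D dt, thy / t the seven
    monomials of the model form match the ansatz if al^2 = t (h + P),
    be^2 = t (h - P) and al be = t D, and the last equation follows from the other two.
    The minus sign accounts for the order of dt and thx in the ansatz. *)
Lemma ansatz_coframe (f0 f1 f2 f3 dt thx thy : mform R 1 7) (t h P : R) :
  0 < t -> `|P| < h ->
  [/\ alternating_form f0, alternating_form f1, alternating_form f2 &
      alternating_form f3] ->
  [/\ alternating_form dt, alternating_form thx & alternating_form thy] ->
  (forall v, [/\ f0 v = 0, f1 v = 0, f2 v = 0 & f3 v = 0] ->
             [/\ dt v = 0, thx v = 0 & thy v = 0] -> v = 0) ->
  let D2 := h ^+ 2 - P ^+ 2 in
  let w1 : mform R 2 7 := (h + P) \*o (f0 ∧ f1) \+ (h - P) \*o (f2 ∧ f3) in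
  let w2 : mform R 2 7 := f0 ∧ f2 \+ -1 \*o (f1 ∧ f3) in
  let w3 : mform R 2 7 := f0 ∧ f3 \+ f1 ∧ f2 in
  exists e,
    g2_coframe (w1 ∧ thy \+ dt ∧ thx ∧ thy \+
                t \*o (w2 ∧ thx \+ (t * D2) \*o (w3 ∧ dt))) e /\
    g2_coform e =
      (t ^+ 2 * D2) \*o (f0 ∧ f1 ∧ f2 ∧ f3) \+ t ^+ 2 \*o (w1 ∧ dt ∧ thx) \+
      (- (t * D2)) \*o (w2 ∧ dt ∧ thy) \+ w3 ∧ thx ∧ thy.
Proof.
move=> t0 Ph [a0 a1 a2 a3] [adt athx athy] ker0 D2 w1 w2 w3.
have [hP1 hP2] : 0 < h + P /\ 0 < h - P by move: Ph; rewrite ltr_norml => /andP[]; lra.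
pose al := Num.sqrt (t * (h + P)); pose be := Num.sqrt (t * (h - P)).
pose D := Num.sqrt D2.
have D2E : D2 = (h + P) * (h - P) by rewrite /D2; ring.
have D20 : 0 < D2 by rewrite D2E mulr_gt0.
have D0 : 0 < D by rewrite sqrtr_gt0.
have al2 : al * al = t * (h + P) by rewrite -expr2 sqr_sqrtr// ltW// mulr_gt0.
have be2 : be * be = t * (h - P) by rewrite -expr2 sqr_sqrtr// ltW// mulr_gt0.
have DD : D * D = D2 by rewrite -expr2 sqr_sqrtr// ltW.
have albe : al * be = t * D.
  rewrite /al /be -sqrtrM ?ltW ?mulr_gt0// (_ : t * (h + P) * (t * (h - P)) = t ^+ 2 * D2); last first.
    by rewrite D2E; ring.
  by rewrite sqrtrM ?sqr_ge0// sqrtr_sqr gtr0_norm.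
have alp : al != 0 by rewrite gt_eqF// sqrtr_gt0 mulr_gt0.
have bep : be != 0 by rewrite gt_eqF// sqrtr_gt0 mulr_gt0.
have [e eL] : exists e, forall j : 'I_7, covec e j = nth dt [:: al \*o f0; al \*o f1;
    be \*o f2; be \*o f3; D^-1 \*o thx; (- (t * D)) \*o dt; t^-1 \*o thy] j.
  apply: coframe_of => j.
  by case: j => -[|[|[|[|[|[|[|//]]]]]]] hj /=; exact: alternatingZ.
have eU : e \in unitmx.
  apply: coframe_unit => v v0.
  have z k (hk : (k < 7)%N) := v0 (Ordinal hk); move: z => z.
  have := z 0%N isT; have := z 1%N isT; have := z 2%N isT; have := z 3%N isT.
  have := z 4%N isT; have := z 5%N isT; have := z 6%N isT; rewrite !eL /=.
  move=> /eqP; rewrite mulf_eq0 invr_eq0 (gt_eqF t0) => /eqP z6.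
  move=> /eqP; rewrite mulf_eq0 oppr_eq0 mulf_eq0 (gt_eqF t0) (gt_eqF D0) => /eqP z5.
  move=> /eqP; rewrite mulf_eq0 invr_eq0 (gt_eqF D0) => /eqP z4.
  move=> /eqP; rewrite mulf_eq0 (negPf bep) => /eqP z3.
  move=> /eqP; rewrite mulf_eq0 (negPf bep) => /eqP z2.
  move=> /eqP; rewrite mulf_eq0 (negPf alp) => /eqP z1.
  move=> /eqP; rewrite mulf_eq0 (negPf alp) => /eqP z0.
  exact: ker0.
have tn : t != 0 by rewrite gt_eqF.
have Dn : D != 0 by rewrite gt_eqF.
have c1 : al * al * t^-1 = h + P by rewrite al2; field.
have c2 : be * be * t^-1 = h - P by rewrite be2; field.
have c3 : al * be * D^-1 = t by rewrite albe; field.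
have c4 : al * be * (t * D) = t * (t * D2) by rewrite albe -DD; ring.
have c5 : D^-1 * (t * D) * t^-1 = 1 by field; rewrite tn.
have c6 : al * al * (be * be) = t ^+ 2 * D2 by rewrite al2 be2 D2E; ring.
have c7 : al * al * (D^-1 * (t * D)) = t ^+ 2 * (h + P) by rewrite al2; field.
have c8 : be * be * (D^-1 * (t * D)) = t ^+ 2 * (h - P) by rewrite be2; field.
have c9 : al * be * (t * D * t^-1) = t * D2 by rewrite albe -DD; field.
have c10 : al * be * (D^-1 * t^-1) = 1 by rewrite albe; field; rewrite tn.
exists e; split; [split => //|]; apply/funext => v.
  rewrite /g2_form !eL /w1 /w2 /w3 !wedge_ext /=.
  rewrite !ext_linear !ext_wordE /=.
  rewrite (word3C12 thx dt).
  move: (word3 f0 f1 thy v) (word3 f2 f3 thy v) (word3 dt thx thy v)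
    (word3 f0 f2 thx v) (word3 f1 f3 thx v) (word3 f0 f3 dt v) (word3 f1 f2 dt v).
  clearbody al be D D2 => x1 x2 x3 x4 x5 x6 x7.
  transitivity (al * al * t^-1 * x1 + be * be * t^-1 * x2 +
      D^-1 * (t * D) * t^-1 * x3 + al * be * D^-1 * (x4 - x5) +
      al * be * (t * D) * (x6 + x7)); last by ring.
  by rewrite c1 c2 c3 c4 c5; ring.
rewrite /g2_coform !eL /w1 /w2 /w3 !wedge_ext /=.
rewrite !ext_linear !ext_wordE /=.
rewrite (word4C34 f0 f1 thx) (word4C34 f2 f3 thx).
move: (word4 f0 f1 f2 f3 v) (word4 f0 f1 dt thx v) (word4 f2 f3 dt thx v)
  (word4 f0 f2 dt thy v) (word4 f1 f3 dt thy v) (word4 f0 f3 thx thy v)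
  (word4 f1 f2 thx thy v).
clearbody al be D D2 => x1 x2 x3 x4 x5 x6 x7.
transitivity (al * al * (be * be) * x1 + al * al * (D^-1 * (t * D)) * x2 +
    be * be * (D^-1 * (t * D)) * x3 - al * be * (t * D * t^-1) * (x4 - x5) +
    al * be * (D^-1 * t^-1) * (x6 + x7)); first by ring.
by rewrite c6 c7 c8 c9 c10; ring.
Qed.

End AdaptedCoframe.

(** * Closedness and coclosedness *)

(** The setting is that of a single chart. The components of the forms at z in the
    coframe are known, but they are not constant near z: exterior derivatives are first
    expressed through the forms themselves, and only then expanded in words. *)
Section Closed.
Context (R : realType) (n : nat) (j0 : 'I_n) (z : 'rV[R]_n).
Context (p q r s : R) (W0 W1 W2 W3 : 'rV[R]_n -> mform R 2 n)
  (thx thy : 'rV[R]_n -> mform R 1 n) (f0 f1 f2 f3 : mform R 1 n).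

Let dt : mform R 1 n := fun v => v 0 j0.
Let cP : {poly R} := p%:P + q *: 'X.
Let cH : {poly R} := r%:P + s *: 'X.
Let cD : {poly R} := cH ^+ 2 - cP ^+ 2.
Let t := z 0 j0.

Hypotheses (n0 : form_near W0 z) (n1 : form_near W1 z) (n2 : form_near W2 z)
  (n3 : form_near W3 z) (nx : form_near thx z) (ny : form_near thy z).
Hypotheses (d0 : exd W0 z = fun=> 0) (d1 : exd W1 z = fun=> 0)
  (d2 : exd W2 z = fun=> 0) (d3 : exd W3 z = fun=> 0).
Hypotheses (dx : exd thx z = q \*o W0 z \+ s \*o W1 z) (dy : exd thy z = -1 \*o W2 z).
Hypotheses (E0 : forall c, (c = p) \/ (c = q) ->
                   c \*o W0 z = c \*o (f0 ∧ f1 \+ -1 \*o (f2 ∧ f3)))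
  (E1 : W1 z = f0 ∧ f1 \+ f2 ∧ f3) (E2 : W2 z = f0 ∧ f2 \+ -1 \*o (f1 ∧ f3))
  (E3 : W3 z = f0 ∧ f3 \+ f1 ∧ f2).

(** The form tilde omega_1, the coefficients being polynomials in t. *)
Definition ansatz_w1 (c c' : {poly R}) (w w' : 'rV[R]_n -> mform R 2 n) (y : 'rV[R]_n)
    : mform R 2 n :=
  c.[y 0 j0] \*o w y \+ c'.[y 0 j0] \*o w' y.

Let tw := ansatz_w1 cP cH W0 W1.

Lemma form_near_cst k (a : mform R k n) : skew_form a -> form_near (fun=> a) z.
Proof. by move=> aa; split => [|v u]; [exact: filterE|exact: derivable_cst]. Qed.

Lemma form_near_dt : form_near (fun=> dt) z.
Proof. by apply: form_near_cst; exact: skew_form1. Qed.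

Lemma form_near_w1 : form_near tw z.
Proof. by apply: form_nearD; exact: form_near_scale_coord. Qed.

Lemma horner_cP x : cP.[x] = p + q * x.
Proof. by rewrite /cP !hornerE. Qed.

Lemma horner_cH x : cH.[x] = r + s * x.
Proof. by rewrite /cH !hornerE. Qed.

Lemma horner_cD x : cD.[x] = (r + s * x) ^+ 2 - (p + q * x) ^+ 2.
Proof. by rewrite /cD hornerD hornerN !horner_exp horner_cP horner_cH. Qed.

Lemma horner_deriv_cD x : cD^`().[x] = 2 * (s * (r + s * x) - q * (p + q * x)).
Proof.
have -> : cD^`() = 2%:P * (s%:P * cH - q%:P * cP).
  by rewrite /cD /cH /cP !poly.derivE -!mul_polyC; ring.
by rewrite hornerM hornerC hornerD hornerN 2!hornerM !hornerC horner_cP horner_cH.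
Qed.

Lemma ansatz_w1E : tw z =
  (r + s * t + (p + q * t)) \*o word2 f0 f1 \+ (r + s * t - (p + q * t)) \*o word2 f2 f3.
Proof.
rewrite /tw /ansatz_w1 E1 horner_cP horner_cH; apply/funext => v /=.
have := congr1 (@^~ v) (E0 (or_introl erefl)).
have := congr1 (@^~ v) (E0 (or_intror erefl)).
rewrite /= !wedge_ext !ext_wordE -/t.
move: (W0 z v) (word2 f0 f1 v) (word2 f2 f3 v) => x y y' qE pE.
transitivity (p * x + t * (q * x) + (r + s * t) * (y + y')); first by ring.
by rewrite pE qE; ring.
Qed.

Lemma curvature_xE : exd thx z =
  (s + q) \*o word2 f0 f1 \+ (s - q) \*o word2 f2 f3.
Proof.
rewrite dx E0; last by right.
by rewrite E1 !wedge_ext !ext_wordE; apply/funext => v /=; ring.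
Qed.

(** This is dt wedge tilde omega_1', and the derivative is the curvature of thx by
    assumption. *)
Lemma exd_w1 : exd tw z = ext_prod dt (exd thx z).
Proof.
rewrite /tw /ansatz_w1 exdD; try exact: form_near_scale_coord.
rewrite !exd_scale_coord// d0 d1 dx.
have -> : cP^`().[z 0 j0] = q by rewrite /cP !poly.derivE !hornerE.
have -> : cH^`().[z 0 j0] = s by rewrite /cH !poly.derivE !hornerE.
rewrite !wedge_ext !ext_linear -/dt.
by apply/funext => v /=; rewrite !mulr0 !addr0.
Qed.

(** The terms dt thx w2 and dt tilde omega_1' thy appear twice with opposite signs;
    the products of w2 with tilde omega_1 and tilde omega_1' vanish. *)
Lemma ansatz_closed :
  exd (fun y => tw y ∧ thy y \+ dt ∧ thx y ∧ thy y \+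
    y 0 j0 \*o (W2 y ∧ thx y \+ ('X * cD).[y 0 j0] \*o (W3 y ∧ dt))) z = fun=> 0.
Proof.
have ndt := form_near_dt; have n1' := form_near_w1.
have nW3 := form_near_wedge n3 ndt; have nW2 := form_near_wedge n2 nx.
have nU := form_near_scale_coord ('X * cD) j0 nW3.
have nS := form_nearD nW2 nU.
have ntxy := form_near_wedge (form_near_wedge ndt nx) ny.
have nwy := form_near_wedge n1' ny.
have -> : (fun y => tw y ∧ thy y \+ dt ∧ thx y ∧ thy y \+
    y 0 j0 \*o (W2 y ∧ thx y \+ ('X * cD).[y 0 j0] \*o (W3 y ∧ dt))) =
  (fun y => tw y ∧ thy y \+ dt ∧ thx y ∧ thy y \+
    'X.[y 0 j0] \*o (W2 y ∧ thx y \+ ('X * cD).[y 0 j0] \*o (W3 y ∧ dt))).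
  by apply/funext => y; rewrite hornerX.
rewrite (exdD (form_nearD nwy ntxy) (form_near_scale_coord 'X j0 nS)).
rewrite (exdD nwy ntxy) (exd_scale_coord 'X j0 nS) (exdD nW2 nU).
rewrite (exd_scale_coord ('X * cD) j0 nW3).
rewrite (exd_wedge2 n1' ny) (exd_wedge2 (form_near_wedge ndt nx) ny).
rewrite (exd_wedge1 ndt nx) (exd_wedge2 n2 nx) (exd_wedge2 n3 ndt).
rewrite exd_cst d2 d3 dy exd_w1 curvature_xE ansatz_w1E E2 E3 !wedge_ext -/dt.
rewrite !(ext0l, ext0r, ext_linear, ext_wordE).
apply/funext => v /=; rewrite hornerX poly.derivE hornerC !word4_dup.
rewrite (word4C34 dt f0 f2) (word4C23 dt f0 (thx z)).
rewrite (word4C34 dt f1 f3) (word4C23 dt f1 (thx z)).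
move: (word4 dt f0 f1 _ v) (word4 dt f2 f3 _ v) (word4 dt _ f0 f2 v)
  (word4 dt _ f1 f3 v) => x1 x2 x3 x4; ring.
Qed.

(** Everything is a multiple of dt f0 f1 f2 f3, since the product of w3
    with either curvature vanishes. The first summand contributes (t^2 D^2)', the second one
    - t^2 (D^2)' and the third one - 2 t D^2. *)
Lemma ansatz_coclosed :
  exd (fun y => (2^-1%:P * 'X^2 * cD).[y 0 j0] \*o (W1 y ∧ W1 y) \+
    'X^2.[y 0 j0] \*o (tw y ∧ dt ∧ thx y) \+
    (- ('X * cD)).[y 0 j0] \*o (W2 y ∧ dt ∧ thy y) \+ W3 y ∧ thx y ∧ thy y) z =
  fun=> 0.
Proof.
have ndt := form_near_dt; have n1' := form_near_w1.
have n11 := form_near_wedge n1 n1.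
have nwdt := form_near_wedge n1' ndt; have nwdtx := form_near_wedge nwdt nx.
have n2dt := form_near_wedge n2 ndt; have n2dty := form_near_wedge n2dt ny.
have n3x := form_near_wedge n3 nx; have n3xy := form_near_wedge n3x ny.
have s1 := form_near_scale_coord (2^-1%:P * 'X^2 * cD) j0 n11.
have s2 := form_near_scale_coord 'X^2 j0 nwdtx.
have s3 := form_near_scale_coord (- ('X * cD)) j0 n2dty.
rewrite (exdD (form_nearD (form_nearD s1 s2) s3) n3xy).
rewrite (exdD (form_nearD s1 s2) s3).
rewrite (exdD s1 s2).
rewrite (exd_scale_coord (2^-1%:P * 'X^2 * cD) j0 n11).
rewrite (exd_scale_coord 'X^2 j0 nwdtx) (exd_scale_coord (- ('X * cD)) j0 n2dty).
rewrite (exd_wedge2 n1 n1) (exd_wedge3 nwdt nx) (exd_wedge2 n1' ndt).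
rewrite (exd_wedge3 n2dt ny) (exd_wedge2 n2 ndt) (exd_wedge3 n3x ny).
rewrite (exd_wedge2 n3 nx).
rewrite exd_cst d1 d2 d3 dy exd_w1 curvature_xE ansatz_w1E E1 E2 E3 !wedge_ext -/dt.
rewrite !(ext0l, ext0r, ext_linear, ext_wordE).
apply/funext => v /=; rewrite !word5_dup.
have cyc x y c c' : word5 x y dt c c' v = word5 dt x y c c' v.
  by rewrite (word5C23 x y dt) (word5C12 x dt) opprK.
have block x y c c' : word5 dt x y c c' v = word5 dt c c' x y v.
  rewrite (word5C34 dt x y c) (word5C23 dt x c) opprK.
  by rewrite (word5C45 dt c x y c') (word5C34 dt c x c') opprK.
rewrite !cyc (block f2) (word5C34 dt f0 f2) (block f1) (word5C34 dt f0 f2).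
have -> : (2^-1%:P * 'X^2 * cD)^`().[z 0 j0] =
    t * cD.[t] + 2^-1 * t ^+ 2 * cD^`().[t].
  rewrite derivM derivM derivC derivXn mul0r add0r hornerD 2!hornerM.
  rewrite hornerM hornerMn !hornerC expr1 hornerX hornerM hornerC horner_exp hornerX.
  rewrite -/t; congr (_ + _); rewrite -mulr_natl; by field.
rewrite hornerN (hornerM _ cD) (hornerM 'X cD) horner_exp !hornerX horner_deriv_cD horner_cD -/t.
move: (word5 _ _ _ _ _ v) => w; by field.
Qed.

End Closed.

(** * The torsion-free structure *)

Lemma skew_form_pullback (R : realType) (m n k : nat) (A : 'M[R]_(m, n))
    (w : mform R k n) :
  skew_form w -> skew_form (fun v : 'M[R]_(k, m) => w (v *m A)).
Proof. by move=> aw s v; rewrite /= row_permE -mulmxA -row_permE aw. Qed.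

(** In the adapted frame w0 is described only through its multiples by p and q, so that
    for p = q = 0 it can be any closed form. *)
Section Assembly.
Context (R : realType) (M : manifold R 4) (g0 J1 J2 J3 : mx_field M).
Hypothesis HK : hyperkahler g0 J1 J2 J3.
Local Notation w1 := (fund_form g0 J1).
Local Notation w2 := (fund_form g0 J2).
Local Notation w3 := (fund_form g0 J3).
Context (w0 : form_field M 2) (p q r s a : R) (b : \bar R) (M' : set M)
  (etaN : form_field (prod_manifold 2 M) 1) (xiP : form_field (prod_manifold 1 M) 1).
Hypothesis form_w0 : is_form setT w0.
Hypothesis skew_w0 : forall i z, chart_set setT i z -> skew_form (w0 i z).
Hypothesis closed_w0 : form_closed setT w0.
Hypothesis a0 : 0 < a.
Hypothesis pos : forall t : R, a < t -> (t%:E < b)%E -> `|p + q * t| < r + s * t.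
Hypothesis suit : suitable a b M' w2 (fun i z => q \*o w0 i z \+ s \*o w1 i z) etaN xiP.
Local Notation k0 := (@Ordinal 4 0 isT).
Local Notation k1 := (@Ordinal 4 1 isT).
Local Notation k2 := (@Ordinal 4 2 isT).
Local Notation k3 := (@Ordinal 4 3 isT).
Hypothesis frame : forall i z, chart_set setT i z ->
  exists2 E, adapted_frame (g0 i z) (J1 i z) (J2 i z) (J3 i z) E &
    forall c, c = p \/ c = q -> c \*o w0 i z =
      c \*o (covec (invmx E) k0 ∧ covec (invmx E) k1 \+
             -1 \*o (covec (invmx E) k2 ∧ covec (invmx E) k3)).

Let W : set (prod_manifold 3 M) := slab 2 a b M'.
Let j0 : 'I_(3 + 4) := lshift 4 0.
Let cP : {poly R} := p%:P + q *: 'X.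
Let cH : {poly R} := r%:P + s *: 'X.
Let cD : {poly R} := cH ^+ 2 - cP ^+ 2.
Let W_ (w : form_field M 2) : form_field (prod_manifold 3 M) 2 := pull_base 3 w.
Let dt : form_field (prod_manifold 3 M) 1 := fun i z v => v 0 j0.
Let thx : form_field (prod_manifold 3 M) 1 :=
  fun i z => dcoord 4 (@Ordinal 3 1 isT) \+ pull_prod 3 xiP i z.
Let thy : form_field (prod_manifold 3 M) 1 :=
  fun i z => dcoord 4 (@Ordinal 3 2 isT) \+ pull_prod 3 etaN i z.
Let tw : form_field (prod_manifold 3 M) 2 :=
  fun i => ansatz_w1 j0 cP cH (W_ w0 i) (W_ w1 i).
Let phi : form_field (prod_manifold 3 M) 3 := fun i y =>
  tw i y ∧ thy i y \+ dt i y ∧ thx i y ∧ thy i y \+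
  y 0 j0 \*o (W_ w2 i y ∧ thx i y \+ ('X * cD).[y 0 j0] \*o (W_ w3 i y ∧ dt i y)).
(** The Hodge dual of phi, written without reference to a frame. *)
Let psi : form_field (prod_manifold 3 M) 4 := fun i y =>
  (2^-1%:P * 'X^2 * cD).[y 0 j0] \*o (W_ w1 i y ∧ W_ w1 i y) \+
  'X^2.[y 0 j0] \*o (tw i y ∧ dt i y ∧ thx i y) \+
  (- ('X * cD)).[y 0 j0] \*o (W_ w2 i y ∧ dt i y ∧ thy i y) \+
  W_ w3 i y ∧ thx i y ∧ thy i y.

Lemma hk_riemannian : is_riemannian g0. Proof. by case: HK. Qed.
Lemma hk_acs1 : orthogonal_acs g0 J1. Proof. by case: HK => _ []. Qed.
Lemma hk_acs2 : orthogonal_acs g0 J2. Proof. by case: HK => _ []. Qed.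
Lemma hk_acs3 : orthogonal_acs g0 J3. Proof. by case: HK => _ []. Qed.

Lemma chart_slab_open i : open (chart_set W i).
Proof. by apply: chart_set_open; apply: slab_open; case: suit. Qed.

Lemma is_form_pull (w : form_field M 2) : is_form setT w -> is_form W (W_ w).
Proof. by move=> fw; apply: is_form_pull_base; exact: is_form_sub fw. Qed.

Lemma is_form_horner k (c : {poly R}) (w : form_field (prod_manifold 3 M) k) :
  is_form W w -> is_form W (fun i y => c.[y 0 j0] \*o w i y).
Proof.
apply: is_form_scale; first exact: chart_slab_open.
  by move=> i; apply: smooth_horner_coord; exact: chart_slab_open.
move=> i j z _; congr c.[_]; symmetry.
exact: (slab_time_transition (m := 2) i j z).
Qed.

Lemma is_form_thx : is_form W thx.
Proof.
apply: is_formD; [exact: chart_slab_open|exact: is_form_dcoord|].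
by apply: is_form_pull_prod; case: suit.
Qed.

Lemma is_form_thy : is_form W thy.
Proof.
apply: is_formD; [exact: chart_slab_open|exact: is_form_dcoord|].
by apply: is_form_pull_prod; case: suit.
Qed.

Lemma is_form_dt : is_form W dt.
Proof. exact: (@is_form_dcoord R 4 M a b M' 2 0). Qed.

Lemma is_form_fund k : is_form setT (fund_form g0 (nth J1 [:: J1; J2; J3] k)).
Proof.
apply: fund_form_is_form; first exact: hk_riemannian.
by case: k => [|[|[|k]]] /=; rewrite ?nth_nil; [exact: hk_acs1|exact: hk_acs2|exact: hk_acs3|exact: hk_acs1].
Qed.

Lemma is_form_W : [/\ is_form W (W_ w0), is_form W (W_ w1), is_form W (W_ w2) &
  is_form W (W_ w3)].
Proof.
by split; apply: is_form_pull => //; [exact: (is_form_fund 0)|exact: (is_form_fund 1)|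
  exact: (is_form_fund 2)].
Qed.

Lemma is_form_tw : is_form W tw.
Proof.
have [f0 f1 _ _] := is_form_W.
by apply: is_formD; [exact: chart_slab_open|exact: is_form_horner|exact: is_form_horner].
Qed.

Lemma is_form_phi : is_form W phi.
Proof.
have [_ _ f2 f3] := is_form_W; have ft := is_form_tw; have fd := is_form_dt.
have fx := is_form_thx; have fy := is_form_thy; have o := chart_slab_open.
have S := is_formD o (is_form_wedge o f2 fx)
  (is_form_horner ('X * cD) (is_form_wedge o f3 fd)).
have := is_formD o (is_formD o (is_form_wedge o ft fy)
  (is_form_wedge o (is_form_wedge o fd fx) fy)) (is_form_horner 'X S).
congr (is_form _ _); apply/funext => i; apply/funext => y.
by rewrite hornerX.
Qed.

Lemma is_form_psi : is_form W psi.
Proof.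
have [_ f1 f2 f3] := is_form_W; have ft := is_form_tw; have fd := is_form_dt.
have fx := is_form_thx; have fy := is_form_thy; have o := chart_slab_open.
exact: (is_formD o (is_formD o (is_formD o
  (is_form_horner (2^-1%:P * 'X^2 * cD) (is_form_wedge o f1 f1))
  (is_form_horner 'X^2 (is_form_wedge o (is_form_wedge o ft fd) fx)))
  (is_form_horner (- ('X * cD)) (is_form_wedge o (is_form_wedge o f2 fd) fy)))
  (is_form_wedge o (is_form_wedge o f3 fx) fy)).
Qed.

Section AtPoint.
Context (i : charts M) (z : 'rV[R]_(3 + 4)).
Hypothesis Wz : chart_set W i z.

Let m := rsubmx z.

Lemma chart_base : chart_set M' i m.
Proof. by have [_ _ ] := (chart_slabT a b M' i z).1 Wz. Qed.

Lemma chart_baseT : chart_set setT i m.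
Proof. by apply: chart_setS chart_base. Qed.

Let t := z 0 j0.

Lemma time_range : a < t /\ (t%:E < b)%E.
Proof. by have [? ?] := (chart_slabT a b M' i z).1 Wz. Qed.

Lemma form_near_pull (w : form_field M 2) :
  (forall y, chart_set setT i y -> skew_form (w i y)) ->
  is_form setT w -> form_near (W_ w i) z.
Proof.
move=> aw fw; apply: (form_near_chart chart_slab_open _ (is_form_pull fw) Wz) => y Wy.
have [_ _ /(chart_setS (@subsetT _ _)) iy] := (chart_slabT a b M' i y).1 Wy.
rewrite /W_ /pull_base (_ : (fun v => _) = fun v => w i (rsubmx y) (v *m col_mx 0 1%:M)).
  by apply: skew_form_pullback; exact: aw.
by apply/funext => v; rewrite -rsubmxE.
Qed.

Lemma form_near_fund J : orthogonal_acs g0 J -> is_form setT (fund_form g0 J) ->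
  form_near (W_ (fund_form g0 J) i) z.
Proof.
move=> oJ fJ; apply: form_near_pull => // y iy.
by apply: fund_mx_skew; [exact: metric_at hk_riemannian _ _ iy|exact: complex_at oJ _ _ iy].
Qed.

Lemma form_near_1form (w : form_field (prod_manifold 3 M) 1) : is_form W w -> form_near (w i) z.
Proof.
by move=> fw; apply: (form_near_chart chart_slab_open _ fw Wz) => y _; exact: skew_form1.
Qed.

Lemma exd_pull (w : form_field M 2) : form_closed setT w -> exd (W_ w i) z = fun=> 0.
Proof.
move=> cw; have := ext_d_pull_base w i z; rewrite /ext_d => ->.
by apply/funext => v; have := cw i m chart_baseT; rewrite /ext_d => ->.
Qed.

Lemma exd_thx : exd (thx i) z = q \*o W_ w0 i z \+ s \*o W_ w1 i z.
Proof.
have [_ _ _ fx ex] := suit.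
have n1 : form_near (fun=> dcoord 4 (@Ordinal 3 1 isT) : mform R 1 (3 + 4)) z.
  exact: (form_near_1form (is_form_dcoord a b M' _)).
have n2 := form_near_1form (is_form_pull_prod 2 fx).
rewrite /thx (exdD n1 n2) exd_cst.
have := ext_d_pull_prod xiP i z; rewrite /ext_d => ->.
have zx : chart_set (slab 0 a b M') i (z *m pull_mx R 4 3 1).
  apply/chart_slabT; rewrite slab_time_pull mul_pull_mx row_mxKr.
  by have [? ?] := time_range; split => //; exact: chart_base.
apply/funext => v /=; rewrite add0r.
have := congr1 (@^~ (v *m pull_mx R 4 3 1)) (ex i _ zx); rewrite /ext_d => ->.
by rewrite /pull_base !mul_pull_mx !row_mxKr.
Qed.

Lemma exd_thy : exd (thy i) z = -1 \*o W_ w2 i z.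
Proof.
have [_ fy ey _ _] := suit.
have n1 : form_near (fun=> dcoord 4 (@Ordinal 3 2 isT) : mform R 1 (3 + 4)) z.
  exact: (form_near_1form (is_form_dcoord a b M' _)).
have n2 := form_near_1form (is_form_pull_prod 2 fy).
rewrite /thy (exdD n1 n2) exd_cst.
have := ext_d_pull_prod etaN i z; rewrite /ext_d => ->.
have zx : chart_set (slab 1 a b M') i (z *m pull_mx R 4 3 2).
  apply/chart_slabT; rewrite slab_time_pull mul_pull_mx row_mxKr.
  by have [? ?] := time_range; split => //; exact: chart_base.
apply/funext => v /=; rewrite add0r mulN1r.
have := congr1 (@^~ (v *m pull_mx R 4 3 2)) (ey i _ zx); rewrite /ext_d => ->.
by rewrite /pull_base !mul_pull_mx !row_mxKr.
Qed.

Lemma frame_at : exists f0 f1 f2 f3 : mform R 1 (3 + 4),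
  [/\ W_ w1 i z = f0 ∧ f1 \+ f2 ∧ f3, W_ w2 i z = f0 ∧ f2 \+ -1 \*o (f1 ∧ f3),
     W_ w3 i z = f0 ∧ f3 \+ f1 ∧ f2 &
     forall c, c = p \/ c = q ->
       c \*o W_ w0 i z = c \*o (f0 ∧ f1 \+ -1 \*o (f2 ∧ f3))] /\
  [/\ alternating_form f0, alternating_form f1, alternating_form f2 & alternating_form f3] /\
  forall v, [/\ f0 v = 0, f1 v = 0, f2 v = 0 & f3 v = 0] -> rsubmx v = 0.
Proof.
have [E [EgE [E1 E2 E3]] E0] := frame chart_baseT; have EU := frame_unit EgE.
pose A : 'M[R]_(3 + 4, 4) := col_mx 0 1%:M; pose F := invmx E.
pose f k : mform R 1 (3 + 4) := fun v => covec F k (v *m A).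
have fE k l v : (covec F k ∧ covec F l) (rsubmx v) = (f k ∧ f l) v.
  by rewrite rsubmxE; exact: (congr1 (@^~ v) (wedge_pullback A (covec F k) (covec F l))).
exists (f k0), (f k1), (f k2), (f k3); split; [split|split].
- apply/funext => v; rewrite /W_ /pull_base fund_formE (fund_mx_skew_mx EU E1) /=.
  by rewrite !fE; ring.
- apply/funext => v; rewrite /W_ /pull_base fund_formE (fund_mx_skew_mx EU E2) /=.
  by rewrite !fE; ring.
- apply/funext => v; rewrite /W_ /pull_base fund_formE (fund_mx_skew_mx EU E3) /=.
  by rewrite !fE; ring.
- move=> c cpq; apply/funext => v; rewrite /W_ /pull_base /=.
  by have := congr1 (@^~ (rsubmx v)) (E0 c cpq); rewrite /= !fE.
- have af k : alternating_form (f k).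
    apply: alternating_pullback; apply: alternating1 => x y u v.
    by rewrite /covec mulmxDl -!scalemxAl !mxE.
  by split.
- move=> v [v0 v1 v2 v3].
  have : rsubmx v *m F = 0.
    apply/rowP => k; rewrite [RHS]mxE rsubmxE.
    by case: k => -[|[|[|[|//]]]] hk;
      [rewrite -[RHS]v0|rewrite -[RHS]v1|rewrite -[RHS]v2|rewrite -[RHS]v3];
      rewrite /f /covec; congr (_ _ _); apply: val_inj.
  have FU : F \in unitmx by rewrite unitmx_inv.
  by move=> vF; rewrite -[LHS](mulmxK FU) vF mul0mx.
Qed.

Lemma is_form_alternating_at (w : form_field (prod_manifold 3 M) 1) :
  is_form W w -> alternating_form (w i z).
Proof. by case=> aw _ _; exact: aw. Qed.

(** The system is triangular: xi_P involves only dt and the base, so dx is determined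
    by thx and then dy by thy. *)
Lemma coframe_kernel v : rsubmx v = 0 ->
  [/\ dt i z v = 0, thx i z v = 0 & thy i z v = 0] -> v = 0.
Proof.
move=> v0 [vt vx vy].
have [_ fy _ fx _] := suit.
have at0 k (w : mform R 1 k) : alternating_form w -> w 0 = 0.
  move=> aw; have := alternating1_linear 0 0 0 0 aw.
  by rewrite !scale0r addr0 !mul0r addr0.
have slabz l : chart_set (slab l a b M') i (z *m pull_mx R 4 3 l.+1).
  apply/chart_slabT; rewrite slab_time_pull mul_pull_mx row_mxKr.
  by have [? ?] := time_range; split => //; exact: chart_base.
have pullE l : (forall k : 'I_3, (k < l)%N -> v 0 (lshift 4 k) = 0) ->
    v *m pull_mx R 4 3 l = 0.
  move=> vk; rewrite mul_pull_mx v0; apply/rowP => c; rewrite [RHS]mxE -(splitK c).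
  case: (fintype.split c) => d; rewrite /unsplit ?row_mxEl ?row_mxEr ?mxE//.
  rewrite big1// => k _; rewrite !mxE.
  case: (ltnP k l) => kl; first by rewrite vk// mul0r.
  by rewrite andbF mulr0.
have ot (k : 'I_3) : (k < 1)%N -> v 0 (lshift 4 k) = 0.
  by move=> k1; rewrite -[RHS]vt; congr (v _ (lshift _ _)); apply: val_inj; case: k k1 => -[].
have ox : v 0 (lshift 4 (@Ordinal 3 1 isT)) = 0.
  have := vx; rewrite /thx /pull_prod /= -/(pull_mx R 4 3 1) (pullE 1%N ot).
  rewrite at0 ?addr0//; case: fx => ax _ _.
  exact: (ax _ _ (slabz 0%N)).
have o2 (k : 'I_3) : (k < 2)%N -> v 0 (lshift 4 k) = 0.
  case: k => -[|[|//]] hk _; first by apply: ot.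
  by rewrite -[RHS]ox; congr (v _ (lshift _ _)); apply: val_inj.
have oy : v 0 (lshift 4 (@Ordinal 3 2 isT)) = 0.
  have := vy; rewrite /thy /pull_prod /= -/(pull_mx R 4 3 2) (pullE 2%N o2).
  rewrite at0 ?addr0//; case: fy => ay _ _.
  exact: (ay _ _ (slabz 1%N)).
rewrite -[v]hsubmxK v0 (_ : lsubmx v = 0) ?row_mx0//.
apply/rowP => -[[|[|[|//]]] hk]; rewrite !mxE; [exact: ot|exact: o2|].
by rewrite -[RHS]oy; congr (v _ (lshift _ _)); apply: val_inj.
Qed.

Lemma ansatz_g2_at :
  exists e, g2_coframe (phi i z) e /\ psi i z = @hodge R 3 4 e (phi i z).
Proof.
have [f0 [f1 [f2 [f3 [[E1 E2 E3 E0] [[a0' a1 a2 a3] fker]]]]]] := frame_at.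
have [ta tb] := time_range.
have [e [[eU phiE] psiE]] := @ansatz_coframe R f0 f1 f2 f3 (dt i z) (thx i z) (thy i z)
  t (r + s * t) (p + q * t) (lt_trans a0 ta) (pos ta tb)
  (And4 a0' a1 a2 a3)
  (And3 (is_form_alternating_at is_form_dt) (is_form_alternating_at is_form_thx) (is_form_alternating_at is_form_thy))
  (fun v vf vt => coframe_kernel (fker v vf) vt).
have twE : tw i z = (r + s * t + (p + q * t)) \*o (f0 ∧ f1) \+
    (r + s * t - (p + q * t)) \*o (f2 ∧ f3).
  by rewrite !wedge_ext; exact: (@ansatz_w1E _ _ j0 z p q r s (W_ w0 i) (W_ w1 i) _ _ _ _ E0 E1).
have cDt : cD.[t] = (r + s * t) ^+ 2 - (p + q * t) ^+ 2.
  by rewrite /cD hornerD hornerN !horner_exp /cH /cP !hornerE.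
have ph : phi i z = g2_form e.
  rewrite -phiE /phi -twE E2 E3 -/t (hornerM 'X cD) hornerX cDt.
  by [].
exists e; split; first by split.
rewrite ph hodge_g2_form// psiE /psi -twE E1 E2 E3 -/t.
rewrite (hornerM _ cD) hornerM hornerN (hornerM 'X cD) !horner_exp !hornerX hornerC cDt.
apply/funext => v /=.
suff -> : ((f0 ∧ f1 \+ f2 ∧ f3) ∧ (f0 ∧ f1 \+ f2 ∧ f3)) v = 2 * (f0 ∧ f1 ∧ f2 ∧ f3) v.
  by congr (_ + _ + _ + _); field.
rewrite !wedge_ext !ext_linear !ext_wordE /= !word4_dup.
rewrite (word4C23 f2 f3 f0) (word4C12 f2 f0) opprK (word4C34 f0 f2 f3).
by rewrite (word4C23 f0 f2 f1) opprK; ring.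
Qed.

Lemma ansatz_closed_at : exd (phi i) z = (fun=> 0) /\ exd (psi i) z = (fun=> 0).
Proof.
have [f0 [f1 [f2 [f3 [[E1 E2 E3 E0] _]]]]] := frame_at.
have pJ : [/\ parallel g0 J1, parallel g0 J2 & parallel g0 J3] by case: HK.
have [p1 p2 p3] := pJ.
have d0 := exd_pull closed_w0.
have d1 := exd_pull (parallel_fund_closed hk_riemannian hk_acs1 p1).
have d2 := exd_pull (parallel_fund_closed hk_riemannian hk_acs2 p2).
have d3 := exd_pull (parallel_fund_closed hk_riemannian hk_acs3 p3).
have n0 := form_near_pull (skew_w0 (i := i)) form_w0.
have n1 := form_near_fund hk_acs1 (is_form_fund 0).
have n2 := form_near_fund hk_acs2 (is_form_fund 1).
have n3 := form_near_fund hk_acs3 (is_form_fund 2).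
have nx := form_near_1form is_form_thx; have ny := form_near_1form is_form_thy.
split.
  exact: (ansatz_closed j0 r n0 n1 n2 n3 nx ny d0 d1 d2 d3 exd_thx exd_thy E0 E1 E2 E3).
exact: (ansatz_coclosed j0 r n0 n1 n2 n3 nx ny d0 d1 d2 d3 exd_thx exd_thy E0 E1 E2 E3).
Qed.

End AtPoint.

(** The polynomials in t in phi are rewritten as the given coefficients. *)
Theorem ansatz_torsion_free : torsion_free_g2 W
  (g2_ansatz
    (fun i z => (p + q * time z) \*o pull_base 3 w0 i z \+
                (r + s * time z) \*o pull_base 3 w1 i z)
    w2 w3 (fun t => t * ((r + s * t) ^+ 2 - (p + q * t) ^+ 2)) etaN xiP).
Proof.
set A := g2_ansatz _ _ _ _ _ _.
have -> : A = phi.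
  apply/funext => i; apply/funext => z.
  have cPE x : cP.[x] = p + q * x by rewrite /cP !hornerE.
  have cHE x : cH.[x] = r + s * x by rewrite /cH !hornerE.
  have cDE x : cD.[x] = (r + s * x) ^+ 2 - (p + q * x) ^+ 2.
    by rewrite /cD hornerD hornerN !horner_exp cPE cHE.
  rewrite /A /g2_ansatz /phi /tw /ansatz_w1 (hornerM 'X cD) hornerX.
  rewrite cPE cHE cDE /time -/j0.
  rewrite (_ : dcoord 4 (@Ordinal 3 0 isT) = dt i z)//.
  by apply/funext => v; congr (v _ (lshift _ _)); apply: val_inj.
split.
- split; first exact: is_form_phi.
  by move=> i z Wz; have [e [? _]] := ansatz_g2_at Wz; exists e.
- by move=> i z Wz; rewrite /ext_d (ansatz_closed_at Wz).1.
- exists psi; split; first exact: is_form_psi.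
    by move=> i z Wz; have [e [? ?]] := ansatz_g2_at Wz; exists e.
  by move=> i z Wz; rewrite /ext_d (ansatz_closed_at Wz).2.
Qed.

End Assembly.

(** * The two families *)

Theorem theorem2 (R : realType) (M : manifold R 4) (g0 J1 J2 J3 : mx_field M)
    (HK : hyperkahler g0 J1 J2 J3) :
  let w1 := fund_form g0 J1 in
  let w2 := fund_form g0 J2 in
  let w3 := fund_form g0 J3 in
  (forall (r s a : R) (b : \bar R) (M' : set M)
      (etaN : form_field (prod_manifold 2 M) 1)
      (xiP : form_field (prod_manifold 1 M) 1),
    0 < a ->
    (forall t : R, a < t -> (t%:E < b)%E -> 0 < r + s * t) ->
    suitable a b M' w2 (fun i z => s \*o w1 i z) etaN xiP ->
    torsion_free_g2 (slab 2 a b M')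
      (g2_ansatz
        (fun i z => (r + s * time z) \*o pull_base 3 w1 i z)
        w2 w3
        (fun t => t * (r + s * t) ^+ 2)
        etaN xiP))
  /\
  (forall (I : mx_field M), almost_kahler g0 I ->
    let w0 := fund_form g0 I in
    form_eq setT (fun i z => w0 i z ∧ w0 i z) (fun i z v => - (w1 i z ∧ w1 i z) v) ->
    forall (p q r s a : R) (b : \bar R) (M' : set M)
      (etaN : form_field (prod_manifold 2 M) 1)
      (xiP : form_field (prod_manifold 1 M) 1),
    0 < a ->
    (forall t : R, a < t -> (t%:E < b)%E -> `|p + q * t| < r + s * t) ->
    suitable a b M' w2 (fun i z => q \*o w0 i z \+ s \*o w1 i z) etaN xiP ->
    torsion_free_g2 (slab 2 a b M')
      (g2_ansatz
        (fun i z => (p + q * time z) \*o pull_base 3 w0 i z \+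
                    (r + s * time z) \*o pull_base 3 w1 i z)
        w2 w3
        (fun t => t * ((r + s * t) ^+ 2 - (p + q * t) ^+ 2))
        etaN xiP)).
Proof.
move=> w1 w2 w3; have rg : is_riemannian g0 by case: HK.
have oJ1 : orthogonal_acs g0 J1 by case: HK => _ [].
have pJ1 : parallel g0 J1 by case: HK => _ _ [].
have skewJ J i z : orthogonal_acs g0 J -> chart_set setT i z ->
    skew_form (fund_form g0 J i z).
  by move=> oJ iz; apply: fund_mx_skew;
    [exact: metric_at rg _ _ iz|exact: complex_at oJ _ _ iz].
(* Here w1 itself plays the part of w0, with coefficient 0. *)
split=> [r s a b M' etaN xiP a0 pos suit|].
  have := @ansatz_torsion_free R M g0 J1 J2 J3 HK w1 0 0 r s a b M' etaN xiP.
  move=> /(_ (fund_form_is_form rg oJ1) (fun i z => skewJ _ i z oJ1)).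
  move=> /(_ (parallel_fund_closed rg oJ1 pJ1) a0) H.
  have -> : (fun i z => (r + s * time z) \*o pull_base 3 w1 i z) =
      (fun i z => (0 + 0 * time z) \*o pull_base 3 w1 i z \+
                  (r + s * time z) \*o pull_base 3 w1 i z).
    apply/funext => i; apply/funext => z; apply/funext => v /=.
    by rewrite mul0r addr0 mul0r add0r.
  have -> : (fun t => t * (r + s * t) ^+ 2) =
      (fun t => t * ((r + s * t) ^+ 2 - (0 + 0 * t) ^+ 2)).
    by apply/funext => t; rewrite mul0r addr0 expr0n subr0.
  apply: H.
  - by move=> t ta tb; rewrite mul0r addr0 normr0; exact: pos.
  - rewrite (_ : (fun i z => 0 \*o w1 i z \+ s \*o w1 i z) = fun i z => s \*o w1 i z)//.
    apply/funext => i; apply/funext => z; apply/funext => v /=.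
    by rewrite mul0r add0r.
  - move=> i z iz.
    have d0 : (delta_mx 0 0 : 'rV[R]_4) != 0.
      by apply/eqP => /matrixP/(_ 0 0); rewrite !mxE /=; lra.
    have [_ [E aE _]] := adapted_frame_from (hyperkahler_at rg HK iz) d0.
    exists E => // c c0; have -> : c = 0 by case: c0.
    by apply/funext => v /=; rewrite !mul0r.
move=> I [oI cI] w0 opp p q r s a b M' etaN xiP a0 pos suit.
apply: (@ansatz_torsion_free R M g0 J1 J2 J3 HK w0) => //.
- exact: fund_form_is_form.
- by move=> i z; exact: skewJ.
- move=> i z iz.
  have [E aE IE] := almost_kahler_frame (hyperkahler_at rg HK iz)
    (complex_at oI iz) (opp i z iz).
  exists E => // c _; rewrite [w0 i z](fund_mx_skew_mx (frame_unit aE.1) IE).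
  by apply/funext => v /=; ring.
Qed.
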